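(* Let $\mathfrak{k}\subset\mathfrak{g}^{\widehat{\boldsymbol z}}$ be a Lie subalgebra isotropic with respect to $\langle\!\langle\cdot,\cdot\rangle\!\rangle_\omega$ and $K\subset G^{\widehat{\boldsymbol z}}$ the corresponding connected Lie subgroup. The forgetful functor $\pi:\mathfrak F_{\rm Lax}(X)\to\mathfrak F_{\rm 2d}(\Sigma)$, $(\mathcal L,h)\mapsto h$, is an equivalence of groupoids if and only if for each $h\in C^\infty(\Sigma,G^{\widehat{\boldsymbol z}})$ there exists a unique $\mathcal L\in\Omega^{1,0,0}_{\rm adm}(X,\mathfrak g)$ such that $(\mathcal L,h)\in\mathfrak F_{\rm Lax}(X)$, i.e. such that ${}^{h^{-1}}(\boldsymbol j^*\mathcal L)\in\Omega^1(\Sigma,\mathfrak k)$.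
   Context: Setting. $G\subseteq \mathrm{GL}_N(\mathbb C)$ is a simply connected matrix Lie group over $\mathbb C$ with Lie algebra $\mathfrak g$, and $\langle\cdot,\cdot\rangle$ is a fixed non-degenerate invariant symmetric $\mathbb C$-bilinear form on $\mathfrak g$. $\omega$ is a meromorphic $1$-form on $\mathbb CP^1$ with finite set of zeroes $\boldsymbol\zeta$, $|\boldsymbol\zeta|\ge 1$, and finite set of poles $\boldsymbol z$; $m_y\ge1$ is the order of the zero $y\in\boldsymbol\zeta$ and $n_x\ge 1$ the order of the pole $x\in\boldsymbol z$. Put $\Sigma=\mathbb R^2$, $C=\mathbb CP^1\setminus\boldsymbol\zeta$, $X=\Sigma\times C$. Fix a global holomorphic coordinate $z:C\to\mathbb C$ and write $\omega=\sum_{x\in\boldsymbol z}\sum_{p=0}^{n_x-1}\frac{k^x_p\,dz}{(z-x)^{p+1}}$, $k^x_p\in\mathbb C$. Let $\iota_x:\Sigma\cong\Sigma\times\{x\}\hookrightarrow X$ be the inclusion. $\Omega^{r,0,0}(X,\mathfrak g)$ is the space of smooth $\mathfrak g$-valued $r$-forms on $X$ having only $\Sigma$-legs (no $dz$, $d\bar z$ components), and $d_\Sigma$ is the de Rham differential along $\Sigma$. Defect group. $\mathcal T^{n_x}_x=\mathbb C[\varepsilon_x]/(\varepsilon_x^{n_x})$. $G^{\widehat{\boldsymbol z}}$ is the product over $x\in\boldsymbol z$ of the Lie groups of $(n_x-1)$-jets of curves in $G$, regarded as a subgroup of $\prod_x\mathrm{GL}_N(\mathcal T^{n_x}_x)$;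 its Lie algebra is $\mathfrak g^{\widehat{\boldsymbol z}}=\prod_x\mathfrak g\otimes_{\mathbb C}\mathcal T^{n_x}_x$. The form $\langle\!\langle\cdot,\cdot\rangle\!\rangle_\omega$ on $\mathfrak g^{\widehat{\boldsymbol z}}$ is the orthogonal direct sum of the forms $\langle Y\otimes\varepsilon_x^p,Z\otimes\varepsilon_x^q\rangle=k^x_{p+q}\langle Y,Z\rangle$ (with $k^x_m=0$ for $m\ge n_x$). For a $\mathfrak g$-valued form $\eta$ on $X$, $\boldsymbol j^*\eta=\big(\sum_{p=0}^{n_x-1}\frac1{p!}\iota_x^*(\partial_z^p\eta)\otimes\varepsilon_x^p\big)_{x\in\boldsymbol z}$. For $k\in C^\infty(\Sigma,G^{\widehat{\boldsymbol z}})$ and $a\in\Omega^1(\Sigma,\mathfrak g^{\widehat{\boldsymbol z}})$, ${}^ka=-d_\Sigma k\,k^{-1}+kak^{-1}$. Admissible forms. $\Omega^{r,0,0}_{\mathcal M}(X,\mathfrak g)\subset\Omega^{r,0,0}(X,\mathfrak g)$ is the subspace of forms that are meromorphic on $\mathbb CP^1$ (in the $C$ direction) with poles at each $y\in\boldsymbol\zeta$ of order at most $m_y$. $\mathcal L\in\Omega^{1,0,0}_{\mathcal M}(X,\mathfrak g)$ is admissible if $F_\Sigma(\mathcal L)=d_\Sigma\mathcal L+\frac12[\mathcal L,\mathcal L]\in\Omega^{2,0,0}_{\mathcal M}(X,\mathfrak g)$; $\Omega^{1,0,0}_{\rm adm}(X,\mathfrak g)$ is the set of admissible forms. Groupoids.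 $\mathfrak F_{\rm Lax}(X)$: objects are $(\mathcal L,h)\in\Omega^{1,0,0}_{\rm adm}(X,\mathfrak g)\times C^\infty(\Sigma,G^{\widehat{\boldsymbol z}})$ with ${}^{h^{-1}}(\boldsymbol j^*\mathcal L)\in\Omega^1(\Sigma,\mathfrak k)$; morphisms are $(g,k):(\mathcal L,h)\to({}^g\mathcal L,\Delta(g)hk^{-1})$ with $g\in C^\infty(\Sigma,G)$, $k\in C^\infty(\Sigma,K)$, where $g$ is identified with its pullback to $X$, ${}^g\mathcal L=-d_\Sigma g\,g^{-1}+g\mathcal Lg^{-1}$, and $\Delta:G\to G^{\widehat{\boldsymbol z}}$, $g\mapsto(g)_{x\in\boldsymbol z}$, is the diagonal map (constant jets). $\mathfrak F_{\rm 2d}(\Sigma)$: objects are $h\in C^\infty(\Sigma,G^{\widehat{\boldsymbol z}})$; morphisms are $(g,k):h\to\Delta(g)hk^{-1}$ with $g\in C^\infty(\Sigma,G)$, $k\in C^\infty(\Sigma,K)$. The functor $\pi$ sends $(\mathcal L,h)$ to $h$ and a morphism $(g,k)$ to $(g,k)$. *)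

(* Defs.v *)
From HB Require Import structures.
#[warnings="-all"] From mathcomp Require Import all_boot all_order all_algebra.
#[warnings="-all"] From mathcomp Require Import all_classical all_reals.
#[warnings="-all"] From mathcomp Require Import topology normedtype derive sequences.
#[warnings="-all"] From mathcomp Require Import qpoly complex.
Set Implicit Arguments.
Unset Strict Implicit.
Unset Printing Implicit Defensive.
Import Order.TTheory GRing.Theory Num.Theory numFieldNormedType.Exports.
Local Open Scope classical_set_scope.
Local Open Scope complex_scope.
Local Open Scope ring_scope.

Record groupoid := Groupoid {
  ob : Type;
  hom : ob -> ob -> Type;
  idg : forall a, hom a a;
  cmp : forall a b c, hom a b -> hom b c -> hom a c;
  ivg : forall a b, hom a b -> hom b a;
  cmp1g : forall a b (f : hom a b), cmp (idg a) f = f;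
  cmpg1 : forall a b (f : hom a b), cmp f (idg b) = f;
  cmpA : forall a b c d (f : hom a b) (g : hom b c) (h : hom c d),
    cmp f (cmp g h) = cmp (cmp f g) h;
  cmpgV : forall a b (f : hom a b), cmp f (ivg f) = idg a;
  cmpVg : forall a b (f : hom a b), cmp (ivg f) f = idg b }.

Record functor (A B : groupoid) := Functor {
  fob : ob A -> ob B;
  fmap : forall a b, hom a b -> hom (fob a) (fob b);
  fmap1 : forall a, fmap (idg a) = idg (fob a);
  fmapM : forall a b c (f : hom a b) (g : hom b c),
    fmap (cmp f g) = cmp (fmap f) (fmap g) }.

Definition functor_id (A : groupoid) : functor A A :=
  @Functor A A id (fun _ _ f => f) (fun _ => erefl) (fun _ _ _ _ _ => erefl).

Lemma functor_comp1 (A B D : groupoid) (F : functor A B) (Q : functor B D) a :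
  fmap Q (fmap F (idg a)) = idg (fob Q (fob F a)).
Proof. by rewrite fmap1 fmap1. Qed.

Lemma functor_compM (A B D : groupoid) (F : functor A B) (Q : functor B D)
    a b c (f : hom a b) (g : hom b c) :
  fmap Q (fmap F (cmp f g)) = cmp (fmap Q (fmap F f)) (fmap Q (fmap F g)).
Proof. by rewrite fmapM fmapM. Qed.

Definition functor_comp (A B D : groupoid) (F : functor A B) (Q : functor B D) :
    functor A D :=
  @Functor A D (fun a => fob Q (fob F a)) (fun _ _ f => fmap Q (fmap F f))
    (functor_comp1 F Q) (functor_compM F Q).

(* Between functors of groupoids every natural transformation is invertible. *)
Definition naturally_isomorphic (A B : groupoid) (F Q : functor A B) : Prop :=
  exists eta : forall a, hom (fob F a) (fob Q a),
    forall a b (f : hom a b), cmp (fmap F f) (eta b) = cmp (eta a) (fmap Q f).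

Definition is_equivalence (A B : groupoid) (F : functor A B) : Prop :=
  exists Q : functor B A,
    naturally_isomorphic (functor_comp F Q) (functor_id A) /\
    naturally_isomorphic (functor_comp Q F) (functor_id B).

Section Smooth.
Context {R : realType} {V : normedModType R}.

(* [C^k] on an open set [U] of a finite-dimensional space, in terms of all the
   directional derivatives. *)
Fixpoint Ck (U : set V) (k : nat) (f : V -> R) : Prop :=
  (forall v, U v -> {for v, continuous f}) /\
  (if k is k'.+1 then
     forall w, (forall v, U v -> derivable f v w) /\ Ck U k' ('D_w f)
   else True).

Definition smooth_on (U : set V) (f : V -> R[i]) : Prop :=
  forall k, Ck U k (fun v => complex.Re (f v)) /\ Ck U k (fun v => complex.Im (f v)).

Definition smooth (f : V -> R[i]) : Prop := smooth_on setT f.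

Definition Ddir (w : V) (f : V -> R[i]) (v : V) : R[i] :=
  'D_w (fun u => complex.Re (f u)) v +i* 'D_w (fun u => complex.Im (f u)) v.

Arguments Ck : simpl never.

Lemma Ck_continuous k (f : V -> R) v : Ck setT k f -> {for v, continuous f}.
Proof. by case: k => [|k] [cf _]; apply: cf. Qed.

Lemma Ck_derivable k (f : V -> R) v w : Ck setT k.+1 f -> derivable f v w.
Proof. by move=> [_ /(_ w)[df _]]; apply: df. Qed.

Lemma CkW k (f : V -> R) : Ck setT k.+1 f -> Ck setT k f.
Proof.
elim: k f => [|k IH] f; first by case.
by case=> cf df; split=> // w; have [d1 d2] := df w; split=> //; apply: IH.
Qed.

Lemma Ck_cst k (c : R) : Ck setT k (fun _ : V => c).
Proof.
elim: k c => [|k IH] c; split => //; try by move=> v _; exact: cvg_cst.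
move=> w; split=> [v _|]; first exact: derivable_cst.
suff -> : 'D_w (fun _ : V => c) = (fun _ => 0) by exact: IH.
by apply/funext => v; rewrite derive_cst.
Qed.

Lemma CkD k (f g : V -> R) : Ck setT k f -> Ck setT k g ->
  Ck setT k (fun v => f v + g v).
Proof.
elim: k f g => [|k IH] f g Hf Hg.
  by split=> // v _; apply: continuousD; [exact: (Ck_continuous Hf)|exact: (Ck_continuous Hg)].
split=> [v _|w].
  by apply: continuousD; [exact: (Ck_continuous Hf)|exact: (Ck_continuous Hg)].
split=> [v _|].
  by apply: (@derivableD _ _ _ f g); [exact: (Ck_derivable Hf)|exact: (Ck_derivable Hg)].
have -> : 'D_w (fun v => f v + g v) = fun v => 'D_w f v + 'D_w g v.
  apply/funext => v; apply: (@deriveD _ _ _ f g);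
    [exact: (Ck_derivable Hf)|exact: (Ck_derivable Hg)].
by apply: IH; [case: Hf => _ /(_ w)[]|case: Hg => _ /(_ w)[]].
Qed.

Lemma CkM k (f g : V -> R) : Ck setT k f -> Ck setT k g ->
  Ck setT k (fun v => f v * g v).
Proof.
elim: k f g => [|k IH] f g Hf Hg.
  by split=> // v _; apply: continuousM; [exact: (Ck_continuous Hf)|exact: (Ck_continuous Hg)].
split=> [v _|w].
  by apply: continuousM; [exact: (Ck_continuous Hf)|exact: (Ck_continuous Hg)].
split=> [v _|].
  by apply: (@derivableM _ _ f g); [exact: (Ck_derivable Hf)|exact: (Ck_derivable Hg)].
have -> : 'D_w (fun v => f v * g v) = fun v => f v * 'D_w g v + g v * 'D_w f v.
  apply/funext => v; apply: (@deriveM _ _ f g);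
    [exact: (Ck_derivable Hf)|exact: (Ck_derivable Hg)].
apply: CkD; apply: IH; try exact: CkW.
- by case: Hg => _ /(_ w)[].
- by case: Hf => _ /(_ w)[].
Qed.

Lemma CkV k (f : V -> R) : (forall v, f v != 0) -> Ck setT k f ->
  Ck setT k (fun v => (f v)^-1).
Proof.
move=> f0; elim: k => [|k IH] Hf.
  by split=> // v _; apply: continuousV => //; exact: (Ck_continuous Hf).
split=> [v _|w].
  by apply: continuousV => //; exact: (Ck_continuous Hf).
split=> [v _|].
  by apply: (@derivableV _ _ f) => //; exact: (Ck_derivable Hf).
have -> : 'D_w (fun v => (f v)^-1) = fun v => (-1 * ((f v)^-1 * (f v)^-1)) * 'D_w f v.
  apply/funext => v; rewrite (@deriveV _ _ f) //; last exact: (Ck_derivable Hf).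
  by rewrite /GRing.scale /= -exprVn expr2 mulN1r.
apply: CkM; last by case: Hf => _ /(_ w)[].
apply: CkM; first exact: Ck_cst.
by apply: CkM; apply: IH; apply: CkW.
Qed.

Lemma smooth_cst (c : R[i]) : smooth (fun _ : V => c).
Proof. by move=> k; split; exact: Ck_cst. Qed.

Lemma smoothD (f g : V -> R[i]) : smooth f -> smooth g ->
  smooth (fun v => f v + g v).
Proof.
move=> Hf Hg k; have [f1 f2] := Hf k; have [g1 g2] := Hg k; split.
- have -> : (fun v => complex.Re (f v + g v)) =
    fun v => complex.Re (f v) + complex.Re (g v).
    by apply/funext => v; case: (f v) (g v) => [? ?] [? ?].
  exact: CkD.
- have -> : (fun v => complex.Im (f v + g v)) =
    fun v => complex.Im (f v) + complex.Im (g v).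
    by apply/funext => v; case: (f v) (g v) => [? ?] [? ?].
  exact: CkD.
Qed.

Lemma ReM (a b : R[i]) : complex.Re (a * b) =
  complex.Re a * complex.Re b + -1 * (complex.Im a * complex.Im b).
Proof. by case: a b => [a1 a2] [b1 b2] /=; rewrite mulN1r. Qed.

Lemma ImM (a b : R[i]) : complex.Im (a * b) =
  complex.Re a * complex.Im b + complex.Im a * complex.Re b.
Proof. by case: a b => [a1 a2] [b1 b2]. Qed.

Lemma smoothM (f g : V -> R[i]) : smooth f -> smooth g ->
  smooth (fun v => f v * g v).
Proof.
move=> Hf Hg k; have [f1 f2] := Hf k; have [g1 g2] := Hg k; split.
- under eq_fun do rewrite ReM.
  by apply: CkD; [|apply: CkM; [exact: Ck_cst|]]; apply: CkM.
- under eq_fun do rewrite ImM.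
  by apply: CkD; apply: CkM.
Qed.

Lemma smoothV (f : V -> R[i]) : (forall v, f v != 0) -> smooth f ->
  smooth (fun v => (f v)^-1).
Proof.
move=> f0 Hf k; have [f1 f2] := Hf k.
pose n2 v := complex.Re (f v) * complex.Re (f v) + complex.Im (f v) * complex.Im (f v).
have n20 v : n2 v != 0.
  have := f0 v; rewrite /n2 eq_complex negb_and /= -!expr2.
  by rewrite paddr_eq0 ?sqr_ge0 // !sqrf_eq0 negb_and.
have Hn : Ck setT k (fun v => (n2 v)^-1).
  by apply: CkV => //; apply: CkD; apply: CkM.
split.
- have -> : (fun v => complex.Re (f v)^-1) = fun v => complex.Re (f v) * (n2 v)^-1.
    by apply/funext => v; rewrite /n2 -!expr2; case: (f v).
  exact: CkM.
- have -> : (fun v => complex.Im (f v)^-1) =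
      fun v => -1 * (complex.Im (f v) * (n2 v)^-1).
    apply/funext => v; rewrite /n2 -!expr2; case: (f v) => a b /=.
    by rewrite mulN1r.
  by apply: CkM; [exact: Ck_cst|exact: CkM].
Qed.

Lemma DdirC (w : V) (c : R[i]) v : Ddir w (fun _ => c) v = 0.
Proof. by rewrite /Ddir !derive_cst. Qed.

Lemma complex_eq (a b : R[i]) : complex.Re a = complex.Re b ->
  complex.Im a = complex.Im b -> a = b.
Proof. by case: a b => [? ?] [? ?] /= -> ->. Qed.

Lemma derive_ReD (w : V) (f g : V -> R) v : Ck setT 1 f -> Ck setT 1 g ->
  'D_w (fun u => f u + g u) v = 'D_w f v + 'D_w g v.
Proof.
move=> Hf Hg.
exact: (@deriveD _ _ _ f g v w (Ck_derivable Hf) (Ck_derivable Hg)).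
Qed.

Lemma derive_ReM (w : V) (f g : V -> R) v : Ck setT 1 f -> Ck setT 1 g ->
  'D_w (fun u => f u * g u) v = 'D_w f v * g v + f v * 'D_w g v.
Proof.
move=> Hf Hg.
rewrite (@deriveM _ _ f g v w (Ck_derivable Hf) (Ck_derivable Hg)).
by rewrite /GRing.scale /= addrC (mulrC (g v)).
Qed.

Lemma derive_ReN (w : V) (f : V -> R) v : Ck setT 1 f ->
  'D_w (fun u => -1 * f u) v = - 'D_w f v.
Proof.
by move=> Hf; rewrite (derive_ReM w v (Ck_cst _ _) Hf) derive_cst mul0r add0r mulN1r.
Qed.

Lemma DdirD (w : V) (f g : V -> R[i]) v : smooth f -> smooth g ->
  Ddir w (fun u => f u + g u) v = Ddir w f v + Ddir w g v.
Proof.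
move=> Hf Hg; have [f1 f2] := Hf 1%N; have [g1 g2] := Hg 1%N.
apply: complex_eq.
- rewrite [RHS]/= -(derive_ReD w v f1 g1) [LHS]/=; congr ('D_w _ v).
  by apply/funext => u; case: (f u) (g u) => [? ?] [? ?].
- rewrite [RHS]/= -(derive_ReD w v f2 g2) [LHS]/=; congr ('D_w _ v).
  by apply/funext => u; case: (f u) (g u) => [? ?] [? ?].
Qed.

Lemma DdirM (w : V) (f g : V -> R[i]) v : smooth f -> smooth g ->
  Ddir w (fun u => f u * g u) v = Ddir w f v * g v + f v * Ddir w g v.
Proof.
move=> Hf Hg; have [f1 f2] := Hf 1%N; have [g1 g2] := Hg 1%N.
have f1g1 := CkM f1 g1; have f2g2 := CkM f2 g2.
have f1g2 := CkM f1 g2; have f2g1 := CkM f2 g1.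
have H1 := CkM (Ck_cst 1 (-1)) f2g2.
have E1 : (fun u => complex.Re (f u * g u)) = _ :=
  funext (fun u => ReM (f u) (g u)).
have E2 : (fun u => complex.Im (f u * g u)) = _ :=
  funext (fun u => ImM (f u) (g u)).
rewrite /Ddir E1 E2.
rewrite (derive_ReD w v f1g1 H1) (derive_ReN w v f2g2) (derive_ReM w v f1 g1).
rewrite (derive_ReM w v f2 g2) (derive_ReD w v f1g2 f2g1).
rewrite (derive_ReM w v f1 g2) (derive_ReM w v f2 g1).
move: ('D_w _ v) ('D_w _ v) ('D_w _ v) ('D_w _ v) => a b c d.
case: (f v) (g v) => [p q] [r s]; apply: complex_eq => /=.
- by rewrite opprD addrACA.
- by rewrite addrACA.
Qed.

End Smooth.

Section MatrixCalculus.
Context {V : Type} {A : comUnitRingType}.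

Definition entrywise (P : (V -> A) -> Prop) m n (f : V -> 'M[A]_(m, n)) : Prop :=
  forall i j, P (fun v => f v i j).

Definition Dmx (D : (V -> A) -> V -> A) m n (f : V -> 'M[A]_(m, n)) (v : V) :
    'M[A]_(m, n) :=
  \matrix_(i, j) D (fun u => f u i j) v.

Variable P : (V -> A) -> Prop.
Hypothesis Pcst : forall c, P (fun=> c).
Hypothesis PD : forall f g, P f -> P g -> P (fun v => f v + g v).
Hypothesis PM : forall f g, P f -> P g -> P (fun v => f v * g v).
Hypothesis PV : forall f, (forall v, f v \is a GRing.unit) -> P f ->
  P (fun v => (f v)^-1).

Lemma closed_sum (I : Type) (r : seq I) (F : I -> V -> A) :
  (forall i, P (F i)) -> P (fun v => \sum_(i <- r) F i v).
Proof.
move=> PF; elim: r => [|i r IH].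
  suff -> : (fun v => \sum_(i <- [::]) F i v) = fun=> 0 by exact: Pcst.
  by apply/funext => v; rewrite big_nil.
suff -> : (fun v => \sum_(i <- i :: r) F i v) =
    fun v => F i v + \sum_(i <- r) F i v by exact: PD.
by apply/funext => v; rewrite big_cons.
Qed.

Lemma closed_prod (I : Type) (r : seq I) (F : I -> V -> A) :
  (forall i, P (F i)) -> P (fun v => \prod_(i <- r) F i v).
Proof.
move=> PF; elim: r => [|i r IH].
  suff -> : (fun v => \prod_(i <- [::]) F i v) = fun=> 1 by exact: Pcst.
  by apply/funext => v; rewrite big_nil.
suff -> : (fun v => \prod_(i <- i :: r) F i v) =
    fun v => F i v * \prod_(i <- r) F i v by exact: PM.
by apply/funext => v; rewrite big_cons.
Qed.

Lemma entrywise_cst m n (M : 'M[A]_(m, n)) : entrywise P (fun=> M).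
Proof. by move=> i j; exact: Pcst. Qed.

Lemma entrywiseM m n p (f : V -> 'M[A]_(m, n)) (g : V -> 'M[A]_(n, p)) :
  entrywise P f -> entrywise P g -> entrywise P (fun v => f v *m g v).
Proof.
move=> Pf Pg i j; under eq_fun do rewrite mxE.
by apply: closed_sum => k; exact: PM.
Qed.

Lemma closed_det n (f : V -> 'M[A]_n) : entrywise P f -> P (fun v => \det (f v)).
Proof.
move=> Pf; rewrite /determinant; apply: closed_sum => s; apply: PM => //.
by apply: closed_prod => i; exact: Pf.
Qed.

Lemma entrywiseV n (f : V -> 'M[A]_n) : (forall v, f v \in unitmx) ->
  entrywise P f -> entrywise P (fun v => invmx (f v)).
Proof.
move=> fU Pf i j.
have -> : (fun v => invmx (f v) i j) =
    fun v => (\det (f v))^-1 * ((-1) ^+ (j + i) * \det (row' j (col' i (f v)))).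
  by apply/funext => v; rewrite /invmx fU !mxE.
apply: PM; first by apply: PV; [move=> v; rewrite -unitmxE|exact: closed_det].
apply: PM => //; apply: closed_det => a b.
by under eq_fun do rewrite !mxE.
Qed.

Variable D : (V -> A) -> V -> A.
Hypothesis Dcst : forall c v, D (fun=> c) v = 0.
Hypothesis DD : forall f g v, P f -> P g ->
  D (fun u => f u + g u) v = D f v + D g v.
Hypothesis DM : forall f g v, P f -> P g ->
  D (fun u => f u * g u) v = D f v * g v + f v * D g v.

Lemma D_sum (I : Type) (r : seq I) (F : I -> V -> A) v :
  (forall i, P (F i)) ->
  D (fun u => \sum_(i <- r) F i u) v = \sum_(i <- r) D (F i) v.
Proof.
move=> PF; elim: r => [|i r IH].
  by rewrite big_nil; under eq_fun do rewrite big_nil; exact: Dcst.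
rewrite big_cons -IH -DD //; last exact: closed_sum.
by under eq_fun do rewrite big_cons.
Qed.

Lemma Dmx_cst m n (M : 'M[A]_(m, n)) v : Dmx D (fun=> M) v = 0.
Proof. by apply/matrixP => i j; rewrite !mxE Dcst. Qed.

Lemma DmxM m n p (f : V -> 'M[A]_(m, n)) (g : V -> 'M[A]_(n, p)) v :
  entrywise P f -> entrywise P g ->
  Dmx D (fun u => f u *m g u) v = Dmx D f v *m g v + f v *m Dmx D g v.
Proof.
move=> Pf Pg; apply/matrixP => i j; rewrite !mxE.
under [X in D X v]eq_fun do rewrite mxE.
rewrite D_sum; last by move=> k; exact: PM.
rewrite -big_split /=; apply: eq_bigr => k _.
by rewrite DM // !mxE.
Qed.

End MatrixCalculus.

Definition trunc (R : realType) (n : nat) := {poly %/ ('X^n : {poly R[i]})}.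

Section Truncated.
Context {R : realType}.

Definition tcoef n (a : trunc R n) (p : nat) : R[i] := (a : {poly R[i]})`_p.

Definition to_trunc n (a : nat -> R[i]) : trunc R n :=
  in_qpoly 'X^n (\poly_(p < n) a p).

Definition jet_mx n N (a : nat -> 'M[R[i]]_N) : 'M[trunc R n]_N :=
  \matrix_(i, j) to_trunc n (fun p => a p i j).

Definition coef_mx n N (a : 'M[trunc R n]_N) (p : nat) : 'M[R[i]]_N :=
  \matrix_(i, j) tcoef (a i j) p.

Definition smoothT {V : normedModType R} n (f : V -> trunc R n) : Prop :=
  forall p, smooth (fun v => tcoef (f v) p).

Definition DdirT {V : normedModType R} n (w : V) (f : V -> trunc R n) (v : V) :
    trunc R n :=
  to_trunc n (fun p => Ddir w (fun u => tcoef (f u) p) v).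

Lemma tcoef_big n (a : trunc R n) p : (n.-1 < p)%N -> tcoef a p = 0.
Proof.
move=> np; rewrite /tcoef nth_default //; apply: leq_trans np.
have E : size (mk_monic ('X^n : {poly R[i]})) = n.-1.+2.
  by rewrite mk_monic_Xn size_polyXn.
by rewrite -ltnS -[X in (_ < X)%N]E; exact: size_mk_monic.
Qed.

Lemma tcoefM n (a b : trunc R n) p : (p <= n.-1)%N ->
  tcoef (a * b) p = \sum_(i < p.+1) tcoef a i * tcoef b (p - i).
Proof.
move=> pn; rewrite /tcoef -coefM poly_of_qpolyM.
move: (polyn a * polyn b) => q; rewrite mk_monic_Xn.
rewrite [in RHS](Pdiv.RingMonic.rdivp_eq (monicXn _ n.-1.+1) q).
by rewrite coefD coefMXn ltnS pn add0r.
Qed.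

Lemma tcoef0 n (a b : trunc R n) : tcoef (a * b) 0 = tcoef a 0 * tcoef b 0.
Proof. by rewrite tcoefM // big_ord_recl big_ord0 addr0. Qed.

Context {V : normedModType R}.

Lemma smoothT_cst n (c : trunc R n) : smoothT (fun _ : V => c).
Proof. by move=> p; exact: smooth_cst. Qed.

Lemma smoothTD n (f g : V -> trunc R n) : smoothT f -> smoothT g ->
  smoothT (fun v => f v + g v).
Proof.
move=> Hf Hg p; rewrite /tcoef.
under eq_fun do rewrite poly_of_qpolyD coefD.
by apply: smoothD; [exact: Hf|exact: Hg].
Qed.

Lemma smooth_sum (I : Type) (r : seq I) (F : I -> V -> R[i]) :
  (forall i, smooth (F i)) -> smooth (fun v => \sum_(i <- r) F i v).
Proof.
by apply: (@closed_sum V R[i] smooth);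
  [exact: smooth_cst|move=> f g; exact: smoothD].
Qed.

Lemma smoothTM n (f g : V -> trunc R n) : smoothT f -> smoothT g ->
  smoothT (fun v => f v * g v).
Proof.
move=> Hf Hg p; case: (leqP p n.-1) => pn; last first.
  by under eq_fun do rewrite tcoef_big //; exact: smooth_cst.
under eq_fun do rewrite tcoefM //.
by apply: smooth_sum => i; apply: smoothM; [exact: Hf|exact: Hg].
Qed.

Lemma smoothTV n (f : V -> trunc R n) : (forall v, f v \is a GRing.unit) ->
  smoothT f -> smoothT (fun v => (f v)^-1).
Proof.
move=> fU Hf.
have f00 v : tcoef (f v) 0 != 0.
  apply/eqP => f0; have := tcoef0 (f v) (f v)^-1.
  rewrite mulrV // f0 mul0r /tcoef => /eqP.
  have -> : ((1 : trunc R n) : {poly R[i]}) = 1 by [].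
  by rewrite coefC eqxx oner_eq0.
move=> p; elim/ltn_ind: p => p IH.
case: (leqP p n.-1) => pn; last first.
  by under eq_fun do rewrite tcoef_big //; exact: smooth_cst.
have -> : (fun v => tcoef (f v)^-1 p) = fun v => (tcoef (f v) 0)^-1 *
   (tcoef (1 : trunc R n) p +
    -1 * \sum_(i < p) tcoef (f v) i.+1 * tcoef (f v)^-1 (p - i.+1)).
  apply/funext => v; rewrite -(mulrV (fU v)) tcoefM // big_ord_recl subn0.
  by rewrite mulN1r addrK mulKf.
apply: smoothM; first by apply: smoothV => //; exact: Hf.
apply: smoothD; first exact: smooth_cst.
apply: smoothM; first exact: smooth_cst.
apply: smooth_sum => i; apply: smoothM; first exact: Hf.
by apply: IH; rewrite ltn_subrL /=; case: i => i /=; case: (p).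
Qed.

End Truncated.

Section MatrixLieGroup.
Context {R : realType} {N : nat}.
Local Notation C := R[i].
Implicit Types (X Y Z : 'M[C]_N).

Definition smooth_mx {V : normedModType R} (f : V -> 'M[C]_N) : Prop :=
  entrywise smooth f.

Definition smooth_curve (S : set 'M[C]_N) (c : R -> 'M[C]_N) : Prop :=
  smooth_mx c /\ forall t, S (c t).

(* The tangent space at the identity. *)
Definition lie_algebra (S : set 'M[C]_N) : set 'M[C]_N :=
  [set X | exists c, [/\ smooth_curve S c, c 0 = 1%:M & Dmx (@Ddir R R 1) c 0 = X]].

Definition mxbracket (A : pzRingType) (n : nat) (X Y : 'M[A]_n) : 'M[A]_n :=
  X *m Y - Y *m X.

(* A closed subgroup of the general linear group; it is a Lie group over the
   complex numbers when its Lie algebra is a complex subspace. *)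
Record matrix_lie_group := MatrixLieGroup {
  mlg_set :> set 'M[C]_N;
  mlg_unit : forall g, mlg_set g -> g \in unitmx;
  mlg1 : mlg_set 1%:M;
  mlgM : forall g h, mlg_set g -> mlg_set h -> mlg_set (g *m h);
  mlgV : forall g, mlg_set g -> mlg_set (invmx g);
  mlg_closed : exists F : set 'M[C^o]_N,
    closed F /\ forall g, mlg_set g <-> F g /\ g \in unitmx;
  mlg_complex : forall X, lie_algebra mlg_set X ->
    lie_algebra mlg_set ((0 +i* 1) *: X) }.

Definition I01 : set R := [set t | 0 <= t <= 1].

Definition simply_connected (S : set 'M[C]_N) : Prop :=
  [/\ S !=set0,
      forall a b, S a -> S b -> exists c : R -> 'M[C^o]_N,
        [/\ {within I01, continuous c},
            forall t, I01 t -> S (c t), c 0 = a & c 1 = b]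
    & forall c : R -> 'M[C^o]_N,
        {within I01, continuous c} ->
        (forall t, I01 t -> S (c t)) -> c 0 = c 1 ->
      exists H : R * R -> 'M[C^o]_N,
        [/\ {within I01 `*` I01, continuous H},
            forall s t, I01 s -> I01 t -> S (H (s, t)),
            forall t, I01 t -> H (0, t) = c t,
            forall t, I01 t -> H (1, t) = c 0
          & forall s, I01 s -> H (s, 0) = c 0 /\ H (s, 1) = c 0]].

Record invariant_form (S : set 'M[C]_N) := InvariantForm {
  ivf :> 'M[C]_N -> 'M[C]_N -> C;
  ivf_linear : forall a X Y Z,
    lie_algebra S X -> lie_algebra S Y -> lie_algebra S Z ->
    ivf (a *: X + Y) Z = a * ivf X Z + ivf Y Z;
  ivf_sym : forall X Y, lie_algebra S X -> lie_algebra S Y -> ivf X Y = ivf Y X;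
  ivf_invariant : forall X Y Z,
    lie_algebra S X -> lie_algebra S Y -> lie_algebra S Z ->
    ivf (mxbracket X Y) Z = ivf X (mxbracket Y Z);
  ivf_nondegenerate : forall X, lie_algebra S X ->
    (forall Y, lie_algebra S Y -> ivf X Y = 0) -> X = 0 }.

End MatrixLieGroup.
Arguments matrix_lie_group : clear implicits.

Section OneForm.
Context {R : realType}.
Local Notation C := R[i].

(* The Riemann sphere is [option C], [None] being the point at infinity. *)
Definition local_coord (y : option C) (w : C) : C :=
  if y is Some a then a + w else w^-1.

Definition holomorphic_at (f : C -> C) (z : C) : Prop :=
  \forall w \near (z : C^o), derivable (f : C^o -> C^o) w 1.

(* The coefficient at [w] of [f dz] in the local coordinate around [y]; at
   infinity [dz = - dw / w^2]. *)
Definition local_coef (f : C -> C) (y : option C) (w : C) : C :=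
  if y is Some a then f (a + w) else - f (w^-1) / w ^+ 2.

Definition has_order (f : C -> C) (y : option C) (m : int) : Prop :=
  exists phi : C -> C, [/\ holomorphic_at phi 0, phi 0 != 0 &
    \forall w \near (0 : C^o)^', local_coef f y w = w ^ m * phi w].

Definition principal_parts (r : nat) (x : 'I_r -> C) (n : 'I_r -> nat)
    (k : 'I_r -> nat -> C) (z : C) : C :=
  \sum_i \sum_(p < n i) k i p / (z - x i) ^+ p.+1.

(* A global coordinate on the complement of the zeroes is the restriction of an
   affine coordinate of the sphere whose point at infinity is a zero; the sphere
   is identified with [option C] through it, so [None] is one of the zeroes. *)
Record one_form := OneForm {
  npole : nat;
  pole : 'I_npole -> C;
  mult : 'I_npole -> nat;
  level : 'I_npole -> nat -> C;
  zeroes : seq (option C);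
  zmult : option C -> nat;
  omega := principal_parts pole mult level;
  pole_inj : injective pole;
  mult_gt0 : forall x, (0 < mult x)%N;
  pole_order : forall x, has_order omega (Some (pole x)) (- (mult x)%:Z);
  zmult_gt0 : forall y, y \in zeroes -> (0 < zmult y)%N;
  zero_order : forall y, y \in zeroes -> has_order omega y (zmult y)%:Z;
  regular_order : forall y, y \notin zeroes -> y \notin codom (Some \o pole) ->
    has_order omega y 0;
  zero_infty : None \in zeroes }.

Arguments pole : clear implicits.
Arguments mult : clear implicits.
Arguments level : clear implicits.

Variable W : one_form.

Definition spectral := {z : C | Some z \notin zeroes W}.

(* The value outside [spectral] is junk. *)
Definition extend (u : spectral -> C) (z : C) : C :=
  if insub z is Some s then u s else 0.

(* Holomorphic on [spectral], with a pole of order at most [zmult W y] at each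
   zero [y]. *)
Definition meromorphic (u : spectral -> C) : Prop :=
  (forall z : spectral, holomorphic_at (extend u) (val z)) /\
  forall y, y \in zeroes W -> exists phi : C -> C, holomorphic_at phi 0 /\
    \forall w \near (0 : C^o)^',
      phi w = w ^+ zmult W y * extend u (local_coord y w).

End OneForm.
Arguments one_form : clear implicits.
Arguments pole {R} _ _.
Arguments mult {R} _ _.
Arguments level {R} _ _ _.

Section Defect.
Context {R : realType} {N : nat} (G : matrix_lie_group R N) (W : one_form R).
Local Notation C := R[i].
Local Notation Sigma := ('rV[R]_2).

Definition axis (i : 'I_2) : Sigma := delta_mx 0 i.

Definition defect_mx := forall x : 'I_(npole W), 'M[trunc R (mult W x)]_N.

Definition smoothJ (f : Sigma -> defect_mx) : Prop :=
  forall x, entrywise (@smoothT _ _ _) (fun s => f s x).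

Definition partialJ (i : 'I_2) (f : Sigma -> defect_mx) (s : Sigma) : defect_mx :=
  fun x => Dmx (DdirT (axis i)) (fun u => f u x) s.

Definition taylor_coef (c : R -> 'M[C]_N) (p : nat) : 'M[C]_N :=
  \matrix_(i, j)
    ((derive1n p (fun t => complex.Re (c t i j)) 0 +i*
      derive1n p (fun t => complex.Im (c t i j)) 0) / p`!%:R).

(* [G] being complex, jets of real curves are the same as jets of holomorphic
   ones. *)
Definition defect_group : set defect_mx :=
  [set a | forall x, exists c, smooth_curve G c /\ a x = jet_mx _ (taylor_coef c)].

Definition defect_algebra : set defect_mx :=
  [set a | forall x p, (p < mult W x)%N -> lie_algebra G (coef_mx (a x) p)].

Definition defect_form (B : invariant_form G) (a b : defect_mx) : C :=
  \sum_x \sum_(p < mult W x) \sum_(q < mult W x | (p + q < mult W x)%N)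
    level W x (p + q) * B (coef_mx (a x) p) (coef_mx (b x) q).

Definition isotropic (B : invariant_form G) (k : set defect_mx) : Prop :=
  forall a b, k a -> k b -> defect_form B a b = 0.

Definition lie_subalgebra (k : set defect_mx) : Prop :=
  [/\ k `<=` defect_algebra, k (fun=> 0),
      forall (l : C) a b, k a -> k b -> k (fun x => l%:A *: a x + b x)
    & forall a b, k a -> k b -> k (fun x => mxbracket (a x) (b x))].

Definition expJ (a : defect_mx) : defect_mx := fun x =>
  \matrix_(i, j) to_trunc _ (fun p =>
    limn (fun m => \sum_(l < m) tcoef ((a x ^+ l) i j) p / l`!%:R : C^o)).

Definition oneJ : defect_mx := fun=> 1%:M.
Definition mulJ (a b : defect_mx) : defect_mx := fun x => a x *m b x.
Definition invJ (a : defect_mx) : defect_mx := fun x => invmx (a x).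

(* The subgroup generated by the exponentials, i.e. the connected Lie subgroup
   with Lie algebra [k]. *)
Inductive connected_subgroup (k : set defect_mx) : defect_mx -> Prop :=
| cs_exp a : k a -> connected_subgroup k (expJ a)
| cs_one : connected_subgroup k oneJ
| cs_mul a b : connected_subgroup k a -> connected_subgroup k b ->
    connected_subgroup k (mulJ a b)
| cs_inv a : connected_subgroup k a -> connected_subgroup k (invJ a).

Inductive exp_word (k : set defect_mx) : (Sigma -> defect_mx) -> Prop :=
| ew_exp X : smoothJ X -> (forall s, k (X s)) -> exp_word k (fun s => expJ (X s))
| ew_one : exp_word k (fun=> oneJ)
| ew_mul f g : exp_word k f -> exp_word k g -> exp_word k (fun s => mulJ (f s) (g s))
| ew_inv f : exp_word k f -> exp_word k (fun s => invJ (f s)).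

(* The connected subgroup [K] need not be closed, and smoothness of a map to [K]
   refers to its Lie group structure, with charts [X |-> exp X * a] for [X] in a
   neighbourhood of [0] in [k]. As the multiplication and the inversion of [K] are
   smooth, the smooth maps to [K] are those that are, locally, words in
   exponentials of smooth [k]-valued functions. *)
Definition smoothK (k : set defect_mx) (f : Sigma -> defect_mx) : Prop :=
  [/\ smoothJ f, (forall s x, f s x \in unitmx),
      forall s, connected_subgroup k (f s)
    & forall s : Sigma, exists w, exp_word k w /\ \forall u \near s, f u = w u].

Definition smoothG (g : Sigma -> 'M[C]_N) : Prop :=
  smooth_mx g /\ forall s, mlg_set G (g s).

Definition smooth_defect (h : Sigma -> defect_mx) : Prop :=
  smoothJ h /\ forall s, defect_group (h s).

Definition Omega1 (k : set defect_mx) (a : 'I_2 -> Sigma -> defect_mx) : Prop :=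
  forall i, smoothJ (a i) /\ forall s, k (a i s).

Definition gaugeJ (f : Sigma -> defect_mx) (a : 'I_2 -> Sigma -> defect_mx) :
    'I_2 -> Sigma -> defect_mx :=
  fun i s x => - (partialJ i f s x *m invmx (f s x)) +
               f s x *m a i s x *m invmx (f s x).

Definition diagJ (g : 'M[C]_N) : defect_mx := fun x => map_mx (qpolyC _) g.

(* A form on [Sigma * C] with legs along [Sigma] only is given by its coefficients:
   two for a one-form, one for a two-form. *)
Definition coefficient := Sigma -> spectral W -> 'M[C]_N.

(* [C] is viewed as the real plane. *)
Definition surface : set (Sigma * (R * R)) :=
  [set v | Some (v.2.1 +i* v.2.2) \notin zeroes W].

Definition Omega_M (f : coefficient) : Prop :=
  [/\ forall s z, lie_algebra G (f s z),
      forall i j, smooth_on surface (fun v =>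
        extend (fun z => f v.1 z i j) (v.2.1 +i* v.2.2))
    & forall s i j, meromorphic (fun z => f s z i j)].

Definition partialL (i : 'I_2) (f : coefficient) : coefficient :=
  fun s z => Dmx (Ddir (axis i)) (fun u => f u z) s.

Definition curvature (L : 'I_2 -> coefficient) : coefficient := fun s z =>
  partialL 0 (L 1) s z - partialL 1 (L 0) s z + mxbracket (L 0 s z) (L 1 s z).

Definition admissible (L : 'I_2 -> coefficient) : Prop :=
  (forall i, Omega_M (L i)) /\ Omega_M (curvature L).

Definition gaugeL (g : Sigma -> 'M[C]_N) (L : 'I_2 -> coefficient) :
    'I_2 -> coefficient :=
  fun i s z => - (Dmx (Ddir (axis i)) g s *m invmx (g s)) +
               g s *m L i s z *m invmx (g s).

(* The coefficients of [L] being holomorphic, [d/dz] is the complex derivative. *)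
Definition jstar (L : 'I_2 -> coefficient) : 'I_2 -> Sigma -> defect_mx :=
  fun i s x => jet_mx _ (fun p => \matrix_(a, b)
    (derive1n p (extend (fun z => L i s z a b) : C^o -> C^o) (pole W x) /
     p`!%:R)).

Definition lax_object (k : set defect_mx) (L : 'I_2 -> coefficient)
    (h : Sigma -> defect_mx) : Prop :=
  [/\ admissible L, smooth_defect h
    & Omega1 k (gaugeJ (fun s => invJ (h s)) (jstar L))].

Variable k : set defect_mx.

Definition gauge := ((Sigma -> 'M[C]_N) * (Sigma -> defect_mx))%type.

Definition is_gauge (a : gauge) : Prop := smoothG a.1 /\ smoothK k a.2.

Definition gauge1 : gauge := (fun=> 1%:M, fun=> oneJ).
Definition gaugeM (b a : gauge) : gauge :=
  (fun s => b.1 s *m a.1 s, fun s => mulJ (b.2 s) (a.2 s)).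
Definition gaugeV (a : gauge) : gauge :=
  (fun s => invmx (a.1 s), fun s => invJ (a.2 s)).

Definition act (a : gauge) (h : Sigma -> defect_mx) : Sigma -> defect_mx :=
  fun s => mulJ (mulJ (diagJ (a.1 s)) (h s)) (invJ (a.2 s)).

Lemma smoothG_unit g : smoothG g -> forall s, g s \in unitmx.
Proof. by move=> [_ Gg] s; exact: mlg_unit (Gg s). Qed.

Lemma is_gauge1 : is_gauge gauge1.
Proof.
split; split=> /=.
- by apply: entrywise_cst => c; exact: smooth_cst.
- by move=> _; exact: mlg1.
- by move=> x; apply: entrywise_cst => c; exact: smoothT_cst.
- by move=> _ x; rewrite /oneJ unitmx1.
- by move=> _; exact: cs_one.
- by move=> s; exists (fun=> oneJ); split; [exact: ew_one|by apply: filterE].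
Qed.

Lemma is_gaugeM a b : is_gauge a -> is_gauge b -> is_gauge (gaugeM b a).
Proof.
move=> [[sa Ga] [ja ua ca wa]] [[sb Gb] [jb ub cb wb]]; split; split=> /=.
- apply: entrywiseM sb sa; [exact: smooth_cst|move=> ? ?; exact: smoothD|].
  by move=> ? ?; exact: smoothM.
- by move=> s; exact: mlgM.
- move=> x; apply: entrywiseM (jb x) (ja x); [exact: smoothT_cst| |].
    by move=> ? ?; exact: smoothTD.
  by move=> ? ?; exact: smoothTM.
- by move=> s x; rewrite unitmx_mul ub ua.
- by move=> s; exact: cs_mul.
- move=> s; have [u [Wu Eu]] := wa s; have [v [Wv Ev]] := wb s.
  exists (fun s => mulJ (v s) (u s)); split; first exact: ew_mul.
  by near=> t; rewrite (near Eu t) // (near Ev t).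
Unshelve. all: by end_near. Qed.

Lemma is_gaugeV a : is_gauge a -> is_gauge (gaugeV a).
Proof.
move=> [sGa [ja ua ca wa]]; have Ua := smoothG_unit sGa; case: sGa => sa Ga.
split; split=> /=.
- apply: entrywiseV sa => //; [exact: smooth_cst|move=> ? ?; exact: smoothD| |].
    by move=> ? ?; exact: smoothM.
  by move=> f fU; apply: smoothV => v; rewrite -unitfE.
- by move=> s; exact: mlgV.
- move=> x; apply: entrywiseV (fun s => ua s x) (ja x).
  + exact: smoothT_cst.
  + by move=> ? ?; exact: smoothTD.
  + by move=> ? ?; exact: smoothTM.
  + by move=> f fU; exact: smoothTV.
- by move=> s x; rewrite unitmx_inv; exact: ua.
- by move=> s; exact: cs_inv.
- move=> s; have [u [Wu Eu]] := wa s.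
  exists (fun s => invJ (u s)); split; first exact: ew_inv.
  by near=> t; rewrite (near Eu t) //.
Unshelve. all: by end_near. Qed.

Lemma invmxM (A : comUnitRingType) n (a b : 'M[A]_n) : a \in unitmx ->
  b \in unitmx -> invmx (a *m b) = invmx b *m invmx a.
Proof.
move=> aU bU; have abU : a *m b \in unitmx by rewrite unitmx_mul aU.
have E : (invmx b *m invmx a) *m (a *m b) = 1%:M.
  by rewrite -mulmxA (mulmxA (invmx a)) mulVmx // mul1mx mulVmx.
by rewrite -[LHS]mul1mx -E -mulmxA mulmxV // mulmx1.
Qed.

Lemma gaugeMA a b c : gaugeM (gaugeM c b) a = gaugeM c (gaugeM b a).
Proof.
congr pair; first by apply/funext => s; rewrite /= mulmxA.
by apply/funext => s; apply/functional_extensionality_dep => x; rewrite /mulJ /= mulmxA.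
Qed.

Lemma gauge1M a : gaugeM gauge1 a = a.
Proof.
case: a => g f; congr pair; first by apply/funext => s; rewrite /= mul1mx.
by apply/funext => s; apply/functional_extensionality_dep => x; rewrite /mulJ /= mul1mx.
Qed.

Lemma gaugeM1 a : gaugeM a gauge1 = a.
Proof.
case: a => g f; congr pair; first by apply/funext => s; rewrite /= mulmx1.
by apply/funext => s; apply/functional_extensionality_dep => x; rewrite /mulJ /= mulmx1.
Qed.

Lemma gaugeVM a : is_gauge a -> gaugeM (gaugeV a) a = gauge1.
Proof.
move=> [/smoothG_unit Ua [_ ua _ _]].
congr pair; first by apply/funext => s; rewrite /= mulVmx.
apply/funext => s; apply/functional_extensionality_dep => x.
by rewrite /mulJ /invJ /= mulVmx //; exact: ua.
Qed.

Lemma gaugeMV a : is_gauge a -> gaugeM a (gaugeV a) = gauge1.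
Proof.
move=> [/smoothG_unit Ua [_ ua _ _]].
congr pair; first by apply/funext => s; rewrite /= mulmxV.
apply/funext => s; apply/functional_extensionality_dep => x.
by rewrite /mulJ /invJ /= mulmxV //; exact: ua.
Qed.

Lemma act1 h : act gauge1 h = h.
Proof.
apply/funext => s; apply/functional_extensionality_dep => x.
by rewrite /act /mulJ /invJ /diagJ /= invmx1 map_mx1 mul1mx mulmx1.
Qed.

Lemma actM a b h : is_gauge a -> is_gauge b ->
  act (gaugeM b a) h = act b (act a h).
Proof.
move=> [_ [_ ua _ _]] [_ [_ ub _ _]].
apply/funext => s; apply/functional_extensionality_dep => x.
by rewrite /act /mulJ /invJ /diagJ /= map_mxM invmxM ?mulmxA //; [exact: ub|exact: ua].
Qed.

Lemma DmxM_smooth i (f g : Sigma -> 'M[C]_N) s : smooth_mx f -> smooth_mx g ->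
  Dmx (Ddir (axis i)) (fun u => f u *m g u) s =
  Dmx (Ddir (axis i)) f s *m g s + f s *m Dmx (Ddir (axis i)) g s.
Proof.
move=> sf sg; apply: (@DmxM _ _ smooth) sf sg.
- exact: smooth_cst.
- by move=> ? ?; exact: smoothD.
- by move=> ? ?; exact: smoothM.
- by move=> c v; exact: DdirC.
- by move=> ? ? v; exact: DdirD.
- by move=> ? ? v; exact: DdirM.
Qed.

Lemma gaugeL1 L : gaugeL gauge1.1 L = L.
Proof.
apply/funext => i; apply/funext => s; apply/funext => z.
rewrite /gaugeL /= Dmx_cst; last by move=> c v; exact: DdirC.
by rewrite mul0mx oppr0 add0r invmx1 mul1mx mulmx1.
Qed.

Lemma gaugeLM (g h : Sigma -> 'M[C]_N) L : smoothG g -> smoothG h ->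
  gaugeL (fun s => h s *m g s) L = gaugeL h (gaugeL g L).
Proof.
move=> Hg Hh; have gU := smoothG_unit Hg; have hU := smoothG_unit Hh.
apply/funext => i; apply/funext => s; apply/funext => z.
rewrite /gaugeL DmxM_smooth; [|exact: (proj1 Hh)|exact: (proj1 Hg)].
rewrite invmxM // mulmxDl mulmxDr mulmxDl !mulmxA mulmxK // opprD -addrA.
by congr (_ + (_ + _)); rewrite mulmxN mulNmx !mulmxA.
Qed.

Lemma sig_eq (T : Type) (Q : T -> Prop) (a b : {x | Q x}) :
  sval a = sval b -> a = b.
Proof. by case: a b => [a p] [b q] /= E; subst b; congr exist; exact: Prop_irrelevance. Qed.

Definition ob2d := {h : Sigma -> defect_mx | smooth_defect h}.

Definition hom2d (h h' : ob2d) :=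
  {a : gauge | is_gauge a /\ sval h' = act a (sval h)}.

Definition obLax :=
  {Lh : ('I_2 -> coefficient) * (Sigma -> defect_mx) | lax_object k Lh.1 Lh.2}.

Definition homLax (o o' : obLax) :=
  {a : gauge | [/\ is_gauge a, (sval o').1 = gaugeL a.1 (sval o).1
                 & (sval o').2 = act a (sval o).2]}.

Lemma id2d_proof (h : ob2d) : is_gauge gauge1 /\ sval h = act gauge1 (sval h).
Proof. by split; [exact: is_gauge1|rewrite act1]. Qed.

Lemma cmp2d_proof (h h' h'' : ob2d) (f : hom2d h h') (g : hom2d h' h'') :
  is_gauge (gaugeM (sval g) (sval f)) /\
  sval h'' = act (gaugeM (sval g) (sval f)) (sval h).
Proof.
case: f g => [a [Ga Ea]] [b [Gb Eb]] /=.
by split; [exact: is_gaugeM|rewrite Eb Ea (actM _ Ga Gb)].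
Qed.

Lemma inv2d_proof (h h' : ob2d) (f : hom2d h h') :
  is_gauge (gaugeV (sval f)) /\ sval h = act (gaugeV (sval f)) (sval h').
Proof.
case: f => [a [Ga Ea]] /=; have GV := is_gaugeV Ga.
by split=> //; rewrite Ea -(actM _ Ga GV) (gaugeVM Ga) act1.
Qed.

Definition F2d : groupoid.
refine (@Groupoid ob2d hom2d
  (fun h => exist _ gauge1 (id2d_proof h))
  (fun h h' h'' f g => exist _ (gaugeM (sval g) (sval f)) (cmp2d_proof f g))
  (fun h h' f => exist _ (gaugeV (sval f)) (inv2d_proof f)) _ _ _ _ _).
- by move=> a b f; apply: sig_eq; exact: gaugeM1.
- by move=> a b f; apply: sig_eq; exact: gauge1M.
- by move=> a b c d f g h; apply: sig_eq; exact: gaugeMA.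
- by move=> a b [f [Gf Ef]]; apply: sig_eq; exact: gaugeVM.
- by move=> a b [f [Gf Ef]]; apply: sig_eq; exact: gaugeMV.
Defined.

Lemma idLax_proof (o : obLax) :
  [/\ is_gauge gauge1, (sval o).1 = gaugeL gauge1.1 (sval o).1
    & (sval o).2 = act gauge1 (sval o).2].
Proof. by split; [exact: is_gauge1|rewrite gaugeL1|rewrite act1]. Qed.

Lemma cmpLax_proof (o o' o'' : obLax) (f : homLax o o') (g : homLax o' o'') :
  [/\ is_gauge (gaugeM (sval g) (sval f)),
      (sval o'').1 = gaugeL (gaugeM (sval g) (sval f)).1 (sval o).1
    & (sval o'').2 = act (gaugeM (sval g) (sval f)) (sval o).2].
Proof.
case: f g => [a [Ga La Ea]] [b [Gb Lb Eb]] /=.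
split; [exact: is_gaugeM| |by rewrite Eb Ea (actM _ Ga Gb)].
by rewrite Lb La (gaugeLM _ (proj1 Ga) (proj1 Gb)).
Qed.

Lemma invLax_proof (o o' : obLax) (f : homLax o o') :
  [/\ is_gauge (gaugeV (sval f)),
      (sval o).1 = gaugeL (gaugeV (sval f)).1 (sval o').1
    & (sval o).2 = act (gaugeV (sval f)) (sval o').2].
Proof.
case: f => [a [Ga La Ea]] /=; have GV := is_gaugeV Ga.
split=> //; last by rewrite Ea -(actM _ Ga GV) (gaugeVM Ga) act1.
rewrite La -(gaugeLM _ (proj1 Ga) (proj1 GV)).
have /(congr1 fst) /= -> := gaugeVM Ga; by rewrite gaugeL1.
Qed.

Definition FLax : groupoid.
refine (@Groupoid obLax homLax
  (fun o => exist _ gauge1 (idLax_proof o))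
  (fun o o' o'' f g => exist _ (gaugeM (sval g) (sval f)) (cmpLax_proof f g))
  (fun o o' f => exist _ (gaugeV (sval f)) (invLax_proof f)) _ _ _ _ _).
- by move=> a b f; apply: sig_eq; exact: gaugeM1.
- by move=> a b f; apply: sig_eq; exact: gauge1M.
- by move=> a b c d f g h; apply: sig_eq; exact: gaugeMA.
- by move=> a b [f [Gf Lf Ef]]; apply: sig_eq; exact: gaugeVM.
- by move=> a b [f [Gf Lf Ef]]; apply: sig_eq; exact: gaugeMV.
Defined.

Definition forget_ob (o : obLax) : ob2d :=
  let: exist Lh p := o in let: And3 _ sh _ := p in exist _ Lh.2 sh.

Lemma forget_obE o : sval (forget_ob o) = (sval o).2.
Proof. by case: o => [[L h] [? ? ?]]. Qed.

Lemma forget_hom_proof (o o' : obLax) (f : homLax o o') :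
  is_gauge (sval f) /\ sval (forget_ob o') = act (sval f) (sval (forget_ob o)).
Proof. by rewrite !forget_obE; case: f => [a []]. Qed.

Definition forget : functor FLax F2d.
refine (@Functor FLax F2d forget_ob
  (fun o o' f => exist _ (sval f) (forget_hom_proof f)) _ _).
- by move=> a; apply: sig_eq.
- by move=> a b c f g; apply: sig_eq.
Defined.

End Defect.

Arguments defect_mx {R} N W.
Arguments coefficient {R} N W.

(* Main.v *)
(** * Transporting Lax connections along gauge transformations

An equivalence is full, and lifting the identity gauge transformation of [h] to a
morphism [(L, h) -> (L', h)] forces [L = L']; it is essentially surjective, and a
gauge transformation [(g, k)] from [h'] to [h] carries a solution [(L', h')] to a
solution over [h]. Conversely the assignment of [L_h] to [h] is functorial, because
[^g L_h] solves the equation over [g h k^-1] and must therefore be the chosen one.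

Everything thus rests on the stability of Lax objects under gauge transformations.
The curvature of [^g L] is [g F(L) g^-1] by the symmetry of second derivatives.
Jets commute with [^g] because the coefficients of [L] are infinitely often complex
differentiable: they are holomorphic and smooth as functions of two real variables,
so the Cauchy-Riemann equations pass to [dL/dz]. Finally, for [f] smooth with values in
[K], both [Ad_f] and [- df f^-1] land in [k]: for [f = exp X] these are the limits of
[sum_n ad_X^n Y / n!] and [- sum_n ad_X^n (dX) / (n+1)!], obtained from Cauchy products of
exponential series, and a subspace of a finite-dimensional space is closed. *)
Require Import Defs.
From mathcomp Require Import all_boot all_order all_algebra.
From mathcomp Require Import all_classical all_reals.
From mathcomp Require Import topology normedtype derive sequences exp.
From mathcomp Require Import qpoly complex ring lra.
Set Implicit Arguments.
Unset Strict Implicit.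
Unset Printing Implicit Defensive.
Import Order.TTheory GRing.Theory Num.Theory numFieldNormedType.Exports.
Local Open Scope classical_set_scope.
Local Open Scope complex_scope.
Local Open Scope ring_scope.

(** * Differential calculus on open sets *)

Section Calculus.
Context {R : realType}.

Section OpenSet.
Context {V : normedModType R} (U : set V) (oU : open U).

(** Three features of the setting shape the argument. Holomorphy of a coefficient is complex
    differentiability near each point and nothing more; higher derivatives are drawn not from an
    integral formula but from the joint real smoothness contained in [Omega_M], so that the symmetry
    of second derivatives serves both the curvature and the jets. The subgroup attached to [k] need
    not be closed, so a smooth map to it is available only as a local word in exponentials: the
    argument runs by induction on words, and conjugation is carried along because it enters the
    logarithmic derivative of a product. Finally, derivatives of matrices of truncated polynomials
    are phrased as first-order expansions in one submultiplicative real norm; a single product rule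
    and a single estimate for the exponential then treat all coefficients at once, and completeness
    is invoked only for series dominated by an exponential series. *)

Lemma near_open (P : V -> Prop) v : (forall u, U u -> P u) -> U v ->
  \forall u \near v, P u.
Proof. by move=> H Uv; apply: filterS (open_nbhs_nbhs (conj oU Uv)). Qed.

Lemma near_eq_continuous (T : topologicalType) (f g : V -> T) v :
  (\forall u \near v, f u = g u) -> {for v, continuous f} -> {for v, continuous g}.
Proof.
move=> fg cf; have E := nbhs_singleton fg; rewrite /prop_for /continuous_at -E.
by apply: cvg_trans cf; apply: near_eq_cvg; apply: filterS fg => u /= ->.
Qed.

Lemma Ck_on_continuous k (f : V -> R) v : Ck U k f -> U v -> {for v, continuous f}.
Proof. by case: k => [|k] [cf _] Uv; apply: cf. Qed.

Lemma Ck_on_derivable k (f : V -> R) v w : Ck U k.+1 f -> U v -> derivable f v w.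
Proof. by move=> [_ /(_ w)[df _]] Uv; apply: df. Qed.

Lemma Ck_derive k (f : V -> R) w : Ck U k.+1 f -> Ck U k ('D_w f).
Proof. by case=> _ /(_ w)[]. Qed.

Lemma Ck_onW k (f : V -> R) : Ck U k.+1 f -> Ck U k f.
Proof.
elim: k f => [|k IH] f; first by case.
by case=> cf df; split=> // w; have [d1 d2] := df w; split=> //; apply: IH.
Qed.

Lemma Ck_on_cst k (c : R) : Ck U k (fun=> c).
Proof.
elim: k c => [|k IH] c; split => //; try by move=> v _; exact: cvg_cst.
move=> w; split=> [v _|]; first exact: derivable_cst.
suff -> : 'D_w (fun _ : V => c) = (fun _ => 0) by exact: IH.
by apply/funext => v; rewrite derive_cst.
Qed.

(** A derivative at a point of the open set [U] sees only nearby values, so agreement on [U] is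
    inherited by all iterated derivatives. This allows junk values outside [U] to be ignored. *)
Lemma eq_Ck k (f g : V -> R) : (forall v, U v -> f v = g v) -> Ck U k f -> Ck U k g.
Proof.
elim: k f g => [|k IH] f g fg Hf.
  split=> // v Uv; apply: near_eq_continuous (Ck_on_continuous Hf Uv).
  exact: near_open.
split=> [v Uv|w].
  by apply: near_eq_continuous (Ck_on_continuous Hf Uv); exact: near_open.
split=> [v Uv|].
  by refine (near_eq_derivable _ (Ck_on_derivable Hf Uv)); exact: near_open.
apply: IH (Ck_derive w Hf) => v Uv; apply: near_eq_derive; exact: near_open.
Qed.

Lemma Ck_onD k (f g : V -> R) : Ck U k f -> Ck U k g -> Ck U k (fun v => f v + g v).
Proof.
have cD k' f' g' : Ck U k' f' -> Ck U k' g' -> forall v, U v ->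
    {for v, continuous (fun v => f' v + g' v)}.
  move=> Hf Hg v Uv; apply: continuousD.
    exact: Ck_on_continuous Hf Uv.
  exact: Ck_on_continuous Hg Uv.
elim: k f g => [|k IH] f g Hf Hg; split=> //; try exact: cD Hf Hg.
move=> w; split=> [v Uv|].
  exact: (@derivableD _ _ _ f g _ _ (Ck_on_derivable Hf Uv) (Ck_on_derivable Hg Uv)).
apply: eq_Ck (IH _ _ (Ck_derive w Hf) (Ck_derive w Hg)) => v Uv; apply/esym.
exact: (@deriveD _ _ _ f g _ _ (Ck_on_derivable Hf Uv) (Ck_on_derivable Hg Uv)).
Qed.

Lemma Ck_onM k (f g : V -> R) : Ck U k f -> Ck U k g -> Ck U k (fun v => f v * g v).
Proof.
have cM k' f' g' : Ck U k' f' -> Ck U k' g' -> forall v, U v ->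
    {for v, continuous (fun v => f' v * g' v)}.
  move=> Hf Hg v Uv; apply: continuousM.
    exact: Ck_on_continuous Hf Uv.
  exact: Ck_on_continuous Hg Uv.
elim: k f g => [|k IH] f g Hf Hg; split=> //; try exact: cM Hf Hg.
move=> w; split=> [v Uv|].
  exact: (@derivableM _ _ f g _ _ (Ck_on_derivable Hf Uv) (Ck_on_derivable Hg Uv)).
apply: (@eq_Ck _ (fun v => f v * 'D_w g v + g v * 'D_w f v)) => [v Uv|].
  apply/esym.
  exact: (@deriveM _ _ f g _ _ (Ck_on_derivable Hf Uv) (Ck_on_derivable Hg Uv)).
by apply: Ck_onD; apply: IH; try exact: Ck_onW; exact: Ck_derive.
Qed.

Lemma eq_smooth_on (f g : V -> R[i]) : (forall v, U v -> f v = g v) ->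
  smooth_on U f -> smooth_on U g.
Proof.
move=> fg Hf k; have [f1 f2] := Hf k.
by split; [apply: eq_Ck f1|apply: eq_Ck f2] => v Uv; rewrite fg.
Qed.

Lemma smooth_onD (f g : V -> R[i]) : smooth_on U f -> smooth_on U g ->
  smooth_on U (fun v => f v + g v).
Proof.
move=> Hf Hg k; have [f1 f2] := Hf k; have [g1 g2] := Hg k; split.
- apply: eq_Ck (Ck_onD f1 g1) => v _.
  by case: (f v) (g v) => [? ?] [? ?].
- apply: eq_Ck (Ck_onD f2 g2) => v _.
  by case: (f v) (g v) => [? ?] [? ?].
Qed.

Lemma smooth_onM (f g : V -> R[i]) : smooth_on U f -> smooth_on U g ->
  smooth_on U (fun v => f v * g v).
Proof.
move=> Hf Hg k; have [f1 f2] := Hf k; have [g1 g2] := Hg k; split.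
- under eq_fun do rewrite Defs.ReM.
  by apply: Ck_onD; [|apply: Ck_onM; [exact: Ck_on_cst|]]; apply: Ck_onM.
- under eq_fun do rewrite Defs.ImM.
  by apply: Ck_onD; apply: Ck_onM.
Qed.

Lemma smooth_on_Ddir w (f : V -> R[i]) : smooth_on U f -> smooth_on U (Ddir w f).
Proof. by move=> Hf k; have [f1 f2] := Hf k.+1; split; [exact: (Ck_derive w f1)|exact: (Ck_derive w f2)]. Qed.

End OpenSet.

(** * Composition with affine maps *)

Section Affine.
Context {V V' : normedModType R} (phi : V -> V') (A : V -> V').
Hypothesis phi_affine : forall h w v, phi (h *: w + v) = h *: A w + phi v.
Hypothesis phi_continuous : continuous phi.

(** The difference quotients of [f \o phi] along [w] are literally those of [f] along [A w], so the
    two derivatives agree even where they are default values. The affine maps of interest are lines,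
    slices of a product and projections. *)
Lemma derive_affine (f : V' -> R) w v : 'D_w (f \o phi) v = 'D_(A w) f (phi v).
Proof.
rewrite /derive.
set F := (fun h => _); set F' := (fun h => _); suff -> : F = F' by [].
by apply/funext => h; rewrite /F /F' /= phi_affine.
Qed.

Lemma derivable_affine (f : V' -> R) v w : derivable f (phi v) (A w) ->
  derivable (f \o phi) v w.
Proof.
rewrite /derivable; set F := (fun h => _); set F' := (fun h => _).
suff -> : F = F' by [].
by apply/funext => h; rewrite /F /F' /= phi_affine.
Qed.

Lemma Ck_affine (U : set V') k (f : V' -> R) : Ck U k f ->
  Ck (phi @^-1` U) k (f \o phi).
Proof.
have cphi k' f' v : Ck U k' f' -> U (phi v) -> {for v, continuous (f' \o phi)}.
  move=> Hf Uv; apply: continuous_comp; first exact: phi_continuous.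
  exact: Ck_on_continuous Hf Uv.
elim: k f => [|k IH] f Hf.
  by split; [move=> v Uv; exact: cphi Hf Uv|exact: I].
split; first by move=> v Uv; exact: cphi Hf Uv.
move=> w; split=> [v Uv|].
    by apply: derivable_affine; exact: Ck_on_derivable Hf Uv.
  have -> : 'D_w (f \o phi) = 'D_(A w) f \o phi.
    by apply/funext => v; exact: derive_affine.
  by apply: IH; exact: Ck_derive.
Qed.

Lemma smooth_on_affine (U : set V') (f : V' -> R[i]) : smooth_on U f ->
  smooth_on (phi @^-1` U) (f \o phi).
Proof. by move=> Hf k; have [f1 f2] := Hf k; split; [exact: Ck_affine f1|exact: Ck_affine f2]. Qed.

Lemma Ddir_affine (f : V' -> R[i]) w v :
  Ddir w (f \o phi) v = Ddir (A w) f (phi v).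
Proof.
apply: complex_eq.
  exact: derive_affine (fun u => complex.Re (f u)) w v.
exact: derive_affine (fun u => complex.Im (f u)) w v.
Qed.

End Affine.

Lemma line_continuous {V : normedModType R} (v x : V) :
  continuous (fun t : R => t *: v + x).
Proof.
move=> t; apply: cvgD; last exact: cvg_cst.
by apply: cvgZr_tmp; exact: cvg_id.
Qed.

(** * The mean value theorem along a line *)

Section Line.
Context {V : normedModType R} (f : V -> R) (v x : V).

Lemma is_derive_line t : derivable f (t *: v + x) v ->
  is_derive t 1 (fun t => f (t *: v + x)) ('D_v f (t *: v + x)).
Proof.
have E (h w t' : R) : (h *: (w : R^o) + t') *: v + x = h *: (w *: v) + (t' *: v + x).
  by rewrite scalerDl scalerA addrA.
move=> df; apply: DeriveDef.
  apply: (@derivable_affine R V (fun t => t *: v + x) (fun w => w *: v) E f t 1).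
  by rewrite scale1r.
have := @derive_affine R V (fun t => t *: v + x) (fun w => w *: v) E f 1 t.
by rewrite scale1r.
Qed.

(** Bounding [c] by the absolute value of [a], rather than by an interval, covers both signs of [a]
    and [a = 0] in one statement. *)
Lemma line_MVT a : (forall t, `|t| <= `|a| -> derivable f (t *: v + x) v) ->
  exists2 c, `|c| <= `|a| & f (a *: v + x) - f x = a * 'D_v f (c *: v + x).
Proof.
move=> df; have [->|a0] := eqVneq a 0.
  by exists 0; rewrite // !scale0r add0r subrr mul0r.
have D p q : (forall t, t \in `[p, q] -> `|t| <= `|a|) -> p < q ->
    exists2 c, `|c| <= `|a| &
      f (q *: v + x) - f (p *: v + x) = 'D_v f (c *: v + x) * (q - p).
  move=> H pq.
  have [|t tpq|c cpq E] := @MVT R (fun t => f (t *: v + x))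
      (fun t => 'D_v f (t *: v + x)) p q pq.
  - by move=> t tpq; apply: is_derive_line; apply/df/H; exact: subset_itv_oo_cc.
  - apply: (@derivable_within_continuous R _ (fun t => f (t *: v + x)) `[p, q]).
    by move=> u upq; apply: ex_derive; apply: is_derive_line; apply/df/H.
  - by exists c => //; apply: H; exact: subset_itv_oo_cc.
case: (ltgtP a 0) a0 => // ha _.
- have [t|//|c ca E] := D a 0.
    by rewrite in_itv /= => /andP[h1 h2]; rewrite !ler0_norm //; lra.
  by exists c => //; move: E; rewrite scale0r add0r => E; lra.
- have [t|//|c ca E] := D 0 a.
    by rewrite in_itv /= => /andP[h1 h2]; rewrite !ger0_norm //; lra.
  by exists c => //; move: E; rewrite scale0r add0r => E; lra.
Qed.

End Line.

Lemma continuous_dist_lt {V : normedModType R} (f : V -> R) x (e : R) :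
  {for x, continuous f} -> 0 < e -> \forall y \near x, `|f x - f y| < e.
Proof. by move=> cf; move: e; apply/cvgrPdist_lt. Qed.

(** * Symmetry of second derivatives *)

Section Schwarz.
Context {V : normedModType R} (U : set V) (oU : open U).

(** The mean value theorem is applied twice: along [v] to the difference [g] of [f] and its
    translate by [a *: w], then along [w] to ['D_v f]. The left-hand side is symmetric in [v] and
    [w], which is what [derive_swap] exploits. *)
Lemma second_difference (f : V -> R) v w x a : Ck U 2 f -> 0 < a ->
  (forall s t, `|s| <= a -> `|t| <= a -> U (s *: v + (t *: w + x))) ->
  exists s t, [/\ `|s| <= a, `|t| <= a &
    f (a *: v + (a *: w + x)) - f (a *: v + x) - f (a *: w + x) + f x =
    a ^+ 2 * 'D_w ('D_v f) (s *: v + (t *: w + x))].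
Proof.
move=> Hf a0 HU; have aa : `|a| = a by rewrite ger0_norm // ltW.
pose g y := f (a *: w + y) - f y.
have z0 : `|0 : R| <= a by rewrite normr0 ltW.
have dw t : `|t| <= a -> derivable (fun y => f (a *: w + y)) (t *: v + x) v.
  move=> ta; apply: (@derivable_affine _ _ (fun y => a *: w + y) id).
    by move=> h u y; rewrite addrCA.
  by apply: Ck_on_derivable Hf _; rewrite addrCA; apply: HU; rewrite ?aa.
have d0 t : `|t| <= a -> derivable f (t *: v + x) v.
  move=> ta; apply: Ck_on_derivable Hf _.
  by have := HU t 0 ta z0; rewrite scale0r add0r.
have [t ta|s sa E] := @line_MVT V g v x a.
  by rewrite aa in ta; apply: (@derivableB _ _ _ (fun y => f (a *: w + y)) f); auto.
rewrite aa in sa.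
have [t ta|t ta E'] := @line_MVT V ('D_v f) w (s *: v + x) a.
  rewrite aa in ta; apply: Ck_on_derivable (Ck_derive v Hf) _.
  by rewrite addrCA; exact: HU.
rewrite aa in ta; exists s, t; split; [exact: sa|exact: ta|].
have -> : a ^+ 2 * 'D_w ('D_v f) (s *: v + (t *: w + x)) =
   a * (a * 'D_w ('D_v f) (t *: w + (s *: v + x))).
  by rewrite mulrA expr2 (addrCA (s *: v)).
rewrite -E'.
have -> : f (a *: v + (a *: w + x)) - f (a *: v + x) - f (a *: w + x) + f x =
   g (a *: v + x) - g x by rewrite /g (addrCA (a *: v)); lra.
rewrite E; congr (a * _).
rewrite (@deriveB _ _ _ (fun y => f (a *: w + y)) f); [|exact: dw|exact: d0].
apply: (f_equal2 (fun p q => p - q)); last by [].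
have E2 h u y : (fun y => a *: w + y) (h *: u + y) = h *: id u + (a *: w + y).
  by rewrite addrCA.
exact: derive_affine E2 f v (s *: v + x).
Qed.

(** The second difference over a small parallelogram equals [a ^+ 2] times either mixed derivative,
    each taken at some point of the parallelogram. The two mixed derivatives thus share a value
    arbitrarily close to [x], and continuity leaves no room for different values at [x]. *)
Lemma derive_swap (f : V -> R) v w x : Ck U 2 f -> U x ->
  'D_w ('D_v f) x = 'D_v ('D_w f) x.
Proof.
(* No number lies within half the distance of two given numbers from both of them. *)
have far (a b c : R) : `|a - c| < `|a - b| / 2 -> `|b - c| < `|a - b| / 2 -> False.
  move=> h1 h2; have : `|a - b| < `|a - b| / 2 + `|a - b| / 2.
    apply: le_lt_trans (ltrD h1 h2); rewrite -(normrN (b - c)).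
    by apply: le_trans (ler_normD _ _); rewrite opprB addrA subrK.
  by rewrite -splitr ltxx.
move=> Hf Ux; apply/eqP/negPn/negP => neq.
set p := 'D_w ('D_v f) x in neq; set q := 'D_v ('D_w f) x in neq.
pose e := `|p - q| / 2.
have e0 : 0 < e by rewrite divr_gt0 // normr_gt0 subr_eq0.
have c1 : {for x, continuous ('D_w ('D_v f))}.
  exact: Ck_on_continuous (Ck_derive w (Ck_derive v Hf)) Ux.
have c2 : {for x, continuous ('D_v ('D_w f))}.
  exact: Ck_on_continuous (Ck_derive v (Ck_derive w Hf)) Ux.
have : \forall y \near x, [/\ U y, `|p - 'D_w ('D_v f) y| < e
   & `|q - 'D_v ('D_w f) y| < e].
  apply: filterS3 (open_nbhs_nbhs (conj oU Ux)) (continuous_dist_lt c1 e0)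
    (continuous_dist_lt c2 e0) => y h1 h2 h3.
  by split; [exact: h1|exact: h2|exact: h3].
move=> /nbhs_ballP[r /= r0 Hr].
(* The summand [1] keeps [M] positive when both directions vanish; with [a = r / (2 * M)] the
   parallelogram stays within distance [r / 2] of [x]. *)
pose M := `|v| + `|w| + 1.
have M0 : 0 < M by rewrite ltr_wpDl // addr_ge0.
pose a := r / (2 * M).
have a0 : 0 < a by rewrite divr_gt0 // mulr_gt0.
have HU s t : `|s| <= a -> `|t| <= a -> ball x r (s *: v + (t *: w + x)).
  move=> sa ta; rewrite -ball_normE /= addrA opprD addrCA subrr addr0 normrN.
  apply: le_lt_trans (ler_normD _ _) _; rewrite !normrZ.
  apply: (@le_lt_trans _ _ (a * M)).
    rewrite /M !mulrDr; apply: (@le_trans _ _ (a * `|v| + a * `|w|)).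
      by apply: lerD; exact: ler_wpM2r.
    by rewrite lerDl mulr1 ltW.
  have -> : a * M = r / 2 by rewrite /a; field; rewrite ?lt0r_neq0.
  by rewrite ltr_pdivrMr // ltr_pMr // ltr1n.
have HUU s t : `|s| <= a -> `|t| <= a -> U (s *: v + (t *: w + x)).
  by move=> sa ta; have [] := Hr _ (HU _ _ sa ta).
have HUU' t s : `|t| <= a -> `|s| <= a -> U (t *: w + (s *: v + x)).
  by move=> sa ta; rewrite addrCA; exact: HUU.
have [s [t [sa ta E]]] := second_difference Hf a0 HUU.
have [t' [s' [ta' sa' E']]] := second_difference Hf a0 HUU'.
have [_ B1 _] := Hr _ (HU _ _ sa ta).
have [_ _ B2] := Hr _ (HU _ _ sa' ta').
have EE : 'D_w ('D_v f) (s *: v + (t *: w + x)) =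
    'D_v ('D_w f) (s' *: v + (t' *: w + x)).
  have a2 : a ^+ 2 != 0 by rewrite expf_neq0 // gt_eqF.
  have P1 : s' *: v + (t' *: w + x) = t' *: w + (s' *: v + x) := addrCA _ _ _.
  have P2 : a *: w + (a *: v + x) = a *: v + (a *: w + x) := addrCA _ _ _.
  apply: (mulfI a2); rewrite P1; apply: etrans (esym E) (etrans _ E'); rewrite P2.
  by move: (f _) (f _) (f _) (f _) => y1 y2 y3 y4; ring.
rewrite EE in B1.
exact: far B1 B2.
Qed.

Lemma Ddir_swap (f : V -> R[i]) v w x : smooth_on U f -> U x ->
  Ddir w (Ddir v f) x = Ddir v (Ddir w f) x.
Proof. by move=> Hf Ux; have [f1 f2] := Hf 2; apply: complex_eq; [exact: (derive_swap _ _ f1)|exact: (derive_swap _ _ f2)]. Qed.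

End Schwarz.
End Calculus.

(** * Complex derivatives and Cauchy-Riemann equations *)

Section ComplexCalculus.
Context {R : realType}.
Local Notation C := R[i].

(* A real-valued substitute for the modulus, which takes its values in [C]. *)
Definition n1 (z : C) : R := `|complex.Re z| + `|complex.Im z|.

Lemma n1_ge0 z : 0 <= n1 z. Proof. by rewrite addr_ge0. Qed.

Lemma n10 : n1 0 = 0. Proof. by rewrite /n1 /= normr0 addr0. Qed.

Lemma n1_Re z : `|complex.Re z| <= n1 z. Proof. by rewrite lerDl. Qed.

Lemma n1_Im z : `|complex.Im z| <= n1 z. Proof. by rewrite lerDr. Qed.

Lemma n1D z w : n1 (z + w) <= n1 z + n1 w.
Proof.
case: z w => [a b] [c d]; rewrite /n1 /= addrACA.
by apply: lerD; exact: ler_normD.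
Qed.

Lemma n1N z : n1 (- z) = n1 z.
Proof. by case: z => a b; rewrite /n1 /= !normrN. Qed.

Lemma n1M z w : n1 (z * w) <= n1 z * n1 w.
Proof.
case: z w => [a b] [c d]; rewrite /n1 /= mulrDr !mulrDl -!normrM.
apply: (le_trans (lerD (ler_normB _ _) (ler_normD _ _))).
lra.
Qed.

Lemma n1_sum (I : Type) (r : seq I) (P : pred I) (F : I -> C) :
  n1 (\sum_(i <- r | P i) F i) <= \sum_(i <- r | P i) n1 (F i).
Proof.
elim/big_ind2: _ => [|z x w y zx wy|//]; first by rewrite n10.
exact: le_trans (n1D _ _) (lerD zx wy).
Qed.

Lemma n1_eq0 z : (n1 z == 0) = (z == 0).
Proof. by case: z => a b; rewrite /n1 paddr_eq0 // !normr_eq0 eq_complex. Qed.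

Lemma n1_realM (t : R) z : n1 (t%:C * z) = `|t| * n1 z.
Proof. by case: z => a b; rewrite /n1 /= !mul0r subr0 addr0 !normrM mulrDr. Qed.

Lemma normC_le_n1 (z : C) : `|z| <= (n1 z)%:C.
Proof.
rewrite [X in `|X|]complexE; case: z => a b /=; apply: le_trans (ler_normD _ _) _.
rewrite /n1 rmorphD /= !normrM !normc_def /= !expr0n /= !addr0 ?add0r expr1n sqrtr1.
by rewrite mul1r !sqrtr_sqr.
Qed.

Lemma Re_le_normC (z : C) : `|complex.Re z|%:C <= `|z|. Proof. exact: (normc_ge_Re z). Qed.

Lemma Im_le_normC (z : C) : `|complex.Im z|%:C <= `|z|.
Proof.
rewrite normc_def lecR; apply: le_trans (_ : Num.sqrt (complex.Im z ^+ 2) <= _).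
  by rewrite sqrtr_sqr.
by rewrite ler_wsqrtr // lerDr sqr_ge0.
Qed.

Lemma n1_le_normC (z : C) : (n1 z)%:C <= 2 * `|z|.
Proof.
rewrite /n1 rmorphD /= mulr_natl mulr2n.
by apply: lerD; [exact: Re_le_normC|exact: Im_le_normC].
Qed.

Lemma gt0_complex (e : C) : 0 < e -> exists2 r : R, 0 < r & e = r%:C.
Proof. by case: e => a b; rewrite ltcE /= => /andP[/eqP -> a0]; exists a. Qed.

Lemma halfC (r : R) : r%:C = 2 * (r / 2)%:C :> C.
Proof.
have -> : (2 : C) = (2 : R)%:C by rewrite rmorph_nat.
by rewrite -rmorphM /=; congr (_%:C); lra.
Qed.

(** The radii of balls in [C^o] are themselves complex numbers. Here they are exchanged for real
    ones, at the cost of a factor [2] between [n1] and the modulus. *)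
Lemma nbhs_n1 (z : C^o) (P : C -> Prop) :
  (\forall w \near z, P w) <->
  exists2 r : R, 0 < r & forall w, n1 (w - z) < r -> P w.
Proof.
split=> [/nbhs_ballP[e /= /gt0_complex[r r0 ->] H]|[r r0 H]].
  exists r => // w wz; apply: H; rewrite -ball_normE /= distrC.
  by apply: le_lt_trans (normC_le_n1 _) _; rewrite ltcR.
apply/nbhs_ballP; exists (r / 2)%:C => /=; first by rewrite ltcR divr_gt0.
move=> w; rewrite -ball_normE /= distrC => wz; apply: H.
rewrite -ltcR; apply: le_lt_trans (n1_le_normC _) _.
rewrite halfC.
by rewrite ltr_pM2l.
Qed.

(** The complex derivative as a first-order expansion with real error bounds, the form in which it
    can be compared with the expansions of the real and imaginary parts. *)
Definition cderiv (f : C -> C) (z d : C) : Prop :=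
  forall e : R, 0 < e -> exists2 r : R, 0 < r &
    forall h, n1 h < r -> n1 (f (h + z) - f z - d * h) <= e * n1 h.

Lemma cderivP (f : C -> C) z d :
  derivable (f : C^o -> C^o) z 1 /\ derive1 (f : C^o -> C^o) z = d <-> cderiv f z d.
Proof.
pose q (h : C^o) : C^o := h^-1 *: (f (h + z) - f z : C^o).
have qE : (fun h : C^o => h^-1 *: (((f : C^o -> C^o) \o shift z) (h *: (1 : C^o)) - f z)) = q.
  by apply/funext => h; rewrite /q /= [h%:A]mulr1.
have main : (q @ 0^' --> (d : C^o)) <-> cderiv f z d.
  split=> [/cvgrPdist_lt H e e0|H].
    have e20 : 0 < (e / 2)%:C :> C by rewrite ltcR divr_gt0.
    have := H _ e20; rewrite near_withinE => /nbhs_n1[r r0 Hr].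
    exists r => // h hr; have [->|h0] := eqVneq h 0.
      by rewrite add0r subrr mulr0 subrr n10 mulr0.
    have := Hr h; rewrite subr0 => /(_ hr h0) => Hq.
    have -> : f (h + z) - f z - d * h = - ((d - q h) * h).
      rewrite /q /GRing.scale /= mulrBl mulrAC mulVf // mul1r opprB.
      by [].
    rewrite n1N; apply: le_trans (n1M _ _) _; apply: ler_wpM2r; first exact: n1_ge0.
    rewrite -lecR; apply: le_trans (n1_le_normC _) _.
    by rewrite [e%:C]halfC ler_pM2l // ltW.
  apply/cvgrPdist_lt => _ /gt0_complex[e e0 ->].
  (* As [n1] is at most twice the modulus, a third of [e] produces an error of two thirds of [e],
     leaving room for the strict inequality. *)
  have [r r0 Hr] := H _ (divr_gt0 e0 (ltr0n R 3)).
  rewrite near_withinE; apply/nbhs_n1; exists r => // h; rewrite subr0 => hr h0.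
  have -> : d - q h = - ((f (h + z) - f z - d * h) / h).
    rewrite /q /GRing.scale /= mulrBl mulfK // opprB mulrC.
    by [].
  rewrite normrN normrM normfV ltr_pdivrMr ?normr_gt0 //.
  apply: le_lt_trans (normC_le_n1 _) _.
  apply: (@le_lt_trans _ _ (e / 3 * n1 h)%:C); first by rewrite lecR Hr.
  rewrite rmorphM /=.
  apply: (@le_lt_trans _ _ ((e / 3)%:C * (2 * `|h|))).
    by apply: ler_wpM2l; [rewrite lecR divr_ge0 // ltW|exact: n1_le_normC].
  rewrite mulrA ltr_pM2r ?normr_gt0 //.
  have -> : (2 : C) = (2 : R)%:C by rewrite rmorph_nat.
  by rewrite -rmorphM /= ltcR; lra.
rewrite -main derive1E /derivable /derive qE; split=> [[c <-]//|cq].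
by split; [apply/cvg_ex; exists d|exact: cvg_lim].
Qed.

Lemma derivable_cderiv (f : C -> C) z : derivable (f : C^o -> C^o) z 1 ->
  cderiv f z (derive1 (f : C^o -> C^o) z).
Proof. by move=> df; apply/cderivP. Qed.

Definition ux : R * R := (1, 0).
Definition uy : R * R := (0, 1).

Definition toC (p : R * R) : C := p.1 +i* p.2.

Lemma toCD p q : toC (p + q) = toC p + toC q. Proof. by []. Qed.

Lemma toCZ t p : toC (t *: p) = t%:C * toC p.
Proof. by rewrite /toC /=; apply: complex_eq => /=; rewrite !mul0r ?subr0 ?addr0. Qed.

Lemma cderiv_is_derive (f : C -> C) p d v : cderiv f (toC p) d ->
  is_derive p v (fun q => complex.Re (f (toC q))) (complex.Re (d * toC v)) /\
  is_derive p v (fun q => complex.Im (f (toC q))) (complex.Im (d * toC v)).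
Proof.
move=> H.
have K : forall e : R, 0 < e -> \forall t \near (0 : R)^',
    n1 (t^-1%:C * (f (toC (t *: v + p)) - f (toC p)) - d * toC v) < e.
  (* [M] bounds the direction and is positive even when [v = 0]; the factor [2] below yields half of
     [e], hence a strict inequality. *)
  move=> e e0; pose M := n1 (toC v) + 1.
  have M0 : 0 < M by rewrite ltr_wpDl // n1_ge0.
  have [r r0 Hr] := H _ (divr_gt0 e0 (mulr_gt0 M0 (ltr0n R 2))).
  near=> t.
  have t0 : t != 0 by near: t; exact: nbhs_dnbhs_neq.
  have tr : `|t| < r / M by near: t; apply: dnbhs0_lt; rewrite divr_gt0.
  have nt : n1 (t%:C * toC v) <= `|t| * M.
    by rewrite n1_realM ler_wpM2l // lerDl.
  have := Hr (t%:C * toC v); rewrite -toCZ -toCD toCZ => Ht.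
  have {Ht} Ht := Ht (le_lt_trans nt _); rewrite -ltr_pdivlMr // in Ht.
  have -> : t^-1%:C * (f (toC (t *: v + p)) - f (toC p)) - d * toC v =
     t^-1%:C * (f (toC (t *: v + p)) - f (toC p) - d * (t%:C * toC v)).
    rewrite [RHS]mulrBr; congr (_ - _).
    by rewrite [RHS]mulrCA (mulrA t^-1%:C) -rmorphM /= mulVf // mul1r.
  rewrite n1_realM normfV ltr_pdivrMl ?normr_gt0 //.
  apply: le_lt_trans (Ht tr) _.
  apply: (@le_lt_trans _ _ (e / (M * 2) * (`|t| * M))).
    by rewrite ler_wpM2l // divr_ge0 ?ltW // mulr_gt0.
  have -> : e / (M * 2) * (`|t| * M) = `|t| * e / 2 by field; rewrite lt0r_neq0.
  have : 0 < `|t| * e by rewrite mulr_gt0 // normr_gt0.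
  lra.
have Re_scale (a : R) (z : C) : complex.Re (a%:C * z) = a * complex.Re z.
  by case: z => x y /=; rewrite mul0r subr0.
have Im_scale (a : R) (z : C) : complex.Im (a%:C * z) = a * complex.Im z.
  by case: z => x y /=; rewrite mul0r addr0.
have ReB (a b : C) : complex.Re (a - b) = complex.Re a - complex.Re b.
  by case: a b => [? ?] [? ?].
have ImB (a b : C) : complex.Im (a - b) = complex.Im a - complex.Im b.
  by case: a b => [? ?] [? ?].
have fin (g : R * R -> R) (l : R) : (forall e : R, 0 < e -> \forall t \near (0 : R)^',
    `|t^-1 * (g (t *: v + p) - g p) - l| < e) -> is_derive p v g l.
  move=> Hg.
  have cg : (fun t : R => t^-1 *: ((g \o shift p) (t *: v) - g p)) @ 0^' --> l.
    apply/cvgrPdist_lt => e e0; apply: filterS (Hg e e0) => t.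
    by rewrite distrC.
  by apply: DeriveDef; [apply/cvg_ex; exists l|exact: cvg_lim].
split; apply: fin => e e0; apply: filterS (K e e0) => t.
- apply: le_lt_trans; rewrite -ReB -Re_scale -ReB; exact: n1_Re.
- apply: le_lt_trans; rewrite -ImB -Im_scale -ImB; exact: n1_Im.
Unshelve. all: by end_near. Qed.

(** The increment is split into a vertical and a horizontal leg, each treated by [line_MVT]. Balls
    of the product are products of intervals, so both intermediate points remain where the partial
    derivatives differ from those at [p] by at most [e]. *)
Lemma C1_differentiable (U : set (R * R)) (g : R * R -> R) p : open U ->
  Ck U 1 g -> U p -> forall e : R, 0 < e -> exists2 r : R, 0 < r &
  forall a b : R, `|a| + `|b| < r ->
    `|g ((a, b) + p) - g p - (a * 'D_ux g p + b * 'D_uy g p)| <=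
    e * (`|a| + `|b|).
Proof.
move=> oU Hg Up e e0.
have c1 := Ck_on_continuous (@Ck_derive R _ U 0 g ux Hg) Up.
have c2 := Ck_on_continuous (@Ck_derive R _ U 0 g uy Hg) Up.
have : \forall q \near p, [/\ U q, `|'D_ux g p - 'D_ux g q| <= e
   & `|'D_uy g p - 'D_uy g q| <= e].
  apply: filterS3 (open_nbhs_nbhs (conj oU Up)) (continuous_dist_lt c1 e0)
    (continuous_dist_lt c2 e0) => q h1 h2 h3.
  by split; [exact: h1|exact: ltW h2|exact: ltW h3].
move=> /nbhs_ballP[r /= r0 Hr]; exists r => // a b ab.
have ar : `|a| < r by apply: le_lt_trans ab; rewrite lerDl.
have br : `|b| < r by apply: le_lt_trans ab; rewrite lerDr.
have B s t : `|s| <= `|a| -> `|t| <= `|b| -> ball p r (s *: ux + (t *: uy + p)).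
  move=> sa tb; split; rewrite /ux /uy /ball /= !scaler0 ?add0r ?[_%:A]mulr1.
    rewrite opprD addrCA subrr addr0 normrN; exact: le_lt_trans ar.
  rewrite opprD addrCA subrr addr0 normrN; exact: le_lt_trans br.
have [t tb|t tb E1] := @line_MVT R _ g uy p b.
  apply: Ck_on_derivable Hg _.
  have := B 0 t; rewrite scale0r add0r normr0 => /(_ (normr_ge0 _) tb).
  by move=> /Hr[].
have [s sa|s sa E2] := @line_MVT R _ g ux (b *: uy + p) a.
  apply: Ck_on_derivable Hg _.
  by have /Hr[] := B s b sa (lexx _).
have /Hr[_ B1 _] := B s b sa (lexx _).
have := B 0 t; rewrite scale0r add0r normr0 => /(_ (normr_ge0 _) tb)/Hr[_ _ B2].
have -> : ((a, b) + p : R * R) = a *: ux + (b *: uy + p).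
  rewrite addrA; congr (_ + p).
  by rewrite /ux /uy; apply/pair_equal_spec; split => /=; rewrite !scaler0 ?addr0 ?add0r [RHS]mulr1.
set X := 'D_ux g p in B1 *; set Y := 'D_uy g p in B2 *.
set X' := 'D_ux g _ in B1 E2; set Y' := 'D_uy g _ in B2 E1.
set g2 := g (_ + _) in E2 *; set g1 := g (b *: _ + p) in E1 E2.
have -> : g2 - g p - (a * X + b * Y) = - (a * (X - X')) - b * (Y - Y').
  have -> : g2 - g p = a * X' + b * Y' by rewrite -E1 -E2; lra.
  by ring.
apply: le_trans (ler_normB _ _) _; rewrite normrN !normrM mulrDr.
by apply: lerD; rewrite mulrC ler_wpM2r.
Qed.

(** Under the Cauchy-Riemann equation the real expansions of the two components assemble into
    multiplication by the derivative along [ux]. Each component receives half of [e] because [n1]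
    adds their errors. *)
Lemma cauchy_riemann_cderiv (U : set (R * R)) (f : C -> C) p : open U -> U p ->
  Ck U 1 (fun q => complex.Re (f (toC q))) ->
  Ck U 1 (fun q => complex.Im (f (toC q))) ->
  Ddir uy (f \o toC) p = (0 +i* 1) * Ddir ux (f \o toC) p ->
  cderiv f (toC p) (Ddir ux (f \o toC) p).
Proof.
move=> oU Up H1 H2 /eqP; rewrite eq_complex /= mul0r mul1r sub0r mul0r mul1r add0r.
move=> /andP[/eqP E1 /eqP E2] e e0.
have e20 : 0 < e / 2 by rewrite divr_gt0.
have [r1 r10 K1] := C1_differentiable oU H1 Up e20.
have [r2 r20 K2] := C1_differentiable oU H2 Up e20.
exists (Num.min r1 r2); first by rewrite lt_min r10.
case=> a b; rewrite lt_min => /andP[/K1 {}K1 /K2 {}K2].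
have -> : (a +i* b) + toC p = toC ((a, b) + p) by [].
move: K1 K2; rewrite E1 E2 /Ddir.
set X := 'D_ux _ p; set Y := 'D_ux _ p.
case: (f (toC (_ + p))) => u1 u2; case: (f (toC p)) => w1 w2 /= K1 K2.
rewrite /n1 /=.
have -> : u1 - w1 - (X * a - Y * b) = u1 - w1 - (a * X + b * - Y) by ring.
have -> : u2 - w2 - (X * b + Y * a) = u2 - w2 - (a * Y + b * X) by ring.
apply: le_trans (lerD K1 K2) _.
lra.
Qed.

Lemma Ddir_imul {V : normedModType R} (f : V -> C) w p :
  derivable (fun q => complex.Im (f q)) p w ->
  Ddir w (fun q => (0 +i* 1) * f q) p = (0 +i* 1) * Ddir w f p.
Proof.
have iE (c : C) : (0 +i* 1) * c = (- complex.Im c) +i* complex.Re c.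
  by case: c => a b; apply: complex_eq => /=; ring.
have E1 : (fun q => complex.Re ((0 +i* 1) * f q)) = (fun q => - complex.Im (f q)).
  by apply/funext => q; rewrite iE.
have E2 : (fun q => complex.Im ((0 +i* 1) * f q)) = (fun q => complex.Re (f q)).
  by apply/funext => q; rewrite iE.
move=> df; rewrite iE /Ddir E1 E2; apply: complex_eq; last by [].
exact: (deriveN df).
Qed.

(** Pairing complex differentiability with smoothness in two real variables gives a class stable
    under [derive1], on which induction on the order of the derivative is possible. *)
Definition holo (O : set C) (u : C -> C) : Prop :=
  (forall z, O z -> derivable (u : C^o -> C^o) z 1) /\
  smooth_on (toC @^-1` O) (u \o toC).

Lemma open_toC (O : set C) : open (O : set C^o) -> open (toC @^-1` O).
Proof.
move=> oO; rewrite openE => p Op.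
have /nbhs_n1[r r0 H] : \forall w \near (toC p : C^o), O w.
  exact: open_nbhs_nbhs.
apply/nbhs_ballP; exists (r / 2) => /=; first by rewrite divr_gt0.
move=> q [/= b1 b2]; apply: H; rewrite /n1 /=.
have := ltrD b1 b2; rewrite -splitr.
by rewrite distrC [X in _ + X]distrC.
Qed.

Lemma holo_derive1 (O : set C) u : open (O : set C^o) -> holo O u ->
  holo O (derive1 (u : C^o -> C^o)).
Proof.
move=> oO [du su]; have oU := open_toC oO; set U := toC @^-1` O in su oU.
have CR v p : U p -> Ddir v (u \o toC) p = derive1 (u : C^o -> C^o) (toC p) * toC v.
  move=> Up; have [D1 D2] := cderiv_is_derive v (derivable_cderiv (du _ Up)).
  by apply: complex_eq; rewrite /=; apply: derive_val.
have E p : U p -> Ddir ux (u \o toC) p = ((derive1 (u : C^o -> C^o)) \o toC) p.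
  by move=> Up; rewrite CR // [toC ux](_ : _ = 1) // mulr1.
have su' : smooth_on U ((derive1 (u : C^o -> C^o)) \o toC).
  by apply: eq_smooth_on E (smooth_on_Ddir ux su).
split; [move=> z Oz|exact: su'].
suff H p : U p -> derivable (derive1 (u : C^o -> C^o) : C^o -> C^o) (toC p) 1.
  by case: z Oz => a b Oz; exact: (H (a, b) Oz).
move=> {z Oz} Up; have [s1 s2] := su' 1%N.
suff /cderivP[d1 _] : cderiv (derive1 (u : C^o -> C^o)) (toC p)
  (Ddir ux ((derive1 (u : C^o -> C^o)) \o toC) p).
  exact: d1.
apply: (@cauchy_riemann_cderiv U (derive1 (u : C^o -> C^o)) _ oU Up);
  [exact: s1|exact: s2|].
have eqD w (f g : R * R -> C) q : U q -> (forall q', U q' -> f q' = g q') ->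
    Ddir w f q = Ddir w g q.
  move=> Uq fg; apply: complex_eq; apply: near_eq_derive;
    by apply: (near_open oU _ Uq) => q' Uq'; rewrite fg.
(* The derivative of [u] is its derivative along [ux]. Exchanging [uy] with [ux] moves the
   Cauchy-Riemann equation of [u] inside the outer derivative, where multiplication by the imaginary
   unit can be pulled out. *)
rewrite -!(eqD _ _ _ _ Up E) (Ddir_swap oU ux uy su Up).
have E2 q : U q -> Ddir uy (u \o toC) q = (0 +i* 1) * Ddir ux (u \o toC) q.
  by move=> Uq; rewrite !CR // [toC ux](_ : _ = 1) // mulr1 mulrC.
rewrite (eqD _ _ _ _ Up E2).
have [_ t2] := smooth_on_Ddir ux su 1%N.
exact: (Ddir_imul (Ck_on_derivable t2 Up)).
Qed.

End ComplexCalculus.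

(** * Exponential series in a normed algebra *)

Section TriangularSum.
Context {V : zmodType}.

Lemma triangular_sum (F : nat -> nat -> V) m :
  \sum_(n < m) \sum_(i < n.+1) F i (n - i)%N =
  \sum_(i < m) \sum_(j < m | (i + j < m)%N) F i j.
Proof.
transitivity (\sum_(n < m) \sum_(i < m | (i < n.+1)%N) F i (n - i)%N).
  by apply: eq_bigr => n _; rewrite (big_ord_widen _ (fun i => F i (n - i)%N) (ltn_ord n)).
rewrite (exchange_big_dep predT) //=; apply: eq_bigr => i _.
transitivity (\sum_(0 + i <= n < m) F i (n - i)%N).
  by rewrite add0n big_geq_mkord; apply: eq_bigl => n; rewrite ltnS.
rewrite big_addn big_mkord (big_ord_widen m (fun j => F i (j + i - i)%N)) ?leq_subr //.
by apply: eq_big => [j|j _]; rewrite ?addnK // ltn_subRL.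
Qed.

(** What separates the product of two partial sums from the partial sum of their Cauchy product is
    the part of the square on or beyond the antidiagonal [i + j = m]. *)
Lemma square_sum_split (F : nat -> nat -> V) m :
  \sum_(i < m) \sum_(j < m) F i j - \sum_(n < m) \sum_(i < n.+1) F i (n - i)%N =
  \sum_(i < m) \sum_(j < m | (m <= i + j)%N) F i j.
Proof.
rewrite triangular_sum -sumrB; apply: eq_bigr => i _.
rewrite (bigID (fun j : 'I_m => (i + j < m)%N)) /= [LHS]addrC addKr.
by apply: eq_bigl => j; rewrite -leqNgt.
Qed.

End TriangularSum.

(** Completeness is asked only for series dominated by an exponential series. [bscale] is a central
    copy of the reals. The norm of [1] is left unspecified, whence the factors [B 1] in the
    estimates below. *)
Record banach_norm (R : realType) (A : pzRingType) := BanachNorm {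
  bn :> A -> R;
  bscale : {rmorphism R -> A};
  bscaleC : forall r a, bscale r * a = a * bscale r;
  bn_ge0 : forall a, 0 <= bn a;
  bn_eq0 : forall a, bn a = 0 -> a = 0;
  bnD : forall a b, bn (a + b) <= bn a + bn b;
  bnN : forall a, bn (- a) = bn a;
  bnM : forall a b, bn (a * b) <= bn a * bn b;
  bnZ : forall r a, bn (bscale r * a) = `|r| * bn a;
  bn_complete : forall (a : nat -> A) (K x : R), 0 <= x ->
    (forall l, bn (a l) <= K * x ^+ l) ->
    exists s, (fun m => bn (\sum_(l < m) bscale l`!%:R^-1 * a l - s)) @ \oo --> (0 : R) }.

Section ExponentialSeries.
Context {R : realType} {A : pzRingType} (B : banach_norm R A).
Implicit Types (a b : nat -> A) (X H s : A).
Local Notation sc := (bscale B).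

Lemma bn0 : B 0 = 0.
Proof. by rewrite -(mul0r (1 : A)) -(rmorph0 sc) bnZ normr0 mul0r. Qed.

Lemma bnB s t : B (s - t) <= B s + B t.
Proof. by rewrite -(bnN B t); exact: bnD. Qed.

Lemma bn_sum (I : Type) (r : seq I) (P : pred I) (F : I -> A) :
  B (\sum_(i <- r | P i) F i) <= \sum_(i <- r | P i) B (F i).
Proof.
elim/big_ind2: _ => [|z x w y zx wy|//]; first by rewrite bn0.
exact: le_trans (bnD _ _ _) (lerD zx wy).
Qed.

Lemma bnX X l : B (X ^+ l) <= B 1 * B X ^+ l.
Proof.
elim: l => [|l IH]; first by rewrite !expr0 mulr1.
rewrite exprSr; apply: le_trans (bnM _ _ _) _.
by rewrite exprSr mulrA ler_wpM2r // bn_ge0.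
Qed.

Lemma cvg_eq_lim (u : nat -> R) (l l' : R) :
  u @ \oo --> l -> l = l' -> u @ \oo --> l'.
Proof. by move=> H <-. Qed.

Definition converges (u : nat -> A) s := (fun m => B (u m - s)) @ \oo --> (0 : R).

Lemma converges_squeeze (u : nat -> A) s (v : nat -> R) :
  (forall m, B (u m - s) <= v m) -> v @ \oo --> (0 : R) -> converges u s.
Proof.
move=> uv v0; apply: (@squeeze_cvgr _ _ _ _ (fun=> 0) v) => //; last exact: cvg_cst.
by near=> m; rewrite bn_ge0 uv.
Unshelve. all: by end_near. Qed.

Lemma converges_unique (u : nat -> A) s t : converges u s -> converges u t -> s = t.
Proof.
move=> us ut; apply/eqP; rewrite -subr_eq0; apply/eqP/(@bn_eq0 _ _ B).
have h : (fun _ : nat => B (s - t)) @ \oo --> (0 : R).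
  apply: (@squeeze_cvgr _ _ _ _ (fun=> 0) (fun m => B (u m - s) + B (u m - t))).
  - near=> m; rewrite bn_ge0 /= -(bnN B (u m - s)).
    have -> : s - t = - (u m - s) + (u m - t) by rewrite opprB addrA subrK.
    exact: bnD.
  - exact: cvg_cst.
  - exact: cvg_eq_lim (cvgD us ut) (addr0 _).
by have := cvg_unique _ (@cvg_cst _ (B (s - t)) _ \oo _) h; apply.
Unshelve. all: by end_near. Qed.

Lemma convergesB (u v : nat -> A) s t : converges u s -> converges v t ->
  converges (fun m => u m - v m) (s - t).
Proof.
move=> us vt; apply: (@converges_squeeze _ _ (fun m => B (u m - s) + B (v m - t))).
  by move=> m; rewrite opprD addrACA -opprD; exact: bnB.
exact: cvg_eq_lim (cvgD us vt) (addr0 _).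
Qed.

Lemma convergesMl c (u : nat -> A) s : converges u s ->
  converges (fun m => c * u m) (c * s).
Proof.
move=> us; apply: (@converges_squeeze _ _ (fun m => B c * B (u m - s))).
  by move=> m; rewrite -mulrBr; exact: bnM.
exact: cvg_eq_lim (cvgM (cvg_cst (B c)) us) (mulr0 _).
Qed.

Lemma convergesMr c (u : nat -> A) s : converges u s ->
  converges (fun m => u m * c) (s * c).
Proof.
move=> us; apply: (@converges_squeeze _ _ (fun m => B (u m - s) * B c)).
  by move=> m; rewrite -mulrBl; exact: bnM.
exact: cvg_eq_lim (cvgM us (cvg_cst (B c))) (mul0r _).
Qed.

Lemma convergesM (u v : nat -> A) s t : converges u s -> converges v t ->
  converges (fun m => u m * v m) (s * t).
Proof.
move=> us vt.
apply: (@converges_squeeze _ _ (fun m => B (u m - s) * (B (v m - t) + B t) + B s * B (v m - t))).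
  move=> m; have -> : u m * v m - s * t = (u m - s) * v m + s * (v m - t).
    by rewrite mulrBl mulrBr addrA subrK.
  apply: le_trans (bnD _ _ _) (lerD (le_trans (bnM _ _ _) _) (bnM _ _ _)).
  rewrite ler_wpM2l ?bn_ge0 // -[X in B X](subrK t); exact: bnD.
apply: cvg_eq_lim (cvgD (cvgM us (cvgD vt (cvg_cst (B t)))) (cvgM (cvg_cst (B s)) vt)) _.
by rewrite mul0r mulr0 addr0.
Qed.

Lemma converges_null (u v : nat -> A) s : converges u s ->
  (fun m => B (u m - v m)) @ \oo --> (0 : R) -> converges v s.
Proof.
move=> us uv.
apply: (@converges_squeeze _ _ (fun m => B (u m - v m) + B (u m - s))).
  move=> m; have -> : v m - s = - (u m - v m) + (u m - s).
    by rewrite opprB addrA subrK.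
  by apply: le_trans (bnD _ _ _) _; rewrite bnN.
exact: cvg_eq_lim (cvgD uv us) (addr0 _).
Qed.

(* The partial sums of the exponential generating series of [a], whose product is the
   series of the binomial convolution. *)
Definition egf a m : A := \sum_(l < m) sc l`!%:R^-1 * a l.

Definition egf_bound a K x := forall l, B (a l) <= K * x ^+ l.

Lemma egf_exists a K x : 0 <= x -> egf_bound a K x -> exists s, converges (egf a) s.
Proof. exact: bn_complete. Qed.

Lemma fact_inv_ge0 l : 0 <= (l`!%:R : R)^-1.
Proof. by rewrite invr_ge0 ler0n. Qed.

Lemma exp_series_cvg (x : R) :
  (fun m => \sum_(l < m) l`!%:R^-1 * x ^+ l) @ \oo --> expR x.
Proof.
have -> : (fun m => \sum_(l < m) l`!%:R^-1 * x ^+ l) = series (exp_coeff x).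
  apply/funext => m; rewrite /series /= big_mkord; apply: eq_bigr => l _.
  by rewrite /exp_coeff /= mulrC.
exact: is_cvg_series_exp_coeff.
Qed.

Lemma exp_series_le (x : R) m : 0 <= x ->
  \sum_(l < m) l`!%:R^-1 * x ^+ l <= expR x.
Proof.
move=> x0; pose u m := \sum_(l < m) (l`!%:R : R)^-1 * x ^+ l.
rewrite -(cvg_lim _ (@exp_series_cvg x)) //.
apply: (@nondecreasing_cvgn_le _ u); last by apply/cvg_ex; exists (expR x); exact: exp_series_cvg.
apply/nondecreasing_seqP => n; rewrite /u big_ord_recr /= lerDl.
by rewrite mulr_ge0 ?fact_inv_ge0 // exprn_ge0.
Qed.

Lemma egf_le a K x m : egf_bound a K x ->
  B (egf a m) <= K * \sum_(l < m) l`!%:R^-1 * x ^+ l.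
Proof.
move=> ba; apply: le_trans (bn_sum _ _ _) _; rewrite mulr_sumr; apply: ler_sum => l _.
by rewrite bnZ ger0_norm ?fact_inv_ge0 // mulrCA ler_wpM2l ?fact_inv_ge0.
Qed.

Lemma egf_lim_le a K x s : 0 <= x -> 0 <= K -> egf_bound a K x ->
  converges (egf a) s -> B s <= K * expR x.
Proof.
move=> x0 K0 ba cs.
have H : (fun m => B (egf a m - s) + K * expR x) @ \oo --> 0 + K * expR x.
  by apply: cvgD cs _; exact: cvg_cst.
rewrite -[leRHS]add0r -(cvg_lim _ H) //; apply: limr_ge; first by apply/cvg_ex; eexists; exact: H.
near=> m; rewrite -[X in B X](subrK (egf a m)).
apply: le_trans (bnD _ _ _) _; apply: lerD; first by rewrite -opprB bnN.
apply: le_trans (egf_le m ba) _; rewrite ler_wpM2l //; exact: exp_series_le.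
Unshelve. all: by end_near. Qed.

Definition conv a b n : A := \sum_(i < n.+1) a i * b (n - i)%N *+ 'C(n, i).

(** Pascal's rule: the shift is a derivation of the binomial convolution, just as differentiation is
    one for products of exponential generating functions. The identities on [conv] below are
    inductions or cancellations based on it. *)
Lemma conv_recr a b n : conv a b n.+1 = conv (a \o succn) b n + conv a (b \o succn) n.
Proof.
rewrite /conv big_ord_recl /= bin0 mulr1n subn0.
under eq_bigr => i _ do rewrite /bump /= add1n binS mulrnDr subSS.
rewrite big_split /= addrA addrC; congr (_ + _).
rewrite big_ord_recr /= bin_small // mulr0n addr0 [RHS]big_ord_recl /= bin0 mulr1n subn0.
congr (_ + _); apply: eq_bigr => i _; rewrite /bump /= add1n.
by congr (_ * b _ *+ _); rewrite -subSn ?subSS.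
Qed.

Lemma egf_conv a b m : egf (conv a b) m =
  \sum_(n < m) \sum_(i < n.+1) (sc i`!%:R^-1 * a i) * (sc (n - i)`!%:R^-1 * b (n - i)%N).
Proof.
apply: eq_bigr => n _; rewrite mulr_sumr; apply: eq_bigr => i _.
have ni : (i <= n)%N by rewrite -ltnS.
transitivity (sc (n`!%:R^-1 * 'C(n, i)%:R) * (a i * b (n - i)%N)).
  by rewrite rmorphM rmorph_nat -mulrA mulr_natl.
transitivity (sc (i`!%:R^-1 * (n - i)`!%:R^-1) * (a i * b (n - i)%N)).
  congr (sc _ * _); rewrite -(bin_fact ni) !natrM; field.
  by rewrite !pnatr_eq0 -!lt0n !fact_gt0 bin_gt0 ni.
by rewrite rmorphM -!mulrA; congr (_ * _); rewrite !mulrA bscaleC.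
Qed.

(** By [square_sum_split] the gap between the product of partial sums and the partial sum of the
    convolution is dominated term by term by [K * L] times the same gap for the scalar series of [x]
    and [y]. The latter tends to [0] by the addition formula for [expR]. *)
Lemma egfM a b K x L y s t : 0 <= x -> 0 <= y ->
  egf_bound a K x -> egf_bound b L y ->
  converges (egf a) s -> converges (egf b) t -> converges (egf (conv a b)) (s * t).
Proof.
move=> x0 y0 ba bb cs ct.
pose e z m : R := \sum_(l < m) l`!%:R^-1 * z ^+ l.
apply: (converges_null (convergesM cs ct)).
apply: (@squeeze_cvgr _ _ _ _ (fun=> 0) (fun m => K * L * (e x m * e y m - e (x + y) m))).
- near=> m; rewrite bn_ge0 /= egf_conv /egf mulr_suml.
  under eq_bigr do rewrite mulr_sumr.
  rewrite (square_sum_split (fun i j => (sc i`!%:R^-1 * a i) * (sc j`!%:R^-1 * b j))).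
  have -> : e x m * e y m - e (x + y) m =
      \sum_(i < m) \sum_(j < m | (m <= i + j)%N) i`!%:R^-1 * x ^+ i * (j`!%:R^-1 * y ^+ j).
    rewrite -(square_sum_split (fun i j => i`!%:R^-1 * x ^+ i * (j`!%:R^-1 * y ^+ j))).
    rewrite /e mulr_suml; congr (_ - _); first by apply: eq_bigr => i _; rewrite mulr_sumr.
    apply: eq_bigr => n _; rewrite addrC exprDn mulr_sumr; apply: eq_bigr => i _.
    have ni : (i <= n)%N by rewrite -ltnS.
    rewrite -(bin_fact ni) !natrM -mulr_natl; field.
    by rewrite !pnatr_eq0 -!lt0n !fact_gt0 bin_gt0 ni.
  apply: le_trans (bn_sum _ _ _) _; rewrite mulr_sumr; apply: ler_sum => i _.
  apply: le_trans (bn_sum _ _ _) _; rewrite mulr_sumr; apply: ler_sum => j _.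
  have H1 c M z l : egf_bound c M z -> B (sc l`!%:R^-1 * c l) <= M * (l`!%:R^-1 * z ^+ l).
    by move=> bc; rewrite bnZ ger0_norm ?fact_inv_ge0 // mulrCA ler_wpM2l ?fact_inv_ge0.
  apply: le_trans (bnM _ _ _) _; rewrite mulrACA.
  by apply: ler_pM; rewrite ?bn_ge0 //; exact: H1.
- exact: cvg_cst.
- apply: cvg_eq_lim (cvgM (cvg_cst (K * L)) (cvgB (cvgM (@exp_series_cvg x)
    (@exp_series_cvg y)) (@exp_series_cvg (x + y)))) _.
  by rewrite expRD subrr mulr0.
Unshelve. all: by end_near. Qed.

Fixpoint ad_iter X H n : A :=
  if n is n'.+1 then X * ad_iter X H n' - ad_iter X H n' * X else H.

(** Left and right multiplication by [X] commute, so this is the binomial expansion of the [n]-th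
    power of their difference, applied to [H]. *)
Lemma conv_ad X H n :
  conv (fun i => X ^+ i * H) (fun j => (- X) ^+ j) n = ad_iter X H n.
Proof.
elim: n => [|n IH].
  by rewrite /conv big_ord_recl big_ord0 /= !expr0 mul1r mulr1 addr0.
rewrite conv_recr /= -IH; congr (_ + _).
  rewrite /conv mulr_sumr; apply: eq_bigr => i _.
  by rewrite /= exprS mulrnAr !mulrA.
rewrite /conv mulr_suml -sumrN; apply: eq_bigr => i _ /=.
by rewrite exprSr mulrnAl !mulrN mulNrn !mulrA.
Qed.

(* The differential of [X |-> X ^+ l] in the direction [H]. *)
Fixpoint dpow X H l : A :=
  if l is l'.+1 then dpow X H l' * X + X ^+ l' * H else 0.

Lemma conv_dpow0 X H : conv (dpow X H) (fun j => (- X) ^+ j) 0 = 0.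
Proof. by rewrite /conv big_ord_recl big_ord0 /= mul0r mul0rn addr0. Qed.

(** Under [conv_recr] the terms [dpow X H i * X] cancel against those from the shifted powers of
    [- X], and what remains is [conv_ad]. This is the combinatorial content of the formula for the
    differential of the exponential. *)
Lemma conv_dpow X H n :
  conv (dpow X H) (fun j => (- X) ^+ j) n.+1 = ad_iter X H n.
Proof.
rewrite conv_recr -conv_ad /conv -big_split /=; apply: eq_bigr => i _.
rewrite /= -mulrnDl mulrDl addrAC exprS !mulrA mulrN mulNr.
by rewrite subrr add0r.
Qed.

Lemma egf_bound_pow X : egf_bound (fun l => X ^+ l) (B 1) (B X).
Proof. by move=> l; exact: bnX. Qed.

Lemma egf_bound_powN X : egf_bound (fun l => (- X) ^+ l) (B 1) (B X).
Proof. by move=> l; rewrite -(bnN B X); exact: bnX. Qed.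

(** The base [1 + B X] is at least [1], so the exponent [l] may stand for the exact [l - 1], which
    would be awkward at [l = 0]. *)
Lemma bn_dpow X H l : B (dpow X H l) <= l%:R * (B 1 * (1 + B X) ^+ l * B H).
Proof.
have M1 : 1 <= 1 + B X by rewrite lerDl bn_ge0.
elim: l => [|l IH]; first by rewrite /= bn0 mul0r.
rewrite /= -natr1 mulrDl mul1r; apply: le_trans (bnD _ _ _) _; apply: lerD.
  apply: le_trans (bnM _ _ _) _.
  apply: le_trans (ler_wpM2r (bn_ge0 _ _) IH) _.
  have -> : l%:R * (B 1 * (1 + B X) ^+ l.+1 * B H) =
    l%:R * (B 1 * (1 + B X) ^+ l * B H) * (1 + B X) by rewrite exprSr; ring.
  apply: ler_wpM2l; last by rewrite lerDr.
  by rewrite !mulr_ge0 ?bn_ge0 // exprn_ge0 // (le_trans ler01).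
apply: le_trans (bnM _ _ _) _; rewrite ler_wpM2r ?bn_ge0 //.
apply: le_trans (bnX _ _) _; rewrite ler_wpM2l ?bn_ge0 //.
apply: (@le_trans _ _ ((1 + B X) ^+ l)).
  by rewrite lerXn2r ?nnegrE ?bn_ge0 ?lerDr // (le_trans ler01).
by rewrite exprSr ler_peMr // exprn_ge0 // (le_trans ler01).
Qed.

Lemma natr_le_exp2 l : (l%:R : R) <= 2 ^+ l.
Proof. by rewrite -natrX ler_nat ltnW // ltn_expl. Qed.

(** The linear factor [l] is absorbed into [2 ^+ l], which explains the [2] in the base. *)
Lemma egf_bound_dpow X H :
  egf_bound (dpow X H) (B 1 * B H) (2 * (1 + B X)).
Proof.
move=> l; apply: le_trans (bn_dpow _ _ _) _.
rewrite exprMn; have -> : B 1 * B H * (2 ^+ l * (1 + B X) ^+ l) =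
  2 ^+ l * (B 1 * (1 + B X) ^+ l * B H) by ring.
apply: ler_wpM2r (natr_le_exp2 l).
by rewrite !mulr_ge0 ?bn_ge0 // exprn_ge0 // addr_ge0 // bn_ge0.
Qed.

Lemma exp_conjugate X s t H : converges (egf (fun l => X ^+ l)) s ->
  converges (egf (fun l => (- X) ^+ l)) t -> converges (egf (ad_iter X H)) (s * H * t).
Proof.
move=> cs ct.
have -> : ad_iter X H = conv (fun i => X ^+ i * H) (fun j => (- X) ^+ j).
  by apply/funext => n; rewrite conv_ad.
apply: (@egfM _ _ (B 1 * B H) (B X) (B 1) (B X)); rewrite ?bn_ge0 //.
- move=> l; apply: le_trans (bnM _ _ _) _; rewrite mulrAC.
  by rewrite ler_wpM2r ?bn_ge0 // bnX.
- exact: egf_bound_powN.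
- have := convergesMr H cs; congr (converges _ _); apply/funext => m.
  by rewrite /egf mulr_suml; apply: eq_bigr => i _; rewrite mulrA.
Qed.

(** Conjugating [1]: all iterated brackets of [X] with [1] vanish, so the series of [exp_conjugate]
    reduces to its first term. *)
Lemma exp_mulN X s t : converges (egf (fun l => X ^+ l)) s ->
  converges (egf (fun l => (- X) ^+ l)) t -> s * t = 1.
Proof.
move=> cs ct; have := exp_conjugate 1 cs ct; rewrite mulr1 => c1.
apply: converges_unique c1 _.
have T n : ad_iter X 1 n.+1 = 0.
  by elim: n => [|n IH] /=; [rewrite mulr1 mul1r subrr|rewrite -/(ad_iter X 1 n.+1) IH mulr0 mul0r subrr].
apply: (@converges_null (fun=> 1)).
  by rewrite /converges subrr bn0; exact: cvg_cst.
have D m : (0 < m)%N -> B (1 - egf (ad_iter X 1) m) = 0.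
  case: m => // m _; rewrite /egf big_ord_recl big1 => [|i _].
    by rewrite /= invr1 rmorph1 mul1r addr0 subrr bn0.
  by rewrite lift0 T mulr0.
apply/cvgrPdist_lt => e e0; near=> m.
rewrite D ?subrr ?normr0 //; near: m; exact: nbhs_infty_gt.
Unshelve. all: by end_near. Qed.

(** The sequence starts with [0] and is shifted by one, so that the weight of the [n]-th iterated
    bracket is the inverse of the factorial of [n + 1]. *)
Lemma dexp_log X H d t : converges (egf (dpow X H)) d ->
  converges (egf (fun l => (- X) ^+ l)) t ->
  converges (egf (fun n => if n is n'.+1 then ad_iter X H n' else 0)) (d * t).
Proof.
move=> cd ct.
have -> : (fun n => if n is n'.+1 then ad_iter X H n' else 0) =
    conv (dpow X H) (fun j => (- X) ^+ j).
  by apply/funext => -[|n]; rewrite ?conv_dpow0 ?conv_dpow.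
apply: (@egfM _ _ (B 1 * B H) (2 * (1 + B X)) (B 1) (B X)) => //; rewrite ?bn_ge0 //.
- by rewrite mulr_ge0 // addr_ge0 // bn_ge0.
- exact: egf_bound_dpow.
- exact: egf_bound_powN.
Qed.

(** The second-order Taylor remainder of the [l]-th power at [X]. *)
Definition pow_rem X H l : A := (X + H) ^+ l - X ^+ l - dpow X H l.

Lemma bn_powB X H M l : 1 <= M -> B X <= M -> B (X + H) <= M ->
  B ((X + H) ^+ l - X ^+ l) <= l%:R * (B 1 * M ^+ l * B H).
Proof.
move=> M1 MX MY; have M0 : 0 <= M := le_trans ler01 M1.
elim: l => [|l IH]; first by rewrite !expr0 subrr bn0 mul0r.
have -> : (X + H) ^+ l.+1 - X ^+ l.+1 = ((X + H) ^+ l - X ^+ l) * X + (X + H) ^+ l * H.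
  by rewrite mulrBl !exprSr mulrDr addrAC.
rewrite -natr1 [leRHS]mulrDl mul1r; apply: le_trans (bnD _ _ _) _; apply: lerD.
  apply: le_trans (bnM _ _ _) _.
  apply: le_trans (ler_pM (bn_ge0 _ _) (bn_ge0 _ _) IH MX) _.
  by rewrite exprSr le_eqVlt; apply/orP; left; apply/eqP; ring.
apply: le_trans (bnM _ _ _) _; rewrite ler_wpM2r ?bn_ge0 //.
apply: le_trans (bnX _ _) _; rewrite ler_wpM2l ?bn_ge0 //.
apply: (@le_trans _ _ (M ^+ l)); first by rewrite lerXn2r ?nnegrE ?bn_ge0.
by rewrite exprSr ler_peMr // exprn_ge0.
Qed.

Lemma bn_pow_rem X H M l : 1 <= M -> B X <= M -> B (X + H) <= M ->
  B (pow_rem X H l) <= l%:R ^+ 2 * (B 1 * M ^+ l * B H ^+ 2).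
Proof.
move=> M1 MX MY; have M0 : 0 <= M := le_trans ler01 M1.
elim: l => [|l IH].
  by rewrite /pow_rem /= !expr0 subrr subr0 bn0 expr0n mul0r.
have -> : pow_rem X H l.+1 = pow_rem X H l * X + ((X + H) ^+ l - X ^+ l) * H.
  by rewrite /pow_rem /= !exprSr mulrDr !mulrBl opprD [X in X + _ = _]addrAC addrACA.
apply: (@le_trans _ _ (l%:R ^+ 2 * (B 1 * M ^+ l * B H ^+ 2) * M +
                       l%:R * (B 1 * M ^+ l * B H) * B H)).
  apply: le_trans (bnD _ _ _) (lerD (le_trans (bnM _ _ _) _) (le_trans (bnM _ _ _) _)).
    by apply: ler_pM => //; exact: bn_ge0.
  by rewrite ler_wpM2r ?bn_ge0 // bn_powB.
set c := B 1 * M ^+ l * B H ^+ 2.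
have c0 : 0 <= c by rewrite !mulr_ge0 ?bn_ge0 // exprn_ge0 // bn_ge0.
have -> : l.+1%:R ^+ 2 * (B 1 * M ^+ l.+1 * B H ^+ 2) =
    (l%:R + 1) ^+ 2 * c * M by rewrite /c (exprSr M) -natr1; ring.
have -> : l%:R * (B 1 * M ^+ l * B H) * B H = l%:R * c by rewrite /c; ring.
have h1 : l%:R * c <= l%:R * c * M by rewrite ler_peMr // mulr_ge0.
have -> : (l%:R + 1) ^+ 2 * c * M = l%:R ^+ 2 * c * M + (l%:R * c * M + (l%:R + 1) * c * M).
  by ring.
rewrite lerD2l (le_trans h1) // lerDl.
by apply: mulr_ge0 => //; apply: mulr_ge0 => //; rewrite addr_ge0 // ler0n.
Qed.

(** The quadratic factor in [l] is absorbed into [4 ^+ l]; the exponential of [4 * M] in the later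
    estimates comes from here. *)
Lemma egf_bound_pow_rem X H M : 1 <= M -> B X <= M -> B (X + H) <= M ->
  egf_bound (pow_rem X H) (B 1 * B H ^+ 2) (4 * M).
Proof.
move=> M1 MX MY l; apply: le_trans (bn_pow_rem _ M1 MX MY) _.
rewrite exprMn; have -> : B 1 * B H ^+ 2 * (4 ^+ l * M ^+ l) =
  4 ^+ l * (B 1 * M ^+ l * B H ^+ 2) by ring.
apply: ler_wpM2r.
  by rewrite !mulr_ge0 ?bn_ge0 // exprn_ge0 // ?bn_ge0 // (le_trans ler01).
have -> : (4 : R) = 2 ^+ 2 by ring.
by rewrite exprAC lerXn2r ?nnegrE // ?exprn_ge0 // natr_le_exp2.
Qed.

Lemma egfB a b m : egf (fun l => a l - b l) m = egf a m - egf b m.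
Proof. by rewrite /egf -sumrB; apply: eq_bigr => l _; rewrite mulrBr. Qed.

Lemma egfZ r a m : egf (fun l => sc r * a l) m = sc r * egf a m.
Proof.
by rewrite /egf mulr_sumr; apply: eq_bigr => l _; rewrite !mulrA -!rmorphM mulrC.
Qed.

Lemma dpowB X H1 H2 r l : dpow X (H1 - sc r * H2) l = dpow X H1 l - sc r * dpow X H2 l.
Proof.
elim: l => [|l IH] /=; first by rewrite mulr0 subr0.
rewrite IH mulrBl mulrBr mulrDr -!mulrA (mulrA _ (sc r)) -bscaleC -mulrA.
by rewrite opprD addrACA.
Qed.

Lemma exp_second_order X Y s s' d : converges (egf (fun l => X ^+ l)) s ->
  converges (egf (fun l => Y ^+ l)) s' -> converges (egf (dpow X (Y - X))) d ->
  forall M, 1 <= M -> B X <= M -> B Y <= M ->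
  B (s' - s - d) <= B 1 * B (Y - X) ^+ 2 * expR (4 * M).
Proof.
move=> cs cs' cd M M1 MX MY; have M0 : 0 <= M := le_trans ler01 M1.
have E : X + (Y - X) = Y by rewrite addrC subrK.
apply: (@egf_lim_le (pow_rem X (Y - X)) _ (4 * M)).
- by rewrite mulr_ge0.
- by rewrite mulr_ge0 ?exprn_ge0 ?bn_ge0.
- by apply: egf_bound_pow_rem; rewrite ?E.
have := convergesB (convergesB cs' cs) cd; congr (converges _ _).
by apply/funext => m; rewrite -!egfB /pow_rem E.
Qed.

Lemma dexp_le X H1 H2 r d1 d2 : converges (egf (dpow X H1)) d1 ->
  converges (egf (dpow X H2)) d2 ->
  B (d1 - sc r * d2) <= B 1 * B (H1 - sc r * H2) * expR (2 * (1 + B X)).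
Proof.
move=> c1 c2; apply: (@egf_lim_le (dpow X (H1 - sc r * H2))).
- by rewrite mulr_ge0 // addr_ge0 // bn_ge0.
- by rewrite mulr_ge0 ?bn_ge0.
- exact: egf_bound_dpow.
have := convergesB c1 (convergesMl (sc r) c2); congr (converges _ _).
apply/funext => m; rewrite -egfZ -egfB; apply: eq_bigr => l _.
by rewrite dpowB.
Qed.

(** Differentiability at [0] without quotients, meaningful in a ring that carries only the norm [B];
    [t = 0] needs no exclusion, both sides vanishing there. *)
Definition has_velocity (y : R -> A) (d : A) :=
  forall e : R, 0 < e -> \forall t \near (0 : R), B (y t - y 0 - sc t * d) <= e * `|t|.

Lemma near_eq_velocity (y z : R -> A) d : (\forall t \near (0 : R), y t = z t) ->
  has_velocity y d -> has_velocity z d.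
Proof.
move=> yz vy e e0; rewrite -(nbhs_singleton yz).
by near=> t; rewrite -(near yz t) //; near: t; exact: vy.
Unshelve. all: by end_near. Qed.

Lemma velocity_cst s : has_velocity (fun=> s) 0.
Proof. by move=> e e0; near=> t; rewrite subrr mulr0 subr0 bn0 mulr_ge0 // ltW.
Unshelve. all: by end_near. Qed.

Lemma near0_le (e : R) : 0 < e -> \forall t \near (0 : R), `|t| <= e.
Proof.
move=> e0; apply/nbhs_ballP; exists e => //= t.
by rewrite -ball_normE /= sub0r normrN => /ltW.
Qed.

Lemma velocity_small (y : R -> A) d : has_velocity y d -> forall e : R, 0 < e ->
  \forall t \near (0 : R), B (y t - y 0) <= (1 + B d) * `|t| /\ B (y t - y 0) <= e.
Proof.
move=> vy e e0; have c0 : 0 < 1 + B d by rewrite ltr_wpDr // bn_ge0.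
near=> t.
have h : B (y t - y 0) <= (1 + B d) * `|t|.
  rewrite -[X in B X](subrK (sc t * d)); apply: le_trans (bnD _ _ _) _.
  rewrite mulrDl bnZ [`|t| * _]mulrC lerD //.
  by near: t; exact: vy.
split=> //; apply: le_trans h _; rewrite mulrC -ler_pdivlMr //.
by near: t; apply: near0_le; rewrite divr_gt0.
Unshelve. all: by end_near. Qed.

Lemma velocityM (y z : R -> A) d d' : has_velocity y d -> has_velocity z d' ->
  has_velocity (fun t => y t * z t) (d * z 0 + y 0 * d').
Proof.
move=> vy vz e e0.
(* [K] dominates the bounded factor of each of the three error terms, so that each contributes at
   most a third of the allowed error. *)
pose K := B (z 0) + B (y 0) + (1 + B d) + 1.
have K0 : 0 < K.
  by rewrite /K ltr_wpDl // !addr_ge0 // bn_ge0.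
have eK : 0 < e / K / 3 by rewrite !divr_gt0.
near=> t.
have h1 : B (y t - y 0 - sc t * d) <= e / K / 3 * `|t| by near: t; exact: vy.
have h2 : B (z t - z 0 - sc t * d') <= e / K / 3 * `|t| by near: t; exact: vz.
have [h3 _] : B (y t - y 0) <= (1 + B d) * `|t| /\ B (y t - y 0) <= 1.
  by near: t; exact: velocity_small.
have [_ h4] : B (z t - z 0) <= (1 + B d') * `|t| /\ B (z t - z 0) <= e / K / 3.
  by near: t; exact: velocity_small.
have -> : y t * z t - y 0 * z 0 - sc t * (d * z 0 + y 0 * d') =
  (y t - y 0 - sc t * d) * z 0 + (y 0 * (z t - z 0 - sc t * d') +
   (y t - y 0) * (z t - z 0)).
  have -> : sc t * (d * z 0 + y 0 * d') = sc t * d * z 0 + y 0 * (sc t * d').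
    by rewrite mulrDr mulrA (mulrA (y 0)) -bscaleC mulrA.
  have -> : y t * z t - y 0 * z 0 =
      (y t - y 0) * z 0 + (y 0 * (z t - z 0) + (y t - y 0) * (z t - z 0)).
    rewrite addrCA -mulrDr (addrC (z 0)) subrK mulrBr mulrBl [RHS]addrC.
    by rewrite addrA subrK.
  rewrite (mulrBl (z 0) (y t - y 0)) (mulrBr (y 0) (z t - z 0)).
  by rewrite [_ - _ + _ * _]addrAC addrACA opprD.
have n0 : 0 <= `|t| by [].
apply: le_trans (bnD _ _ _) _.
apply: le_trans (lerD (bnM _ _ _) (le_trans (bnD _ _ _) (lerD (bnM _ _ _) (bnM _ _ _)))) _.
have q0 : 0 <= e / K / 3 by rewrite ltW.
have b1 : B (y t - y 0 - sc t * d) * B (z 0) <= e / K / 3 * `|t| * K.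
  by apply: ler_pM; rewrite ?bn_ge0 // /K; have := bn_ge0 B (y 0); have := bn_ge0 B d; lra.
have b2 : B (y 0) * B (z t - z 0 - sc t * d') <= K * (e / K / 3 * `|t|).
  by apply: ler_pM; rewrite ?bn_ge0 // /K; have := bn_ge0 B (z 0); have := bn_ge0 B d; lra.
have b3 : B (y t - y 0) * B (z t - z 0) <= K * `|t| * (e / K / 3).
  apply: ler_pM; rewrite ?bn_ge0 //; apply: le_trans h3 _; rewrite ler_wpM2r // /K.
  by have := bn_ge0 B (z 0); have := bn_ge0 B (y 0); lra.
have E1 : e / K / 3 * `|t| * K = e * `|t| / 3 by field; rewrite lt0r_neq0.
have E2 : K * (e / K / 3 * `|t|) = e * `|t| / 3 by field; rewrite lt0r_neq0.
have E3 : K * `|t| * (e / K / 3) = e * `|t| / 3 by field; rewrite lt0r_neq0.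
rewrite E1 in b1; rewrite E2 in b2; rewrite E3 in b3; lra.
Unshelve. all: by end_near. Qed.

(** The increment of the exponential is compared with its differential at [x 0] applied to
    [x t - x 0], with a quadratic error, and this in turn with [t] times [d], by linearity of the
    differential. *)
Lemma velocity_exp (x y : R -> A) H d : has_velocity x H ->
  (forall t, converges (egf (fun l => x t ^+ l)) (y t)) ->
  converges (egf (dpow (x 0) H)) d -> has_velocity y d.
Proof.
move=> vx cy cd e e0; pose M := B (x 0) + 1.
(* [K1 - 1] and [K2 - 1] are the constants of [exp_second_order] and [dexp_le], the former including
   the Lipschitz bound [1 + B H]; adding [1] makes them positive. Of the two factors [B (x t - x 0)]
   in the quadratic error one supplies the modulus of [t], the other the smallness. *)
pose K1 := B 1 * (1 + B H) * expR (4 * M) + 1.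
pose K2 := B 1 * expR (2 * (1 + B (x 0))) + 1.
have K10 : 0 < K1 by rewrite ltr_wpDl // !mulr_ge0 ?bn_ge0 ?expR_ge0 // addr_ge0 // bn_ge0.
have K20 : 0 < K2 by rewrite ltr_wpDl // mulr_ge0 ?bn_ge0 ?expR_ge0.
near=> t.
have [h1 h1'] : B (x t - x 0) <= (1 + B H) * `|t| /\ B (x t - x 0) <= e / K1 / 2.
  by near: t; apply: velocity_small => //; rewrite !divr_gt0.
have [_ h2] : B (x t - x 0) <= (1 + B H) * `|t| /\ B (x t - x 0) <= 1.
  by near: t; exact: velocity_small.
have h3 : B (x t - x 0 - sc t * H) <= e / K2 / 2 * `|t|.
  by near: t; apply: vx; rewrite !divr_gt0.
have [|d' cd'] := @egf_exists (dpow (x 0) (x t - x 0)) _ _ _ (@egf_bound_dpow _ _).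
  by rewrite mulr_ge0 // addr_ge0 // bn_ge0.
have Mt : B (x t) <= M.
  rewrite -[X in B X](subrK (x 0)); apply: le_trans (bnD _ _ _) _.
  by rewrite addrC lerD2l.
have M1 : 1 <= M by rewrite lerDr bn_ge0.
have Mx : B (x 0) <= M by rewrite lerDl.
have b1 := exp_second_order (cy 0) (cy t) cd' M1 Mx Mt.
have b2 := dexp_le t cd' cd.
have -> : y t - y 0 - sc t * d = (y t - y 0 - d') + (d' - sc t * d).
  by rewrite addrA subrK.
apply: le_trans (bnD _ _ _) _.
have n0 : 0 <= `|t| by [].
have c1 : B (y t - y 0 - d') <= K1 * `|t| * (e / K1 / 2).
  apply: le_trans b1 _.
  apply: (@le_trans _ _ (B 1 * ((1 + B H) * `|t| * (e / K1 / 2)) * expR (4 * M))).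
    rewrite ler_wpM2r ?expR_ge0 // ler_wpM2l ?bn_ge0 // expr2.
    by apply: ler_pM; rewrite ?bn_ge0.
  have -> : B 1 * ((1 + B H) * `|t| * (e / K1 / 2)) * expR (4 * M) =
    (K1 - 1) * `|t| * (e / K1 / 2) by rewrite /K1; ring.
  have q0 : 0 <= e / K1 / 2 by rewrite ltW // !divr_gt0.
  by apply: (ler_wpM2r q0); apply: (ler_wpM2r n0); rewrite gerBl.
have c2 : B (d' - sc t * d) <= K2 * (e / K2 / 2 * `|t|).
  apply: le_trans b2 _.
  have -> : B 1 * B (x t - x 0 - sc t * H) * expR (2 * (1 + B (x 0))) =
    (K2 - 1) * B (x t - x 0 - sc t * H) by rewrite /K2; ring.
  apply: ler_pM; rewrite ?bn_ge0 //; last by rewrite gerBl.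
  by rewrite /K2 addrK mulr_ge0 ?bn_ge0 ?expR_ge0.
have E1 : K1 * `|t| * (e / K1 / 2) = e * `|t| / 2 by field; rewrite lt0r_neq0.
have E2 : K2 * (e / K2 / 2 * `|t|) = e * `|t| / 2 by field; rewrite lt0r_neq0.
rewrite E1 in c1; rewrite E2 in c2; lra.
Unshelve. all: by end_near. Qed.

End ExponentialSeries.

(** * Matrices of truncated polynomials *)

Section TruncCoefficients.
Context {R : realType} {n : nat}.
Local Notation C := R[i].
Local Notation T := (trunc R n).
Implicit Types (a b : T) (c : C).

Lemma tcoefD a b p : tcoef (a + b) p = tcoef a p + tcoef b p.
Proof. by rewrite /tcoef poly_of_qpolyD coefD. Qed.

Lemma tcoef_zero p : tcoef (0 : T) p = 0.
Proof. by rewrite /tcoef coef0. Qed.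

Lemma tcoefN a p : tcoef (- a) p = - tcoef a p.
Proof. by apply/eqP; rewrite -addr_eq0 -tcoefD addNr tcoef_zero. Qed.

Lemma tcoef_sum (I : Type) (r : seq I) (P : pred I) (F : I -> T) p :
  tcoef (\sum_(i <- r | P i) F i) p = \sum_(i <- r | P i) tcoef (F i) p.
Proof.
elim/big_rec2: _ => [|i x y _ <-]; [exact: tcoef_zero|exact: tcoefD].
Qed.

Lemma qpolyC_alg c : qpolyC 'X^n c = c%:A :> T.
Proof. by apply: val_inj; rewrite [RHS]poly_of_qpolyZ /= alg_polyC. Qed.

Lemma tcoefZ c a p : tcoef (qpolyC 'X^n c * a) p = c * tcoef a p.
Proof. by rewrite qpolyC_alg mulr_algl /tcoef poly_of_qpolyZ coefZ. Qed.

Lemma tcoefC c p : tcoef (qpolyC 'X^n c : T) p = if p == 0%N then c else 0.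
Proof. by rewrite /tcoef coefC. Qed.

(** There are [n.-1.+1] coefficients, because the modulus becomes ['X] when [n = 0]; hence the bound
    [p <= n.-1]. For positive [n] it agrees with the bound [p < n] of [to_trunc]. *)
Lemma tcoef_inj a b : (forall p, (p <= n.-1)%N -> tcoef a p = tcoef b p) -> a = b.
Proof.
move=> ab; apply: val_inj; apply/polyP => p.
case: (leqP p n.-1) => pn; first exact: ab.
by have := tcoef_big a pn; have := tcoef_big b pn; rewrite /tcoef => -> ->.
Qed.

Lemma tcoef_to_trunc (u : nat -> C) p : tcoef (to_trunc n u) p = if (p < n)%N then u p else 0.
Proof.
have E : size (mk_monic ('X^n : {poly C})) = n.-1.+2.
  by rewrite mk_monic_Xn size_polyXn.
rewrite /tcoef /to_trunc in_qpoly_small ?coef_poly // E.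
by apply: leq_ltn_trans (size_poly _ _) _; case: (n).
Qed.

Lemma unit_tcoef0 a : tcoef a 0 != 0 -> a \is a GRing.unit.
Proof.
have cop (q : {poly C}) : q`_0 != 0 -> coprimep (mk_monic ('X^n : {poly C})) q.
  move=> q0; rewrite mk_monic_Xn; apply: coprimep_expl.
  by rewrite coprimep_sym coprimepX rootE horner_coef0.
move=> /cop a0; apply/unitrP; exists (qpoly_inv a).
by rewrite qpoly_mulVz // mulrC qpoly_mulVz.
Qed.

End TruncCoefficients.

Lemma cvg_sum0 {R : realType} (I : finType) (F : I -> nat -> R) :
  (forall i, F i @ \oo --> (0 : R)) -> (fun m => \sum_i F i m) @ \oo --> (0 : R).
Proof.
move=> F0; elim: (index_enum I) => [|i r IH].
  by under eq_fun do rewrite big_nil; exact: cvg_cst.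
under eq_fun do rewrite big_cons; exact: cvg_eq_lim (cvgD (F0 i) IH) (addr0 _).
Qed.

(** * A complete submultiplicative norm *)

Section TruncMatrixNorm.
Context {R : realType} {n N : nat}.
Local Notation C := R[i].
Local Notation T := (trunc R n).
Implicit Types (a b : 'M[T]_N).

Definition mxcoef a (i j : 'I_N) p : C := tcoef (a i j) p.

Definition coef_norm a : R := \sum_i \sum_j \sum_(p < n.-1.+1) n1 (mxcoef a i j p).

(* The factor makes the norm submultiplicative. *)
Definition mxnorm a : R := (N * N * n.-1.+1).+1%:R * coef_norm a.

Lemma coef_norm_ge0 a : 0 <= coef_norm a.
Proof. by do 3![apply: sumr_ge0 => ? _]; exact: n1_ge0. Qed.

Lemma ler_term (I : finType) (F : I -> R) i : (forall j, 0 <= F j) -> F i <= \sum_j F j.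
Proof. by move=> F0; rewrite (bigD1 i) //= lerDl sumr_ge0. Qed.

Lemma mxcoef_le a i j p : n1 (mxcoef a i j p) <= coef_norm a.
Proof.
case: (leqP p n.-1) => pn; last by rewrite /mxcoef tcoef_big // n10 coef_norm_ge0.
have g0 i' j' : 0 <= \sum_(p < n.-1.+1) n1 (mxcoef a i' j' p).
  by apply: sumr_ge0 => ? _; exact: n1_ge0.
have h1 := @ler_term _ (fun i => \sum_j \sum_(p < n.-1.+1) n1 (mxcoef a i j p)) i
  (fun i' => sumr_ge0 _ (fun j' _ => g0 i' j')).
have h2 := @ler_term _ (fun j => \sum_(p < n.-1.+1) n1 (mxcoef a i j p)) j (g0 i).
apply: le_trans h1; apply: le_trans h2.
exact: (@ler_term _ (fun p : 'I_n.-1.+1 => n1 (mxcoef a i j p))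
  (Ordinal (pn : (p < n.-1.+1)%N)) (fun=> n1_ge0 _)).
Qed.

Lemma coef_norm_le a e : (forall i j p, (p <= n.-1)%N -> n1 (mxcoef a i j p) <= e) ->
  coef_norm a <= (N * N * n.-1.+1)%:R * e.
Proof.
move=> H; rewrite /coef_norm.
apply: (@le_trans _ _ (\sum_(i < N) \sum_(j < N) \sum_(p < n.-1.+1) e)).
  by do 3![apply: ler_sum => ? _]; apply: H; rewrite -ltnS.
rewrite !big_const_ord !iter_addr_0 -!mulrnA mulr_natl.
by rewrite (mulnC n.-1.+1).
Qed.

Lemma mxcoefM a b i j p : (p <= n.-1)%N -> mxcoef (a * b) i j p =
  \sum_k \sum_(q < p.+1) mxcoef a i k q * mxcoef b k j (p - q).
Proof.
by move=> pn; rewrite /mxcoef mxE tcoef_sum; apply: eq_bigr => k _; rewrite tcoefM.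
Qed.

Lemma mxcoefM_le a b i j p : n1 (mxcoef (a * b) i j p) <= coef_norm a * coef_norm b.
Proof.
case: (leqP p n.-1) => pn; last first.
  by rewrite /mxcoef tcoef_big // n10 mulr_ge0 ?coef_norm_ge0.
rewrite mxcoefM //; apply: (@le_trans _ _
    (\sum_k \sum_(q < n.-1.+1) n1 (mxcoef a i k q) * coef_norm b)).
  apply: le_trans (n1_sum _ _ _) (ler_sum _ _) => k _.
  apply: le_trans (n1_sum _ _ _) _.
  rewrite [leRHS](bigID (fun q : 'I_n.-1.+1 => (q < p.+1)%N)) /=.
  rewrite -[leLHS]addr0; apply: lerD; last first.
    by apply: sumr_ge0 => q _; rewrite mulr_ge0 ?n1_ge0 ?coef_norm_ge0.
  rewrite (big_ord_widen n.-1.+1 (fun q => n1 (mxcoef a i k q * mxcoef b k j (p - q)))) ?ltnS //.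
  apply: ler_sum => q _; apply: le_trans (n1M _ _) _.
  by rewrite ler_wpM2l ?n1_ge0 // mxcoef_le.
under eq_bigr do rewrite -mulr_suml; rewrite -mulr_suml ler_wpM2r ?coef_norm_ge0 //.
apply: le_trans (ler_term i _); first by [].
by move=> i'; do 2![apply: sumr_ge0 => ? _]; exact: n1_ge0.
Qed.

(** Written as a composite of ring morphisms, so that the composite itself can serve as [bscale]. *)
Definition mxscale (r : R) : 'M[T]_N :=
  (scalar_mx \o (qpolyC 'X^n \o real_complex R) : {rmorphism R -> 'M[T]_N}) r.

Lemma mxcoef_scale r a i j p : mxcoef (mxscale r * a) i j p = r%:C * mxcoef a i j p.
Proof. by rewrite /mxcoef /mxscale /= -mulmxE mul_scalar_mx mxE tcoefZ. Qed.

Lemma mxcoefD a b i j p : mxcoef (a + b) i j p = mxcoef a i j p + mxcoef b i j p.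
Proof. by rewrite /mxcoef mxE tcoefD. Qed.

Lemma mxcoefN a i j p : mxcoef (- a) i j p = - mxcoef a i j p.
Proof. by rewrite /mxcoef mxE tcoefN. Qed.

Lemma mxcoef_sum (I : Type) (r : seq I) (P : pred I) (F : I -> 'M[T]_N) i j p :
  mxcoef (\sum_(l <- r | P l) F l) i j p = \sum_(l <- r | P l) mxcoef (F l) i j p.
Proof. by rewrite /mxcoef summxE tcoef_sum. Qed.

Lemma mxcoef_inj a b :
  (forall i j p, (p <= n.-1)%N -> mxcoef a i j p = mxcoef b i j p) -> a = b.
Proof. by move=> H; apply/matrixP => i j; apply: tcoef_inj => p /H; apply. Qed.

Let D0 : 0 < (N * N * n.-1.+1).+1%:R :> R.
Proof. by rewrite ltr0n. Qed.

Let mxnorm_ge0 a : 0 <= mxnorm a.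
Proof. by rewrite mulr_ge0 ?coef_norm_ge0. Qed.

Let mxnorm_eq0 a : mxnorm a = 0 -> a = 0.
Proof.
move/eqP; rewrite mulf_eq0 gt_eqF //= => /eqP a0.
apply: mxcoef_inj => i j p _; apply/eqP; rewrite [X in _ == X]/mxcoef mxE tcoef_zero -n1_eq0.
by rewrite eq_le n1_ge0 andbT -a0 mxcoef_le.
Qed.

Let mxnormD a b : mxnorm (a + b) <= mxnorm a + mxnorm b.
Proof.
rewrite /mxnorm -mulrDr ler_pM2l // /coef_norm -big_split; apply: ler_sum => i _.
rewrite -big_split; apply: ler_sum => j _; rewrite -big_split; apply: ler_sum => p _.
by rewrite mxcoefD n1D.
Qed.

Let mxnormN a : mxnorm (- a) = mxnorm a.
Proof.
congr (_ * _); do 3![apply: eq_bigr => ? _].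
by rewrite mxcoefN n1N.
Qed.

Let mxnormM a b : mxnorm (a * b) <= mxnorm a * mxnorm b.
Proof.
rewrite /mxnorm -mulrA ler_pM2l //.
apply: le_trans (coef_norm_le (fun i j p _ => mxcoefM_le a b i j p)) _.
rewrite mulrCA; apply: ler_wpM2l; first exact: coef_norm_ge0.
by apply: ler_wpM2r; rewrite ?coef_norm_ge0 // ler_nat.
Qed.

Let mxnormZ r a : mxnorm (mxscale r * a) = `|r| * mxnorm a.
Proof.
rewrite /mxnorm mulrCA; congr (_ * _); rewrite /coef_norm.
do 3![rewrite mulr_sumr; apply: eq_bigr => ? _].
by rewrite mxcoef_scale n1_realM.
Qed.

Lemma mxcoef_le_mxnorm a i j p : n1 (mxcoef a i j p) <= mxnorm a.
Proof.
apply: le_trans (mxcoef_le _ _ _ _) _; rewrite ler_peMl ?coef_norm_ge0 //.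
by rewrite ler1n.
Qed.

Lemma mxnorm_cvg0 (u : nat -> 'M[T]_N) :
  (forall i j p, (p <= n.-1)%N -> (fun m => n1 (mxcoef (u m) i j p)) @ \oo --> (0 : R)) ->
  (fun m => mxnorm (u m)) @ \oo --> (0 : R).
Proof.
move=> H; apply: cvg_eq_lim (cvgM (cvg_cst _) (_ : _ --> 0)) (mulr0 _).
apply: (@cvg_sum0 R _ (fun i m => \sum_j \sum_(p < n.-1.+1) n1 (mxcoef (u m) i j p))) => i.
apply: (@cvg_sum0 R _ (fun j m => \sum_(p < n.-1.+1) n1 (mxcoef (u m) i j p))) => j.
apply: (@cvg_sum0 R _ (fun (p : 'I_n.-1.+1) m => n1 (mxcoef (u m) i j p))) => p.
by apply: H; rewrite -ltnS.
Qed.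

Let real_series (v : nat -> R) K x : 0 <= x -> (forall l, `|v l| <= K * x ^+ l) ->
  cvgn (fun m => \sum_(l < m) l`!%:R^-1 * v l).
Proof.
move=> x0 H; have -> : (fun m => \sum_(l < m) l`!%:R^-1 * v l) =
    series (fun l => l`!%:R^-1 * v l).
  by apply/funext => m; rewrite /series /= big_mkord.
apply: (@normed_cvg R R^o); apply: (@series_le_cvg _ _ (fun l => K * exp_coeff x l)).
- by move=> l; exact: normr_ge0.
- move=> l; apply: mulr_ge0.
    by apply: le_trans (normr_ge0 (v 0%N)) _; have := H 0%N; rewrite expr0 mulr1.
  by rewrite /exp_coeff /= divr_ge0 // exprn_ge0.
- move=> l; rewrite /= normrM ger0_norm ?invr_ge0 // /exp_coeff /= mulrC mulrA.
  by rewrite ler_wpM2r ?invr_ge0.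
have -> : (fun l => K * exp_coeff x l) = K *: (exp_coeff x : R^o ^nat) by [].
by apply: is_cvg_seriesZ; exact: is_cvg_series_exp_coeff.
Qed.

Let mxnorm_complete (a : nat -> 'M[T]_N) (K x : R) : 0 <= x ->
  (forall l, mxnorm (a l) <= K * x ^+ l) ->
  exists s, (fun m => mxnorm (\sum_(l < m) mxscale l`!%:R^-1 * a l - s)) @ \oo --> (0 : R).
Proof.
move=> x0 H.
pose re i j p l := complex.Re (mxcoef (a l) i j p).
pose im i j p l := complex.Im (mxcoef (a l) i j p).
have cre i j p : cvgn (fun m => \sum_(l < m) l`!%:R^-1 * re i j p l).
  apply: (real_series x0) => l; apply: le_trans (n1_Re _) _.
  exact: le_trans (mxcoef_le_mxnorm _ _ _ _) (H l).
have cim i j p : cvgn (fun m => \sum_(l < m) l`!%:R^-1 * im i j p l).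
  apply: (real_series x0) => l; apply: le_trans (n1_Im _) _.
  exact: le_trans (mxcoef_le_mxnorm _ _ _ _) (H l).
pose L (f : nat -> R) := limn (fun m => \sum_(l < m) l`!%:R^-1 * f l).
(* The cut is at [n.-1.+1] and not at [n] as in [to_trunc], which would lose the constant
   coefficient when [n = 0]. *)
pose s : 'M[T]_N := \matrix_(i, j) in_qpoly 'X^n
  (\poly_(p < n.-1.+1) (L (re i j p) +i* L (im i j p))).
have sE i j p : (p <= n.-1)%N -> mxcoef s i j p = L (re i j p) +i* L (im i j p).
  move=> pn; have E : size (mk_monic ('X^n : {poly C})) = n.-1.+2.
    by rewrite mk_monic_Xn size_polyXn.
  rewrite /mxcoef mxE /tcoef in_qpoly_small ?coef_poly ?ltnS ?pn // E.
  exact: leq_ltn_trans (size_poly _ _) _.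
exists s; apply: mxnorm_cvg0 => i j p pn.
have -> : (fun m => n1 (mxcoef (\sum_(l < m) mxscale l`!%:R^-1 * a l - s) i j p)) =
  fun m => `|\sum_(l < m) l`!%:R^-1 * re i j p l - L (re i j p)| +
           `|\sum_(l < m) l`!%:R^-1 * im i j p l - L (im i j p)|.
  apply/funext => m; rewrite mxcoefD mxcoefN sE // mxcoef_sum.
  have -> : \sum_(l < m) mxcoef (mxscale l`!%:R^-1 * a l) i j p =
     (\sum_(l < m) l`!%:R^-1 * re i j p l) +i* (\sum_(l < m) l`!%:R^-1 * im i j p l).
    elim: m => [|m IH]; first by rewrite !big_ord0.
    rewrite !big_ord_recr /= IH mxcoef_scale /re /im.
    case: (mxcoef (a m) i j p) => y z; apply: complex_eq => /=.
      by rewrite mul0r subr0.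
    by rewrite mul0r addr0.
  by [].
have D (f : nat -> R) : cvgn (fun m => \sum_(l < m) l`!%:R^-1 * f l) ->
    (fun m => `|\sum_(l < m) l`!%:R^-1 * f l - L f|) @ \oo --> (0 : R).
  move=> cf; apply: cvg_eq_lim (cvg_norm (cvgB cf (cvg_cst (L f)))) _.
  by rewrite /L subrr normr0.
exact: cvg_eq_lim (cvgD (D _ (cre i j p)) (D _ (cim i j p))) (addr0 _).
Qed.

Let mxscaleC r a : mxscale r * a = a * mxscale r.
Proof. by rewrite /mxscale /= -!mulmxE scalar_mxC. Qed.

Definition trunc_banach : banach_norm R 'M[T]_N :=
  @BanachNorm R 'M[T]_N mxnorm _ mxscaleC mxnorm_ge0 mxnorm_eq0 mxnormD mxnormN
    mxnormM mxnormZ mxnorm_complete.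

End TruncMatrixNorm.

(** * Velocities and real directional derivatives *)

Section Velocity.
Context {R : realType} {n N : nat}.
Local Notation C := R[i].
Local Notation T := (trunc R n).
Local Notation B := (@trunc_banach R n N).

Lemma converges_mxcoef (u : nat -> 'M[T]_N) s i j p : converges B u s ->
  (fun m => n1 (mxcoef (u m) i j p - mxcoef s i j p)) @ \oo --> (0 : R).
Proof.
move=> us; apply: (@squeeze_cvgr _ _ _ _ (fun=> 0) (fun m => B (u m - s))) => //; last exact: cvg_cst.
by near=> m; rewrite n1_ge0 -mxcoefN -mxcoefD mxcoef_le_mxnorm.
Unshelve. all: by end_near. Qed.

Lemma converges_complex (u : nat -> C) (l : C) :
  (fun m => n1 (u m - l)) @ \oo --> (0 : R) -> (u : nat -> C^o) @ \oo --> (l : C^o).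
Proof.
move=> H; apply/cvgrPdist_lt => _ /gt0_complex[e e0 ->].
move/cvgrPdist_lt: H => /(_ e e0); apply: filterS => m.
rewrite sub0r normrN ger0_norm ?n1_ge0 // => h.
by rewrite distrC; apply: le_lt_trans (normC_le_n1 _) _; rewrite ltcR.
Qed.

Definition has_real_velocity (g : R -> R) (l : R) :=
  forall e : R, 0 < e -> \forall t \near (0 : R), `|g t - g 0 - t * l| <= e * `|t|.

Lemma real_velocityP {V : normedModType R} (f : V -> R) v w l :
  is_derive v w f l <-> has_real_velocity (fun t => f (t *: w + v)) l.
Proof.
split=> [[df El] e e0|H].
  have : (fun t : R => t^-1 *: ((f \o shift v) (t *: w) - f v)) @ 0^' --> l.
    by rewrite -El; exact: df.
  move=> /cvgrPdist_lt/(_ e e0); rewrite near_withinE; apply: filterS => t Ht.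
  have [->|t0] := eqVneq t 0; first by rewrite subrr mul0r subrr normr0 mulr0.
  have := Ht t0; rewrite scale0r add0r /= => ht.
  have -> : f (t *: w + v) - f v - t * l =
      - (t * (l - t^-1 * (f (t *: w + v) - f v))).
    by move: (f _) (f _) => y1 y2; field.
  by rewrite normrN normrM mulrC ler_wpM2r // ltW.
have c : (fun t : R => t^-1 *: ((f \o shift v) (t *: w) - f v)) @ 0^' --> l.
  apply/cvgrPdist_le => e e0; rewrite near_withinE.
  apply: filterS (H e e0) => t; rewrite scale0r add0r /= => ht t0.
  have -> : l - t^-1 * (f (t *: w + v) - f v) =
      - (t^-1 * (f (t *: w + v) - f v - t * l)).
    by move: (f _) (f _) => y1 y2; field.
  by rewrite normrN normrM normfV mulrC ler_pdivrMr // normr_gt0.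
by apply: DeriveDef; [apply/cvg_ex; exists l|exact: cvg_lim].
Qed.

Lemma velocity_mxcoef (y : R -> 'M[T]_N) d i j p : has_velocity B y d ->
  has_real_velocity (fun t => complex.Re (mxcoef (y t) i j p)) (complex.Re (mxcoef d i j p)) /\
  has_real_velocity (fun t => complex.Im (mxcoef (y t) i j p)) (complex.Im (mxcoef d i j p)).
Proof.
have E (t : R) : mxcoef (y t - y 0 - bscale B t * d) i j p =
    mxcoef (y t) i j p - mxcoef (y 0) i j p - t%:C * mxcoef d i j p.
  by rewrite !mxcoefD !mxcoefN mxcoef_scale.
move=> vy; split=> e e0; apply: filterS (vy e e0) => t; apply: le_trans;
  apply: le_trans (mxcoef_le_mxnorm _ i j p); rewrite E.
- apply: le_trans (n1_Re _); move: (mxcoef _ i j p) (mxcoef _ i j p) (mxcoef _ i j p).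
  by move=> [a1 a2] [b1 b2] [c1 c2] /=; rewrite mul0r subr0.
- apply: le_trans (n1_Im _); move: (mxcoef _ i j p) (mxcoef _ i j p) (mxcoef _ i j p).
  by move=> [a1 a2] [b1 b2] [c1 c2] /=; rewrite mul0r addr0.
Qed.

Lemma velocity_of_mxcoef (y : R -> 'M[T]_N) d :
  (forall i j p, (p <= n.-1)%N ->
    has_real_velocity (fun t => complex.Re (mxcoef (y t) i j p)) (complex.Re (mxcoef d i j p)) /\
    has_real_velocity (fun t => complex.Im (mxcoef (y t) i j p)) (complex.Im (mxcoef d i j p))) ->
  has_velocity B y d.
Proof.
move=> H e e0; pose D : R := (N * N * n.-1.+1).+1%:R.
have D0 : 0 < D by rewrite ltr0n.
(* One factor [D] is the normalisation in [mxnorm], the other bounds the number of coefficients, and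
   the [2] accounts for real and imaginary parts. *)
have e'0 : 0 < e / (D * D) / 2 by rewrite !divr_gt0 // mulr_gt0.
have K (i j : 'I_N) (p : 'I_n.-1.+1) : \forall t \near (0 : R),
    n1 (mxcoef (y t - y 0 - bscale B t * d) i j p) <= e / (D * D) * `|t|.
  have [|h1 h2] := H i j p _; first by rewrite -ltnS.
  apply: filterS2 (h1 _ e'0) (h2 _ e'0) => t k1 k2.
  rewrite !mxcoefD !mxcoefN mxcoef_scale; move: k1 k2.
  move: (mxcoef _ i j p) (mxcoef _ i j p) (mxcoef _ i j p).
  move=> [a1 a2] [b1 b2] [c1 c2] /= k1 k2.
  rewrite /n1 /= !mul0r subr0 addr0 [e / _]splitr mulrDl; exact: lerD.
have {K} : \forall t \near (0 : R), forall i j (p : 'I_n.-1.+1),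
    n1 (mxcoef (y t - y 0 - bscale B t * d) i j p) <= e / (D * D) * `|t|.
  pose Q i j p (t : R) := n1 (mxcoef (y t - y 0 - bscale B t * d) i j p) <= e / (D * D) * `|t|.
  apply: (@filter_forall R 'I_N (fun i t => forall j (p : 'I_n.-1.+1), Q i j p t) (nbhs (0 : R)) _) => i.
  apply: (@filter_forall R 'I_N (fun j t => forall p : 'I_n.-1.+1, Q i j p t) (nbhs (0 : R)) _) => j.
  apply: (@filter_forall R 'I_n.-1.+1 (fun p t => Q i j p t) (nbhs (0 : R)) _) => p; exact: K.
apply: filterS => t Ht.
apply: (@le_trans _ _ (D * (D * (e / (D * D) * `|t|)))).
  rewrite ler_pM2l //; apply: le_trans (coef_norm_le (e := e / (D * D) * `|t|) _) _.
    by move=> i j p pn; exact: (Ht i j (Ordinal (pn : (p < n.-1.+1)%N))).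
  by rewrite ler_wpM2r ?ler_nat // mulr_ge0 // divr_ge0 ?ltW // mulr_gt0.
have cancel2 (x z : R) : x != 0 -> x * (x * (e / (x * x) * z)) = e * z by move=> x0; field.
by rewrite cancel2 // gt_eqF.
Qed.

End Velocity.

(** * The subgroup generated by a subalgebra of the defect algebra *)

Section ClosedSubspace.
Context {R : realType} {d : nat} (S : set 'rV[R[i]]_d).
Hypothesis S0 : S 0.
Hypothesis S_linear : forall l u v, S u -> S v -> S (l *: u + v).

Lemma subspace_row m (M : 'M[R[i]]_(m, d)) v :
  (forall i, S (row i M)) -> (v <= M)%MS -> S v.
Proof.
move=> SM /submxP[D ->]; rewrite mulmx_sum_row.
by elim/big_ind: _ => // [x y Sx Sy|i _]; [rewrite -[x]scale1r; exact: S_linear|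
  rewrite -[_ *: _]addr0; exact: S_linear].
Qed.

(** Among the matrices with rows in [S] one of maximal rank is chosen. A vector of [S] outside its
    row space could be adjoined and would increase the rank. *)
Lemma subspace_matrix : exists M : 'M[R[i]]_d, forall v, S v <-> (v <= M)%MS.
Proof.
pose P r := `[< exists M : 'M[R[i]]_d, (forall i, S (row i M)) /\ \rank M = r >].
have exP : exists r, P r.
  by exists 0%N; apply/asboolP; exists 0; split; [move=> i; rewrite row0|rewrite mxrank0].
have leP r : P r -> (r <= d)%N by move/asboolP => [M [_ <-]]; exact: rank_leq_row.
have [r /asboolP[M [SM rM]] maxM] := ex_maxnP exP leP.
exists M => v; split=> [Sv|]; last exact: subspace_row.
apply/negPn/negP => vM.
have : P (\rank (M + v)%MS).
  apply/asboolP; exists (M + v)%MS; split=> // i.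
  apply: (@subspace_row _ (col_mx M v)).
    by move=> j; rewrite -[j]fintype.splitK; case: (fintype.split j) => j' /=;
      rewrite ?rowKu ?rowKd ?row_id //; exact: SM.
  by rewrite -addsmxE row_sub.
move=> /maxM; rewrite -rM leqNgt => /negP; apply;
by apply: rank_ltmx; rewrite ltmxE addsmxSl addsmx_sub submx_refl.
Qed.

(** Membership in the row space of [M] is the vanishing of the product with [cokermx M], a finite
    system of linear equations that passes to coefficientwise limits. *)
Lemma subspace_closed (u : nat -> 'rV[R[i]]_d) (a : 'rV[R[i]]_d) : (forall m, S (u m)) ->
  (forall j, (fun m => n1 (u m 0 j - a 0 j)) @ \oo --> (0 : R)) -> S a.
Proof.
have [M SM] := subspace_matrix; move=> Su ua; apply/SM; rewrite submxE.
apply/eqP/rowP => i; rewrite [RHS]mxE; apply/eqP; rewrite -n1_eq0.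
have H : (fun m => \sum_j n1 (u m 0 j - a 0 j) * n1 (cokermx M j i)) @ \oo --> (0 : R).
  apply: (@cvg_sum0 _ _ (fun j m => n1 (u m 0 j - a 0 j) * n1 (cokermx M j i))) => j.
  exact: cvg_eq_lim (cvgM (ua j) (cvg_cst _)) (mul0r _).
rewrite eq_le n1_ge0 andbT -(cvg_lim _ H) //.
apply: limr_ge; first by apply/cvg_ex; eexists; exact: H.
near=> m; have /SM := Su m; rewrite submxE => /eqP/rowP/(_ i); rewrite [in RHS]mxE => um.
rewrite -n1N -[X in n1 X]add0r -um !mxE -sumrB.
apply: le_trans (n1_sum _ _ _) (ler_sum _ _) => j _.
by rewrite -mulrBl n1M.
Unshelve. all: by end_near. Qed.

End ClosedSubspace.

(** * Stability of the subalgebra under gauge transformations *)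

Section DefectSubalgebra.
Context {R : realType} {N : nat} (G : matrix_lie_group R N) (W : one_form R).
Local Notation C := R[i].
Local Notation Sigma := ('rV[R]_2).
Local Notation jets := (defect_mx N W).
Context (k : set jets) (hk : lie_subalgebra G k).
Local Notation B x := (@trunc_banach R (mult W x) N).

Lemma mxscaleE (n : nat) r (a : 'M[trunc R n]_N) : mxscale r * a = r%:C%:A *: a.
Proof. by rewrite /mxscale /= -mulmxE mul_scalar_mx qpolyC_alg. Qed.

Lemma k0 : k (fun=> 0). Proof. by case: hk. Qed.

Lemma kZD r a b : k a -> k b -> k (fun x => mxscale r * a x + b x).
Proof.
case: hk => _ _ kl _ ka kb.
have -> : (fun x => mxscale r * a x + b x) = fun x => r%:C%:A *: a x + b x.
  by apply: functional_extensionality_dep => x; rewrite mxscaleE.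
exact: kl.
Qed.

Lemma kD a b : k a -> k b -> k (fun x => a x + b x).
Proof.
move=> ka kb; have := kZD 1 ka kb; congr (k _).
by apply: functional_extensionality_dep => x; rewrite /mxscale rmorph1 mul1r.
Qed.

Lemma kZ r a : k a -> k (fun x => mxscale r * a x).
Proof.
move=> ka; have := kZD r ka k0; congr (k _).
by apply: functional_extensionality_dep => x; rewrite addr0.
Qed.

Lemma kN a : k a -> k (fun x => - a x).
Proof.
move=> ka; have := kZ (-1) ka; congr (k _).
by apply: functional_extensionality_dep => x; rewrite /mxscale rmorphN1 mulN1r.
Qed.

Lemma kB a b : k a -> k b -> k (fun x => a x - b x).
Proof. by move=> ka kb; exact: kD ka (kN kb). Qed.

Lemma k_egf (a : nat -> jets) m : (forall l, k (a l)) ->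
  k (fun x => egf (B x) (fun l => a l x) m).
Proof.
move=> ka; elim: m => [|m IH].
  by have := k0; congr (k _); apply: functional_extensionality_dep => x; rewrite /egf big_ord0.
have := kD IH (kZ m`!%:R^-1 (ka m)); congr (k _).
by apply: functional_extensionality_dep => x; rewrite /egf big_ord_recr.
Qed.

Lemma k_ad X H n : k X -> k H -> k (fun x => ad_iter (X x) (H x) n).
Proof.
move=> kX kH; elim: n => [|n IH] //.
by case: hk => _ _ _ /(_ _ _ kX IH).
Qed.

(** The sizes of the jets depend on the pole, so the coefficients of an element of [defect_mx] are
    indexed by a dependent sum. Through [defect_vec], [k] becomes a subspace of row vectors. *)
Definition coordinate := {x : 'I_(npole W) & ('I_N * 'I_N * 'I_(mult W x).-1.+1)%type}.

Definition coordinate_coef (a : jets) (c : coordinate) : C :=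
  mxcoef (a (tag c)) (tagged c).1.1 (tagged c).1.2 (nat_of_ord (tagged c).2).

Definition defect_vec (a : jets) : 'rV[C]_#|{: coordinate}| :=
  \row_q coordinate_coef a (enum_val q).

Lemma defect_vec_inj : injective defect_vec.
Proof.
move=> a b ab; apply: functional_extensionality_dep => x.
apply: mxcoef_inj => i j p pn.
pose c : coordinate := Tagged (fun x => ('I_N * 'I_N * 'I_(mult W x).-1.+1)%type)
  (i, j, Ordinal (pn : (p < (mult W x).-1.+1)%N)).
by have /rowP/(_ (enum_rank c)) := ab; rewrite !mxE enum_rankK.
Qed.

Lemma k_closed (u : nat -> jets) a : (forall m, k (u m)) ->
  (forall x, converges (B x) (fun m => u m x) (a x)) -> k a.
Proof.
move=> ku ua; suff [b kb /defect_vec_inj <-//] : (defect_vec @` k) (defect_vec a).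
apply: (@subspace_closed _ _ _ _ _ (fun m => defect_vec (u m))).
- exists (fun=> 0); first exact: k0.
  by apply/rowP => q; rewrite !mxE /coordinate_coef /mxcoef mxE tcoef_zero.
- move=> l _ _ [b kb <-] [c kc <-]; case: hk => _ _ /(_ l _ _ kb kc) kl _.
  exists (fun x => l%:A *: b x + c x) => //; apply/rowP => q.
  by rewrite !mxE /coordinate_coef mxcoefD /mxcoef mxE -qpolyC_alg tcoefZ.
- by move=> m; exists (u m).
move=> q; rewrite /defect_vec; under eq_fun do rewrite !mxE.
exact: converges_mxcoef (ua _).
Qed.

(** [expJ] consists of coefficientwise limits. A limit in norm is first obtained from completeness
    and then recognised one coefficient at a time. *)
Lemma expJ_converges (a : jets) x :
  converges (B x) (egf (B x) (fun l => a x ^+ l)) (expJ a x).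
Proof.
have [s cs] := egf_exists (bn_ge0 (B x) (a x)) (egf_bound_pow (B x) (a x)).
suff -> : expJ a x = s by [].
apply/mxcoef_inj => i j p pn; rewrite /mxcoef mxE tcoef_to_trunc.
have -> : (p < mult W x)%N by rewrite -(prednK (mult_gt0 x)) ltnS.
apply: (@cvg_lim C^o); first exact: norm_hausdorff.
apply: converges_complex; have := converges_mxcoef i j p cs.
set F := (fun m : nat => n1 _); set F' := (fun m : nat => n1 _).
suff -> : F = F' by []; apply/funext => m; rewrite /F /F'; congr (n1 (_ - _)).
rewrite mxcoef_sum; apply: eq_bigr => l _; rewrite mxcoef_scale mulrC.
by rewrite fmorphV rmorph_nat.
Qed.

Definition negJ (a : jets) : jets := fun x => - a x.

Lemma negJK a : negJ (negJ a) = a.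
Proof. by apply: functional_extensionality_dep => x; rewrite /negJ opprK. Qed.

Lemma expJN_converges (a : jets) x :
  converges (B x) (egf (B x) (fun l => (- a x) ^+ l)) (expJ (negJ a) x).
Proof. exact: expJ_converges. Qed.

Lemma expJ_mulN a x : expJ a x * expJ (negJ a) x = 1.
Proof. exact: exp_mulN (expJ_converges a x) (expJN_converges a x). Qed.

Lemma k_conj_exp X a : k X -> k a -> k (fun x => expJ X x * a x * expJ (negJ X) x).
Proof.
move=> kX ka; apply: (@k_closed (fun m x => egf (B x) (ad_iter (X x) (a x)) m)).
  by move=> m; apply: (@k_egf (fun l x => ad_iter (X x) (a x) l)) => l; exact: k_ad.
by move=> x; exact: exp_conjugate (expJ_converges X x) (expJN_converges X x).
Qed.

Lemma k_dexp X H (D : jets) : k X -> k H ->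
  (forall x, converges (B x) (egf (B x) (dpow (X x) (H x))) (D x)) ->
  k (fun x => D x * expJ (negJ X) x).
Proof.
move=> kX kH cD.
apply: (@k_closed (fun m x =>
  egf (B x) (fun n => if n is n'.+1 then ad_iter (X x) (H x) n' else 0) m)).
  move=> m; apply: (@k_egf (fun l x => if l is n'.+1 then ad_iter (X x) (H x) n' else 0)) => -[|l].
    exact: k0.
  exact: k_ad.
by move=> x; exact: dexp_log (cD x) (expJN_converges X x).
Qed.

Definition velocityJ (e s : Sigma) (w : Sigma -> jets) (D : jets) :=
  forall x, has_velocity (B x) (fun t => w (t *: e + s) x) (D x).

Lemma mxcoef_partialJ i (f : Sigma -> jets) s x a b p : (p < mult W x)%N ->
  mxcoef (partialJ i f s x) a b p = Ddir (axis i) (fun u => mxcoef (f u x) a b p) s.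
Proof. by move=> pn; rewrite /mxcoef mxE tcoef_to_trunc pn. Qed.

Lemma pred_mult x p : (p <= (mult W x).-1)%N = (p < mult W x)%N.
Proof. by rewrite -{2}(prednK (mult_gt0 x)) ltnS. Qed.

Lemma smoothJ_velocity (f : Sigma -> jets) i s : smoothJ f ->
  velocityJ (axis i) s f (partialJ i f s).
Proof.
move=> sf x; apply: velocity_of_mxcoef => a b p; rewrite pred_mult => pn.
rewrite mxcoef_partialJ //; have [f1 f2] := sf x a b p 1%N; split.
- apply/(real_velocityP (fun u => complex.Re (mxcoef (f u x) a b p))).
  exact: derivableP (Ck_derivable f1).
- apply/(real_velocityP (fun u => complex.Im (mxcoef (f u x) a b p))).
  exact: derivableP (Ck_derivable f2).
Qed.

Lemma velocity_partialJ (f : Sigma -> jets) i s D :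
  velocityJ (axis i) s f D -> partialJ i f s = D.
Proof.
move=> vf; apply: functional_extensionality_dep => x; apply: mxcoef_inj => a b p.
rewrite pred_mult => pn; rewrite mxcoef_partialJ //.
have [h1 h2] := velocity_mxcoef a b p (vf x).
apply: complex_eq.
- exact: (@derive_val _ _ _ _ _ _ _
    ((real_velocityP (fun u => complex.Re (mxcoef (f u x) a b p)) s (axis i) _).2 h1)).
- exact: (@derive_val _ _ _ _ _ _ _
    ((real_velocityP (fun u => complex.Im (mxcoef (f u x) a b p)) s (axis i) _).2 h2)).
Qed.

(** The difference quotients with steps [m.+1%:R^-1] lie in [k] and converge to [D], so [k_closed]
    applies. This places the derivatives of a [k]-valued map in [k]. *)
Lemma k_velocity e s (X : Sigma -> jets) D : (forall u, k (X u)) ->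
  velocityJ e s X D -> k D.
Proof.
move=> kX vX.
pose u (m : nat) : jets := fun x =>
  mxscale m.+1%:R * (X (m.+1%:R^-1 *: e + s) x - X s x).
apply: (@k_closed u) => [m|x]; first exact: kZ (kB (kX _) (kX _)).
pose z (m : nat) := X (m.+1%:R^-1 *: e + s) x - X s x - mxscale m.+1%:R^-1 * D x.
have uE m : u m x - D x = mxscale m.+1%:R * z m.
  rewrite /u /z [RHS]mulrBr; congr (_ - _).
  rewrite mulrA /mxscale -rmorphM mulfV ?pnatr_eq0 // rmorph1; exact/esym/mul1r.
have zE m : B x (u m x - D x) = `|(m.+1%:R : R)| * B x (z m).
  by rewrite uE; exact: (bnZ (B x) m.+1%:R (z m)).
apply/cvgrPdist_le => eps eps0.
pose Q (t : R) := B x (X (t *: e + s) x - X (0 *: e + s) x - bscale (B x) t * D x) <= eps * `|t|.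
have HQ : \forall m \near \oo, Q (harmonic m).
  exact: (@cvg_harmonic R _ (vX x eps eps0)).
apply: filterS HQ => m; rewrite /Q scale0r add0r => Hm.
have {}Hm : B x (z m) <= eps * `|(m.+1%:R : R)^-1| := Hm.
rewrite sub0r normrN (ger0_norm (bn_ge0 _ _)) zE.
by rewrite -ler_pdivlMl ?normr_gt0 ?pnatr_eq0 // -normfV mulrC.
Qed.

(* [v] is the inverse of [w]: recording both makes the class of such pairs stable
   under inversion without differentiating the inverse. *)
Record k_adapted (w v : Sigma -> jets) : Prop := KAdapted {
  adapted_mulV : forall s x, w s x * v s x = 1;
  adapted_conj : forall s a, k a -> k (fun x => w s x * a x * v s x);
  adapted_log : forall i s, exists2 D, velocityJ (axis i) s w D
    & k (fun x => D x * v s x) }.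

Lemma k_adapted1 : k_adapted (fun=> @oneJ R N W) (fun=> @oneJ R N W).
Proof.
split.
- by move=> s x; exact: mulr1.
- move=> s a; congr (k _); apply: functional_extensionality_dep => x.
  by rewrite /oneJ [RHS]mulr1 [RHS]mul1r.
move=> i s; exists (fun=> 0); first by move=> x; exact: velocity_cst.
by have := k0; congr (k _); apply: functional_extensionality_dep => x; rewrite mul0r.
Qed.

Lemma k_adapted_exp X : smoothJ X -> (forall s, k (X s)) ->
  k_adapted (fun s => expJ (X s)) (fun s => expJ (negJ (X s))).
Proof.
move=> sX kX; split.
- by move=> s x; exact: expJ_mulN.
- by move=> s a; exact: k_conj_exp.
move=> i s; have vX := smoothJ_velocity i s sX; set H := partialJ i X s in vX.
have kH := k_velocity kX vX.
have exD x : exists d, converges (B x) (egf (B x) (dpow (X s x) (H x))) d.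
  apply: egf_exists (egf_bound_dpow _ _ _).
  by rewrite mulr_ge0 // addr_ge0 // bn_ge0.
exists (fun x => projT1 (cid (exD x))).
  move=> x; apply: velocity_exp (vX x) _ _ => [t|].
    exact: expJ_converges.
  by rewrite scale0r add0r; exact: projT2 (cid (exD x)).
by apply: k_dexp (kX s) kH _ => x; exact: projT2 (cid (exD x)).
Qed.

(** The logarithmic derivative of a product is that of [f] plus the conjugate by [f] of that of [g].
    This is the reason for keeping [adapted_conj] next to [adapted_log]. *)
Lemma k_adaptedM f f' g g' : k_adapted f f' -> k_adapted g g' ->
  k_adapted (fun s => mulJ (f s) (g s)) (fun s => mulJ (g' s) (f' s)).
Proof.
move=> [fV fk fl] [gV gk gl].
have M (a b : jets) x : mulJ a b x = a x * b x by [].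
split.
- by move=> s x; rewrite !M mulrA -(mulrA (f s x)) gV mulr1 fV.
- move=> s a ka; have := fk s _ (gk s _ ka); congr (k _); apply: functional_extensionality_dep => x.
  by rewrite !M !mulrA.
move=> i s; have [D vD kD'] := fl i s; have [E vE kE] := gl i s.
exists (fun x => D x * g s x + f s x * E x).
  move=> x; have := velocityM (vD x) (vE x).
  by rewrite scale0r add0r.
have := kD kD' (fk s _ kE); congr (k _); apply: functional_extensionality_dep => x.
by rewrite M mulrDl !mulrA -(mulrA (D x)) gV mulr1.
Qed.

Lemma exp_word_adapted w : exp_word k w -> exists v, k_adapted w v /\ k_adapted v w.
Proof.
elim=> {w} [X sX kX||f g _ [f' [ff' f'f]] _ [g' [gg' g'g]]|f _ [f' [ff' f'f]]].
- exists (fun s => expJ (negJ (X s))); split; first exact: (k_adapted_exp sX kX).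
  have sN : smoothJ (fun s => negJ (X s)).
    move=> x a b p; under eq_fun => s do rewrite mxE tcoefN -mulN1r.
    by apply: smoothM; [exact: smooth_cst|exact: sX].
  have E : (fun s => expJ (negJ (negJ (X s)))) = (fun s => expJ (X s)).
    by apply/funext => s; rewrite negJK.
  have kN' s : k (negJ (X s)) := kN (kX s).
  have H := k_adapted_exp sN kN'.
  exact: (eq_ind _ (k_adapted (fun s => expJ (negJ (X s)))) H _ E).
- by exists (fun=> @oneJ R N W); split; exact: k_adapted1.
- exists (fun s => mulJ (g' s) (f' s)).
  by split; exact: k_adaptedM.
(* For an inverse the two recorded maps merely change places, once [f'] is recognised as the matrix
   inverse. *)
- exists f; suff -> : (fun s => invJ (f s)) = f' by [].
  apply/funext => s; apply: functional_extensionality_dep => x.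
  have U : f s x \in unitmx by have [] := mulmx1_unit (adapted_mulV ff' s x).
  have E : f s x *m f' s x = 1%:M := adapted_mulV ff' s x.
  by rewrite /invJ -[RHS](mulKmx U) E mulmx1.
Qed.

(** The value at [s] depends only on the germ of [f] there, and the germ is that of a word in
    exponentials. The logarithmic derivative and the conjugate of [b] are then placed in [k]
    separately. *)
Lemma k_gauge (f : Sigma -> jets) b s i : smoothK k f -> (forall i s, k (b i s)) ->
  k (gaugeJ f b i s).
Proof.
move=> [_ fU _ fw] kb; have [w [Ww Ew]] := fw s.
have [v [wv _]] := exp_word_adapted Ww; have Es := nbhs_singleton Ew.
have [D vD kD'] := adapted_log wv i s.
have vf : velocityJ (axis i) s f D.
  move=> x; apply: near_eq_velocity (vD x).
  have c : (fun t : R => t *: axis i + s) @ (0 : R) --> s.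
    have E : (0 : R) *: axis i + s = s by rewrite scale0r add0r.
    by rewrite -[X in _ --> X]E; exact: line_continuous.
  have H : \forall t \near (0 : R), f (t *: axis i + s) = w (t *: axis i + s) := c _ Ew.
  by apply: filterS H => t ->.
have iE x : invmx (f s x) = v s x.
  have E : f s x *m v s x = 1%:M by rewrite Es; exact: (adapted_mulV wv s x).
  by rewrite -[RHS](mulKmx (fU s x)) E mulmx1.
have := kD (kN kD') (adapted_conj wv s (kb i s)); congr (k _).
apply: functional_extensionality_dep => x.
by rewrite /gaugeJ iE (velocity_partialJ vf) Es.
Qed.

End DefectSubalgebra.

(** * Admissible forms *)

Section SmoothMatrices.
Context {R : realType} {V : normedModType R} {N : nat}.
Local Notation C := R[i].
Implicit Types (f g : V -> 'M[C]_N) (w v : V).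

Lemma smooth_mxM f g : smooth_mx f -> smooth_mx g -> smooth_mx (fun v => f v *m g v).
Proof.
by move=> sf sg; apply: entrywiseM sf sg; [exact: smooth_cst|exact: smoothD|exact: smoothM].
Qed.

Lemma smooth_mx_cst (M : 'M[C]_N) : smooth_mx (fun _ : V => M).
Proof. by move=> i j; exact: smooth_cst. Qed.

Lemma smooth_mxN f : smooth_mx f -> smooth_mx (fun v => - f v).
Proof.
move=> sf i j; under eq_fun do rewrite mxE -mulN1r.
by apply: smoothM; [exact: smooth_cst|exact: sf].
Qed.

Lemma smooth_mxV f : (forall v, f v \in unitmx) -> smooth_mx f ->
  smooth_mx (fun v => invmx (f v)).
Proof.
move=> fU sf; apply: entrywiseV fU sf; [exact: smooth_cst|exact: smoothD|exact: smoothM|].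
by move=> h hU; apply: smoothV => v; rewrite -unitfE.
Qed.

Lemma smooth_mx_Dmx f w : smooth_mx f -> smooth_mx (Dmx (Ddir w) f).
Proof.
move=> sf i j; under eq_fun do rewrite mxE.
exact: (smooth_on_Ddir w (sf i j)).
Qed.

Lemma Dmx_mul f g w v : smooth_mx f -> smooth_mx g ->
  Dmx (Ddir w) (fun u => f u *m g u) v = Dmx (Ddir w) f v *m g v + f v *m Dmx (Ddir w) g v.
Proof.
move=> sf sg; apply: (@DmxM _ _ smooth) sf sg.
- exact: smooth_cst.
- by move=> ? ?; exact: smoothD.
- by move=> ? ?; exact: smoothM.
- by move=> c u; exact: DdirC.
- by move=> ? ? u; exact: DdirD.
- by move=> ? ? u; exact: DdirM.
Qed.

Lemma Dmx_add f g w v : smooth_mx f -> smooth_mx g ->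
  Dmx (Ddir w) (fun u => f u + g u) v = Dmx (Ddir w) f v + Dmx (Ddir w) g v.
Proof.
move=> sf sg; apply/matrixP => i j; rewrite !mxE.
under [X in Ddir w X]eq_fun do rewrite mxE.
exact: DdirD.
Qed.

Lemma Dmx_opp f w v : smooth_mx f ->
  Dmx (Ddir w) (fun u => - f u) v = - Dmx (Ddir w) f v.
Proof.
move=> sf; apply/matrixP => i j; rewrite !mxE.
under [X in Ddir w X]eq_fun do rewrite mxE -mulN1r.
by rewrite DdirM ?DdirC ?mul0r ?add0r ?mulN1r //; exact: smooth_cst.
Qed.

Lemma Dmx_const (M : 'M[C]_N) w v : Dmx (Ddir w) (fun _ : V => M) v = 0.
Proof. by apply: Dmx_cst => c u; exact: DdirC. Qed.

(** Obtained by differentiating the identity that the inverse times [f] is constant. *)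
Lemma Dmx_inv f w v : (forall v, f v \in unitmx) -> smooth_mx f ->
  Dmx (Ddir w) (fun u => invmx (f u)) v = - (invmx (f v) *m Dmx (Ddir w) f v *m invmx (f v)).
Proof.
move=> fU sf; have := Dmx_mul w v (smooth_mxV fU sf) sf.
under [X in Dmx _ X v]eq_fun do rewrite mulVmx ?fU //.
rewrite Dmx_const => /eqP; rewrite eq_sym addr_eq0 => /eqP /(congr1 (mulmx^~ (invmx (f v)))).
by rewrite mulmxK // mulNmx.
Qed.

Lemma Dmx_swap f w w' v : smooth_mx f ->
  Dmx (Ddir w) (Dmx (Ddir w') f) v = Dmx (Ddir w') (Dmx (Ddir w) f) v.
Proof.
move=> sf; apply/matrixP => i j.
have E u w1 w2 : Dmx (Ddir w1) (Dmx (Ddir w2) f) u i j = Ddir w1 (Ddir w2 (fun x => f x i j)) u.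
  rewrite mxE; congr (Ddir w1 _ u); by apply/funext => x; rewrite mxE.
transitivity (Ddir w (Ddir w' (fun x => f x i j)) v); first exact: E.
apply: etrans (esym (E v w' w)); exact: (Ddir_swap openT w' w (sf i j) I).
Qed.

End SmoothMatrices.

(** * Tangent vectors of the matrix group *)

Section LieAlgebra.
Context {R : realType} {N : nat} (G : matrix_lie_group R N).
Local Notation C := R[i].
Local Notation Sigma := ('rV[R]_2).
Implicit Types (X Y g : 'M[C]_N).

(** The sum is the velocity of the product of two curves through the identity; the opposite and the
    conjugate come likewise from the inverse and the conjugate of a curve. *)
Lemma lie_algebraD X Y : lie_algebra G X -> lie_algebra G Y -> lie_algebra G (X + Y).
Proof.
move=> [c [[sc Gc] c0 dc]] [d [[sd Gd] d0 dd]]; exists (fun t => c t *m d t); split.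
- by split=> [|t]; [exact: smooth_mxM|exact: mlgM].
- by rewrite c0 d0 mulmx1.
- by rewrite Dmx_mul // dc dd c0 d0 mulmx1 mul1mx.
Qed.

Lemma lie_algebraN X : lie_algebra G X -> lie_algebra G (- X).
Proof.
move=> [c [[sc Gc] c0 dc]]; have cU t : c t \in unitmx := mlg_unit (Gc t).
exists (fun t => invmx (c t)); split.
- by split=> [|t]; [exact: smooth_mxV|exact: mlgV].
- by rewrite c0 invmx1.
- by rewrite Dmx_inv // dc c0 invmx1 mul1mx mulmx1.
Qed.

Lemma lie_algebra_conj g X : mlg_set G g -> lie_algebra G X ->
  lie_algebra G (g *m X *m invmx g).
Proof.
move=> Gg [c [[sc Gc] c0 dc]].
have sg : smooth_mx (fun t => g *m c t) by apply: smooth_mxM => //; exact: smooth_mx_cst.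
exists (fun t => g *m c t *m invmx g); split.
- split=> [|t]; first by apply: smooth_mxM => //; exact: smooth_mx_cst.
  by apply: mlgM; [exact: mlgM|exact: mlgV].
- by rewrite c0 mulmx1 mulmxV // (mlg_unit Gg).
- rewrite Dmx_mul //; last exact: smooth_mx_cst.
  rewrite [X in _ + _ *m X]Dmx_const mulmx0 addr0.
  rewrite (@Dmx_mul R R N _ _ 1 0 (smooth_mx_cst g) sc).
  by rewrite [X in (X *m _ + _) *m _]Dmx_const mul0mx add0r dc.
Qed.

(** Right translation by the inverse of [g s] brings the curve [g (t *: e + s)] back to the identity
    at [t = 0]. *)
Lemma lie_algebra_log (g : Sigma -> 'M[C]_N) e s : smoothG G g ->
  lie_algebra G (Dmx (Ddir e) g s *m invmx (g s)).
Proof.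
move=> [sg Gg].
have E (h w t : R) : (h *: (w : R^o) + t) *: e + s = h *: (w *: e) + (t *: e + s).
  by rewrite scalerDl scalerA addrA.
have sl : smooth_mx (fun t : R => g (t *: e + s)).
  by move=> i j; exact: (smooth_on_affine E (line_continuous (v := e) (x := s)) (sg i j)).
exists (fun t => g (t *: e + s) *m invmx (g s)); split.
- split=> [|t]; first by apply: smooth_mxM => //; exact: smooth_mx_cst.
  by apply: mlgM; [exact: Gg|apply: mlgV; exact: Gg].
- by rewrite scale0r add0r mulmxV // (mlg_unit (Gg s)).
- rewrite Dmx_mul //; last exact: smooth_mx_cst.
  rewrite [X in _ + _ *m X]Dmx_const mulmx0 addr0; congr (_ *m _).
  apply/matrixP => i j; rewrite !mxE.
  have := Ddir_affine E (fun u => g u i j) 1 0.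
  by rewrite !scale1r scale0r add0r.
Qed.

End LieAlgebra.

(** * Meromorphic functions on the complement of the zeroes *)

Section SpectralSurface.
Context {R : realType} (W : one_form R).
Local Notation C := R[i].
Implicit Types (u v : spectral W -> C) (c : C).

Definition spectral_set : set C := [set z | Some z \notin zeroes W].

Lemma near_neq (a b : C) : a != b -> \forall z \near (a : C^o), z != b.
Proof.
move=> ab; apply/nbhs_n1; exists (n1 (a - b)).
  by rewrite lt_neqAle n1_ge0 eq_sym n1_eq0 subr_eq0 ab.
move=> z; apply: contraTneq => ->.
by rewrite -(n1N (b - a)) opprB ltxx.
Qed.

Lemma near_notin (r : seq (option C)) (z : C) : Some z \notin r ->
  \forall w \near (z : C^o), Some w \notin r.
Proof.
elim: r => [|y r IH]; first by move=> _; exact: filterE.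
rewrite in_cons negb_or => /andP[zy /IH zr].
case: y zy => [y|] zy; last by apply: filterS zr => w wr; rewrite in_cons.
have zy' : z != y by apply: contraNneq zy => ->.
apply: filterS2 zr (near_neq zy') => w wr wy; rewrite in_cons negb_or wr andbT.
by apply: contraNneq wy => -[->].
Qed.

Lemma open_spectral : open (spectral_set : set C^o).
Proof. by rewrite openE => z; exact: near_notin. Qed.

Lemma extend_val u (z : spectral W) : extend u (val z) = u z.
Proof. by rewrite /extend valK. Qed.

Lemma extend_cst c z : spectral_set z -> extend (fun _ : spectral W => c) z = c.
Proof. by move=> Oz; rewrite /extend insubT. Qed.

(** Additivity and scaling hold at every [z] because the junk value is [0]. A nonzero constant, by
    contrast, is its own extension only on [spectral_set], so constants call for
    [near_local_coord]. *)
Lemma extendD u v z : extend (fun x => u x + v x) z = extend u z + extend v z.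
Proof. by rewrite /extend; case: insubP => [//|_]; rewrite addr0. Qed.

Lemma extendZ c u z : extend (fun x => c * u x) z = c * extend u z.
Proof. by rewrite /extend; case: insubP => [//|_]; rewrite mulr0. Qed.

Lemma holomorphic_at_eq (f g : C -> C) z : (\forall w \near (z : C^o), f w = g w) ->
  holomorphic_at f z -> holomorphic_at g z.
Proof.
move=> /near_join fg hf; near=> w.
have e : \forall w' \near (w : C^o), f w' = g w' by near: w.
refine (@near_eq_derivable _ C^o C^o f g w 1 e _); near: w; exact: hf.
Unshelve. all: by end_near. Qed.

Lemma holomorphic_atD (f g : C -> C) z : holomorphic_at f z -> holomorphic_at g z ->
  holomorphic_at (fun w => f w + g w) z.
Proof.
move=> hf hg; apply: filterS2 hf hg => w df dg.
exact: (@derivableD _ _ _ (f : C^o -> C^o) g).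
Qed.

Lemma holomorphic_atZ c (f : C -> C) z : holomorphic_at f z ->
  holomorphic_at (fun w => c * f w) z.
Proof.
by move=> hf; apply: filterS hf => w df; exact: (@derivableZ _ _ _ (f : C^o -> C^o) c).
Qed.

Lemma holomorphic_at_cst c z : holomorphic_at (fun=> c) z.
Proof. by near=> w; exact: (@derivable_cst _ C^o C^o c). Unshelve. all: by end_near. Qed.

Lemma meromorphicD u v : meromorphic u -> meromorphic v ->
  meromorphic (fun x => u x + v x).
Proof.
move=> [hu pu] [hv pv]; split=> [z|y yz].
  rewrite (funext (extendD u v)); exact: holomorphic_atD (hu z) (hv z).
have [f [hf Ef]] := pu y yz; have [g [hg Eg]] := pv y yz.
exists (fun w => f w + g w); split; first exact: holomorphic_atD.
by apply: filterS2 Ef Eg => w -> ->; rewrite extendD mulrDr.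
Qed.

Lemma meromorphicZ c u : meromorphic u -> meromorphic (fun x => c * u x).
Proof.
move=> [hu pu]; split=> [z|y yz].
  rewrite (funext (extendZ c u)); exact: holomorphic_atZ (hu z).
have [f [hf Ef]] := pu y yz.
exists (fun w => c * f w); split; first exact: holomorphic_atZ.
by apply: filterS Ef => w ->; rewrite extendZ mulrCA.
Qed.

Lemma dnbhs_neq (b : C) : \forall w \near (0 : C^o)^', w != b.
Proof.
have [->|b0] := eqVneq b 0; first exact: nbhs_dnbhs_neq.
by apply: nbhs_dnbhs; apply: near_neq; rewrite eq_sym.
Qed.

(** The list of zeroes is finite, and each excludes at most one value of the local coordinate,
    [x - a] around [a] and the inverse of [x] at infinity. A punctured neighbourhood of [0] avoids
    it, even when it is [0]. *)
Lemma near_local_coord y : \forall w \near (0 : C^o)^', spectral_set (local_coord y w).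
Proof.
suff H (r : seq (option C)) : \forall w \near (0 : C^o)^', Some (local_coord y w) \notin r.
  exact: H.
elim: r => [|x r IH]; first exact: filterE.
have Hx : \forall w \near (0 : C^o)^', Some (local_coord y w) != x.
  case: x => [x|]; last exact: filterE.
  case: y {IH} => [a|] /=.
    apply: filterS (dnbhs_neq (x - a)) => w; apply: contraNneq => -[<-].
    by rewrite addrC addKr.
  apply: filterS (dnbhs_neq x^-1) => w; apply: contraNneq => -[<-].
  by rewrite invrK.
by apply: filterS2 IH Hx => w wr wx; rewrite in_cons negb_or wr andbT.
Qed.

Lemma meromorphic_cst c : meromorphic (fun _ : spectral W => c).
Proof.
split=> [z|y yz].
  apply: holomorphic_at_eq (holomorphic_at_cst c _).
  have Oz : spectral_set (val z) := valP z.
  apply: filterS (open_nbhs_nbhs (conj open_spectral Oz)) => w Ow.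
  by rewrite extend_cst.
exists (fun w => w ^+ zmult W y * c); split.
  near=> w; apply: (@derivableM _ _ (fun w : C^o => w ^+ zmult W y) (fun=> c)).
    exact: exprn_derivable.
  exact: derivable_cst.
by apply: filterS (near_local_coord y) => w Ow; rewrite extend_cst.
Unshelve. all: by end_near. Qed.

Lemma meromorphic_sum (I : Type) (r : seq I) (F : I -> spectral W -> C) :
  (forall i, meromorphic (F i)) -> meromorphic (fun x => \sum_(i <- r) F i x).
Proof.
move=> mF; elim: r => [|i r IH].
  by under eq_fun do rewrite big_nil; exact: meromorphic_cst.
by under eq_fun do rewrite big_cons; exact: meromorphicD.
Qed.

End SpectralSurface.

(** * Stability of admissible forms *)

Section Admissible.
Context {R : realType} {N : nat} (G : matrix_lie_group R N) (W : one_form R).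
Local Notation C := R[i].
Local Notation Sigma := ('rV[R]_2).
Local Notation coef := (coefficient N W).
Implicit Types (f : coef) (g : Sigma -> 'M[C]_N).

Lemma open_surface : open (surface W).
Proof.
have oU : open (toC @^-1` (spectral_set W)) := open_toC (@open_spectral R W).
apply: (@open_comp _ _ (snd : Sigma * (R * R) -> R * R) _ _ oU) => x _.
exact: cvg_snd.
Qed.

Definition surface_smooth (u : Sigma -> spectral W -> C) :=
  smooth_on (surface W) (fun v => extend (u v.1) (v.2.1 +i* v.2.2)).

Lemma surface_smoothD u v : surface_smooth u -> surface_smooth v ->
  surface_smooth (fun s z => u s z + v s z).
Proof.
move=> su sv; apply: (eq_smooth_on open_surface _ (smooth_onD open_surface su sv)) => p _.
by rewrite extendD.
Qed.

Lemma smooth_base (a : Sigma -> C) : smooth a ->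
  smooth_on (surface W) (fun v : Sigma * (R * R) => a v.1).
Proof.
move=> sa.
have E (h : R) (w v : Sigma * (R * R)) : (h *: w + v).1 = h *: w.1 + v.1 by [].
have c1 : continuous (fst : Sigma * (R * R) -> Sigma) by move=> x; exact: cvg_fst.
have H := smooth_on_affine E c1 sa.
have sub k (q : Sigma * (R * R) -> R) : Ck setT k q -> Ck (surface W) k q.
  elim: k q => [|k IH] q [cq dq]; split=> //; try by move=> v _; exact: cq.
  by move=> w; have [d1 d2] := dq w; split; [move=> v _; exact: d1|exact: IH].
by move=> k; have [h1 h2] := H k; split; exact: sub.
Qed.

Lemma surface_smooth_base (a : Sigma -> C) : smooth a -> surface_smooth (fun s _ => a s).
Proof.
move=> /smooth_base sa; apply: (eq_smooth_on open_surface _ sa) => p Op.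
by rewrite extend_cst.
Qed.

Lemma surface_smoothZ (a : Sigma -> C) u : smooth a -> surface_smooth u ->
  surface_smooth (fun s z => a s * u s z).
Proof.
move=> /smooth_base sa su.
apply: (eq_smooth_on open_surface _ (smooth_onM open_surface sa su)) => p _.
by rewrite extendZ.
Qed.

Lemma surface_smooth_sum (I : Type) (r : seq I) (F : I -> Sigma -> spectral W -> C) :
  (forall i, surface_smooth (F i)) -> surface_smooth (fun s z => \sum_(i <- r) F i s z).
Proof.
move=> sF; elim: r => [|i r IH].
  have := surface_smooth_base (smooth_cst 0); congr surface_smooth.
  by apply/funext => s; apply/funext => z; rewrite big_nil.
have := surface_smoothD (sF i) IH; congr surface_smooth.
by apply/funext => s; apply/funext => z; rewrite big_cons.
Qed.

Lemma Omega_MD f1 f2 : Omega_M G f1 -> Omega_M G f2 ->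
  Omega_M G (fun s z => f1 s z + f2 s z).
Proof.
move=> [l1 s1 m1] [l2 s2 m2]; split.
- by move=> s z; exact: lie_algebraD.
- move=> i j; have := @surface_smoothD (fun s z => f1 s z i j) (fun s z => f2 s z i j) (s1 i j) (s2 i j); congr smooth_on.
  apply/funext => v; congr (extend _ _); apply/funext => z; by rewrite mxE.
- by move=> s i j; under eq_fun do rewrite mxE; exact: meromorphicD.
Qed.

Lemma Omega_M_base (a : Sigma -> 'M[C]_N) : smooth_mx a -> (forall s, lie_algebra G (a s)) ->
  Omega_M (W := W) G (fun s _ => a s).
Proof.
move=> sa la; split=> [s _|i j|s i j]; first exact: la.
  exact: surface_smooth_base (sa i j).
exact: meromorphic_cst.
Qed.

(** The factors are grouped so that, for a conjugation by [g s], only [B c d] depends on the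
    spectral parameter. Smoothness, pole orders and Taylor coefficients all follow from this linear
    expression. *)
Lemma conj_entry (A B D : 'M[C]_N) i j :
  (A *m B *m D) i j = \sum_d \sum_c (A i c * D d j) * B c d.
Proof.
rewrite mxE; apply: eq_bigr => d _; rewrite mxE mulr_suml; apply: eq_bigr => c _.
by rewrite mulrAC.
Qed.

Lemma Omega_M_conj g f : smoothG G g -> Omega_M G f ->
  Omega_M G (fun s z => g s *m f s z *m invmx (g s)).
Proof.
move=> sG [lf sf mf]; have gU := smoothG_unit sG; have [sg Gg] := sG.
have sgV := smooth_mxV gU sg; split.
- by move=> s z; exact: lie_algebra_conj.
- move=> i j.
  have H d c : surface_smooth (fun s z => (g s i c * invmx (g s) d j) * f s z c d).
    apply: (@surface_smoothZ _ (fun s z => f s z c d)) (sf c d).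
    by apply: smoothM; [exact: sg|exact: sgV].
  have := surface_smooth_sum (index_enum 'I_N)
    (fun d => surface_smooth_sum (index_enum 'I_N) (H d)); congr smooth_on.
  by apply/funext => v; congr (extend _ _); apply/funext => z; rewrite conj_entry.
- move=> s i j; under eq_fun do rewrite conj_entry.
  by apply: meromorphic_sum => d; apply: meromorphic_sum => c; exact: meromorphicZ.
Qed.

Lemma Omega_M_smooth f z : Omega_M G f -> smooth_mx (fun s => f s z).
Proof.
move=> [_ sf _] i j.
pose phi (s : Sigma) : Sigma * (R * R) := (s, (complex.Re (val z), complex.Im (val z))).
have E (h : R) (w v : Sigma) : phi (h *: w + v) = h *: (w, 0) + phi v.
  by rewrite /phi; apply/pair_equal_spec; split => //=; rewrite scaler0 add0r.
have cphi : continuous phi.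
  move=> s; exact: (@cvg_pair _ _ _ _ (nbhs s) _ _ _ _ id (fun=> _) cvg_id (cvg_cst _)).
have zE : complex.Re (val z) +i* complex.Im (val z) = val z by case: (val z).
have H := smooth_on_affine E cphi (sf i j).
have -> : (fun s => f s z i j) =
    (fun v => extend (fun z => f v.1 z i j) (v.2.1 +i* v.2.2)) \o phi.
  by apply/funext => s; rewrite /= zE extend_val.
suff E2 : phi @^-1` surface W = setT by rewrite /smooth -E2.
by apply/seteqP; split=> // s _; rewrite /surface /= zE; exact: (valP z).
Qed.

Lemma Omega_M_gauge g L i : smoothG G g -> Omega_M G (L i) ->
  Omega_M G (gaugeL (W := W) g L i).
Proof.
move=> sG OL; apply: Omega_MD; last exact: Omega_M_conj.
have [sg Gg] := sG; apply: Omega_M_base => [|s]; last exact/lie_algebraN/lie_algebra_log.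
apply/smooth_mxN/smooth_mxM; first exact: smooth_mx_Dmx.
exact: smooth_mxV (smoothG_unit sG) sg.
Qed.

(** Here [V] is the inverse of [g], [D0] and [D1] its first derivatives, [P] and [Q] the derivatives
    of [L1] and [L0] that enter the curvature. The same [H] stands for both mixed second derivatives
    of [g], so these cancel. Inserting [V] times [g] turns the rest into polynomials in [D0 *m V],
    [D1 *m V] and the conjugates of [L0], [L1], [P], [Q]. *)
Lemma curvature_identity (g V H D0 D1 L0 L1 P Q : 'M[C]_N) : V *m g = 1%:M ->
  (- (H *m V) + D1 *m (V *m D0 *m V) + (D0 *m L1 *m V + g *m P *m V - g *m L1 *m (V *m D0 *m V)))
  - (- (H *m V) + D0 *m (V *m D1 *m V) +
     (D1 *m L0 *m V + g *m Q *m V - g *m L0 *m (V *m D1 *m V)))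
  + mxbracket (- (D0 *m V) + g *m L0 *m V) (- (D1 *m V) + g *m L1 *m V) =
  g *m (P - Q + mxbracket L0 L1) *m V.
Proof.
move=> Vg.
have DL (A B : 'M[C]_N) : A *m B *m V = A *m V *m (g *m B *m V).
  by rewrite -!mulmxA (mulmxA V g) Vg mul1mx.
have gLL A B : g *m (A *m B) *m V = g *m A *m V *m (g *m B *m V).
  by rewrite -!mulmxA (mulmxA V g) Vg mul1mx.
have -> : g *m (P - Q + mxbracket L0 L1) *m V =
    g *m P *m V - g *m Q *m V + mxbracket (g *m L0 *m V) (g *m L1 *m V).
  by rewrite /mxbracket -!gLL !(mulmxDr, mulmxN, mulmxDl, mulNmx).
have T (A B : 'M[C]_N) : A *m (V *m B *m V) = A *m V *m (B *m V) by rewrite !mulmxA.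
rewrite !T (DL D0) (DL D1).
move: (D0 *m V) (D1 *m V) (g *m L0 *m V) (g *m L1 *m V) (g *m P *m V) (g *m Q *m V) (H *m V).
move=> a0 a1 m0 m1 p q c.
have B (x y z t : 'M[C]_N) : (- x + y) *m (- z + t) = x *m z - x *m t - y *m z + y *m t.
  rewrite mulmxDl !mulmxDr !mulmxN !mulNmx opprK.
  by rewrite -!addrA.
rewrite /mxbracket !B.
(* With the noncommuting products taken as atoms, only an additive identity remains, which [ring]
   can check entry by entry. *)
move: (a1 *m a0) (a0 *m a1) (a0 *m m1) (m1 *m a0) (a1 *m m0) (m0 *m a1) (m0 *m m1) (m1 *m m0).
by move=> *; apply/matrixP => i j; rewrite !mxE; ring.
Qed.

Lemma curvature_gauge g L : smoothG G g -> (forall i, Omega_M G (L i)) ->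
  curvature (gaugeL (W := W) g L) =
  fun s z => g s *m curvature L s z *m invmx (g s).
Proof.
move=> sG OL; have [sg Gg] := sG; have gU := smoothG_unit sG.
have sV := smooth_mxV gU sg.
have sD i : smooth_mx (Dmx (Ddir (axis i)) g) := smooth_mx_Dmx _ sg.
apply/funext => s; apply/funext => z.
have sL i := Omega_M_smooth z (OL i).
pose D i := Dmx (Ddir (axis i)) g s; pose V := invmx (g s).
have E i j : partialL i (gaugeL g L j) s z =
  - (Dmx (Ddir (axis i)) (Dmx (Ddir (axis j)) g) s *m V) + D j *m (V *m D i *m V) +
  (D i *m L j s z *m V + g s *m partialL i (L j) s z *m V -
   g s *m L j s z *m (V *m D i *m V)).
  rewrite /partialL /gaugeL Dmx_add; last 2 first.
  - exact: (smooth_mxN (smooth_mxM (sD j) sV)).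
  - exact: (smooth_mxM (smooth_mxM sg (sL j)) sV).
  rewrite Dmx_opp; last exact: (smooth_mxM (sD j) sV).
  rewrite (Dmx_mul _ _ (sD j) sV) (Dmx_mul _ _ (smooth_mxM sg (sL j)) sV).
  rewrite (Dmx_mul _ _ sg (sL j)) (Dmx_inv _ _ gU sg).
  by rewrite !mulmxN opprD opprK mulmxDl.
apply: etrans (curvature_identity _ _ _ _ _ _ _ (mulVmx (gU s))).
rewrite /curvature (E 0 1) (E 1 0) (Dmx_swap (axis 0) (axis 1) s sg).
reflexivity.
Qed.

End Admissible.

(** * Jets and gauge transformations *)

Section TaylorCoefficients.
Context {R : realType}.
Local Notation C := R[i].
Implicit Types (u v : C -> C) (O : set C).

Definition inf_derivable O u : Prop := forall p z, O z ->
  derivable (derive1n p (u : C^o -> C^o) : C^o -> C^o) z 1.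

Lemma holo_inf_derivable O u : open (O : set C^o) -> holo O u -> inf_derivable O u.
Proof.
move=> oO hu p; suff [] : holo O (derive1n p (u : C^o -> C^o)) by [].
by elim: p => [//|p IH]; rewrite derive1nS; exact: holo_derive1.
Qed.

Lemma eq_derive1n O u v p z : open (O : set C^o) -> (forall w, O w -> u w = v w) -> O z ->
  derive1n p (u : C^o -> C^o) z = derive1n p (v : C^o -> C^o) z.
Proof.
move=> oO uv; elim: p z => [|p IH] z Oz; first exact: uv.
rewrite !derive1nS !derive1E; apply: near_eq_derive.
by apply: filterS (open_nbhs_nbhs (conj oO Oz)) => w; exact: IH.
Qed.

Lemma derive1n_cst c p (z : C) :
  derive1n p ((fun=> c) : C^o -> C^o) z = if p == 0%N then c else 0.
Proof.
case: p => // p; rewrite derive1Sn.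
have -> : derive1 ((fun=> c) : C^o -> C^o) = (fun=> 0).
  by apply/funext => w; rewrite derive1E derive_cst.
elim: p => [//|p IH]; rewrite derive1Sn.
have -> // : derive1 ((fun=> 0) : C^o -> C^o) = (fun=> 0).
by apply/funext => w; rewrite derive1E derive_cst.
Qed.

Lemma derive1nD O u v p z : open (O : set C^o) -> inf_derivable O u -> inf_derivable O v -> O z ->
  derive1n p ((fun w => u w + v w) : C^o -> C^o) z =
  derive1n p (u : C^o -> C^o) z + derive1n p (v : C^o -> C^o) z.
Proof.
move=> oO du dv; elim: p z => [|p IH] z Oz //.
rewrite !derive1nS !derive1E.
rewrite -(@deriveD _ C^o C^o _ _ _ _ (du p z Oz) (dv p z Oz)).
by apply: near_eq_derive; apply: filterS (open_nbhs_nbhs (conj oO Oz)) => w; exact: IH.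
Qed.

Lemma derive1nZ O c u p z : open (O : set C^o) -> inf_derivable O u -> O z ->
  derive1n p ((fun w => c * u w) : C^o -> C^o) z = c * derive1n p (u : C^o -> C^o) z.
Proof.
move=> oO du; elim: p z => [|p IH] z Oz //.
rewrite !derive1nS !derive1E.
rewrite -[RHS](@deriveZ _ C^o C^o _ c _ _ (du p z Oz)).
by apply: near_eq_derive; apply: filterS (open_nbhs_nbhs (conj oO Oz)) => w; exact: IH.
Qed.

Lemma inf_derivable_cst O c : inf_derivable O (fun=> c).
Proof.
move=> p z Oz; have -> : derive1n p ((fun=> c) : C^o -> C^o) =
    fun=> if p == 0%N then c else 0 by apply/funext => w; exact: derive1n_cst.
exact: derivable_cst.
Qed.

Lemma inf_derivableD O u v : open (O : set C^o) -> inf_derivable O u -> inf_derivable O v ->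
  inf_derivable O (fun w => u w + v w).
Proof.
move=> oO du dv p z Oz.
refine (@near_eq_derivable _ C^o C^o _ _ z 1 _
  (@derivableD _ C^o C^o _ _ _ _ (du p z Oz) (dv p z Oz))).
apply: filterS (open_nbhs_nbhs (conj oO Oz)) => w Ow; apply/esym; exact: derive1nD oO du dv Ow.
Qed.

Lemma inf_derivableZ O c u : open (O : set C^o) -> inf_derivable O u ->
  inf_derivable O (fun w => c * u w).
Proof.
move=> oO du p z Oz.
refine (@near_eq_derivable _ C^o C^o _ _ z 1 _
  (@derivableZ _ C^o C^o _ c _ _ (du p z Oz))).
apply: filterS (open_nbhs_nbhs (conj oO Oz)) => w Ow; apply/esym; exact: derive1nZ oO du Ow.
Qed.

Section Sums.
Context (O : set C) (oO : open (O : set C^o)) (I : Type) (r : seq I) (F : I -> C -> C).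
Hypothesis dF : forall i, inf_derivable O (F i).

Lemma inf_derivable_sum : inf_derivable O (fun w => \sum_(i <- r) F i w).
Proof.
elim: r => [|i r' IH].
  have -> : (fun w => \sum_(i <- [::]) F i w) = (fun=> 0).
    by apply/funext => w; rewrite big_nil.
  exact: inf_derivable_cst.
have -> : (fun w => \sum_(j <- i :: r') F j w) = (fun w => F i w + \sum_(j <- r') F j w).
  by apply/funext => w; rewrite big_cons.
exact: (inf_derivableD oO (@dF i) IH).
Qed.

End Sums.

Lemma derive1n_sum O (I : Type) (r : seq I) (F : I -> C -> C) p z : open (O : set C^o) ->
  (forall i, inf_derivable O (F i)) -> O z ->
  derive1n p ((fun w => \sum_(i <- r) F i w) : C^o -> C^o) z =
  \sum_(i <- r) derive1n p (F i : C^o -> C^o) z.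
Proof.
move=> oO dF Oz; elim: r => [|i r IH].
  have -> : (fun w => \sum_(i <- [::]) F i w) = (fun=> 0).
    by apply/funext => w; rewrite big_nil.
  by rewrite big_nil derive1n_cst if_same.
have -> : (fun w => \sum_(j <- i :: r) F j w) = (fun w => F i w + \sum_(j <- r) F j w).
  by apply/funext => w; rewrite big_cons.
have dS : inf_derivable O (fun w => \sum_(j <- r) F j w).
  by apply: inf_derivable_sum.
by rewrite big_cons -IH (derive1nD p oO (dF i) dS Oz).
Qed.

End TaylorCoefficients.

(** * Poles are not zeroes *)

Section Poles.
Context {R : realType} (W : one_form R).
Local Notation C := R[i].

Lemma holomorphic_continuous (f : C -> C) z : holomorphic_at f z ->
  (f : C^o -> C^o) @ (z : C^o)^' --> (f z : C^o).
Proof.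
move=> /nbhs_singleton df; apply: cvg_within_filter.
by apply/(@differentiable_continuous _ C^o C^o); exact/derivable1_diffP.
Qed.

(** A point that is both a pole and a zero would give, off [0], two local expressions whose
    comparison reads [w ^+ (m + n) * f w = g w] with [m] positive; by continuity [g 0] would vanish.
    Jets are thereby taken at points where the coefficients of a Lax form are holomorphic. *)
Lemma pole_spectral x : spectral_set W (pole W x).
Proof.
apply/negP => /zero_order[f [hf _ Ef]].
have [g [hg g0 Eg]] := pole_order x.
have m0 := mult_gt0 x.
set m := mult W x in Eg m0; set n := zmult W _ in Ef.
have E : \forall w \near (0 : C^o)^', w ^+ (m + n) * f w = g w.
  near=> w.
  have w0 : w != 0 by near: w; exact: dnbhs_neq.
  have e1 : local_coef (omega W) (Some (pole W x)) w = w ^ n%:Z * f w by near: w.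
  have e2 : local_coef (omega W) (Some (pole W x)) w = w ^ (- m%:Z) * g w by near: w.
  move: e1; rewrite e2 => /(congr1 (fun y => w ^ m%:Z * y)).
  rewrite !mulrA -!expfzDr // subrr expr0z mul1r => ->.
  by rewrite -PoszD -exprnP.
have hX : holomorphic_at (fun w : C => w ^+ (m + n)) 0.
  by apply: filterE => w; exact: exprn_derivable.
have cX := holomorphic_continuous hX.
have cf := holomorphic_continuous hf.
have cg := holomorphic_continuous hg.
pose u : C^o -> C^o := fun w => w ^+ (m + n) * f w.
have c1 : u @ (0 : C^o)^' --> (0 ^+ (m + n) * f 0 : C^o).
  by apply: cvgM; [exact: cX|exact: cf].
have c2 : (g : C^o -> C^o) @ (0 : C^o)^' --> (0 ^+ (m + n) * f 0 : C^o).
  exact: (cvg_trans (near_eq_cvg (f := u) E) c1).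
move/eqP: g0; apply.
rewrite (cvg_unique (@norm_hausdorff _ C^o) cg c2) expr0n addn_eq0.
by rewrite [m == _]gtn_eqF //= mul0r.
Unshelve. all: by end_near. Qed.

End Poles.

Section CoefficientMatrices.
Context {R : realType} {n N : nat}.
Local Notation C := R[i].
Local Notation T := (trunc R n).
Implicit Types (A B : 'M[T]_N) (M : 'M[C]_N).
Local Notation mxC := (map_mx (qpolyC ('X^n : {poly C}))).

Lemma coef_mx_inj A B : (forall p, (p <= n.-1)%N -> coef_mx A p = coef_mx B p) -> A = B.
Proof.
move=> AB; apply: mxcoef_inj => i j p /AB/matrixP/(_ i j).
by rewrite !mxE.
Qed.

Lemma coef_mxD A B p : coef_mx (A + B) p = coef_mx A p + coef_mx B p.
Proof. by apply/matrixP => i j; rewrite !mxE tcoefD. Qed.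

Lemma coef_mxN A p : coef_mx (- A) p = - coef_mx A p.
Proof. by apply/matrixP => i j; rewrite !mxE tcoefN. Qed.

Lemma coef_mxC M p : coef_mx (mxC M) p = if p == 0%N then M else 0.
Proof. by apply/matrixP => i j; rewrite !mxE tcoefC; case: ifP; rewrite ?mxE. Qed.

Lemma coef_mxCl M A p : coef_mx (mxC M *m A) p = M *m coef_mx A p.
Proof.
apply/matrixP => i j; rewrite !mxE tcoef_sum; apply: eq_bigr => l _.
by rewrite !mxE tcoefZ.
Qed.

Lemma coef_mxCr M A p : coef_mx (A *m mxC M) p = coef_mx A p *m M.
Proof.
apply/matrixP => i j; rewrite !mxE tcoef_sum; apply: eq_bigr => l _.
by rewrite !mxE mulrC tcoefZ mulrC.
Qed.

Lemma coef_jet_mx (a : nat -> 'M[C]_N) p : (p < n)%N -> coef_mx (jet_mx n a) p = a p.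
Proof. by move=> pn; apply/matrixP => i j; rewrite !mxE tcoef_to_trunc pn. Qed.

(** Taking the constant term is compatible with sums and products. Invertibility of a jet is thereby
    reduced to that of the group element beneath it. *)
Lemma tcoef0_det A : tcoef (\det A) 0 = \det (coef_mx A 0).
Proof.
rewrite /determinant tcoef_sum; apply: eq_bigr => s _.
have t1 : tcoef (1 : T) 0 = 1 by rewrite /tcoef /= coefC.
have sgn (l : nat) : tcoef ((-1 : T) ^+ l) 0 = (-1) ^+ l.
  by elim: l => [|l IH]; rewrite ?expr0 // !exprS tcoef0 IH tcoefN t1.
rewrite tcoef0 sgn; congr (_ * _).
rewrite (big_morph (fun t : T => tcoef t 0) (@tcoef0 _ _) t1).
by apply: eq_bigr => i _; rewrite mxE.
Qed.

Lemma unitmx_coef0 A : coef_mx A 0 \in unitmx -> A \in unitmx.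
Proof. by rewrite !unitmxE unitfE -tcoef0_det; exact: unit_tcoef0. Qed.

End CoefficientMatrices.

(** * Gauge transport of Lax objects *)

Section GaugeTransport.
Context {R : realType} {N : nat} (G : matrix_lie_group R N) (W : one_form R).
Local Notation C := R[i].
Local Notation Sigma := ('rV[R]_2).
Local Notation jets := (defect_mx N W).
Implicit Types (g : Sigma -> 'M[C]_N) (f h : Sigma -> jets) (L : 'I_2 -> coefficient N W).

Lemma smooth_defect_unit h : smooth_defect G h -> forall s x, h s x \in unitmx.
Proof.
move=> [_ Gh] s x; have [c [[_ Gc] ->]] := Gh s x.
apply: unitmx_coef0; rewrite coef_jet_mx ?mult_gt0 //.
suff -> : taylor_coef c 0 = c 0 by exact: mlg_unit (Gc 0).
apply/matrixP => i j; rewrite mxE fact0 /= divr1.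
by case: (c 0 i j).
Qed.

Lemma smoothJM f h : smoothJ f -> smoothJ h -> smoothJ (fun s => mulJ (f s) (h s)).
Proof.
move=> sf sh x; apply: entrywiseM (sf x) (sh x); [exact: smoothT_cst| |].
  by move=> ? ?; exact: smoothTD.
by move=> ? ?; exact: smoothTM.
Qed.

Lemma smoothJV f : (forall s x, f s x \in unitmx) -> smoothJ f ->
  smoothJ (fun s => invJ (f s)).
Proof.
move=> fU sf x; apply: entrywiseV (fun s => fU s x) (sf x); [exact: smoothT_cst| | |].
- by move=> ? ?; exact: smoothTD.
- by move=> ? ?; exact: smoothTM.
- by move=> u uU; exact: smoothTV.
Qed.

Lemma smoothJ_diag g : smooth_mx g -> smoothJ (fun s => diagJ (W := W) (g s)).
Proof.
move=> sg x i j p; under eq_fun do rewrite mxE tcoefC.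
by case: (p == 0%N); [exact: sg|exact: smooth_cst].
Qed.

Lemma smoothJD f h : smoothJ f -> smoothJ h -> smoothJ (fun s x => f s x + h s x).
Proof.
move=> sf sh x i j; under eq_fun do rewrite mxE.
exact: smoothTD (sf x i j) (sh x i j).
Qed.

Lemma smoothJN f : smoothJ f -> smoothJ (fun s x => - f s x).
Proof.
move=> sf x i j p; under eq_fun do rewrite mxE tcoefN -mulN1r.
by apply: smoothM; [exact: smooth_cst|exact: sf].
Qed.

Lemma smoothJ_partial i f : smoothJ f -> smoothJ (partialJ i f).
Proof.
move=> sf x a b p; under eq_fun do rewrite mxE tcoef_to_trunc.
by case: (p < mult W x)%N; [exact: smooth_on_Ddir (sf x a b p)|exact: smooth_cst].
Qed.

Lemma smoothJ_gauge f (a : 'I_2 -> Sigma -> jets) i : (forall s x, f s x \in unitmx) ->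
  smoothJ f -> smoothJ (a i) -> smoothJ (gaugeJ f a i).
Proof.
move=> fU sf sa; have sV := smoothJV fU sf.
apply: smoothJD; first exact: (smoothJN (smoothJM (smoothJ_partial i sf) sV)).
exact: (smoothJM (smoothJM sf sa) sV).
Qed.

(** The product rule for velocities handles all truncated coefficients together, and a velocity
    determines the partial derivative. *)
Lemma partialJM i f h s x : smoothJ f -> smoothJ h ->
  partialJ i (fun s => mulJ (f s) (h s)) s x =
  partialJ i f s x *m h s x + f s x *m partialJ i h s x.
Proof.
move=> sf sh; have vf := smoothJ_velocity i s sf; have vh := smoothJ_velocity i s sh.
suff vM : velocityJ (axis i) s (fun s => mulJ (f s) (h s))
    (fun x => partialJ i f s x *m h s x + f s x *m partialJ i h s x).
  by rewrite (velocity_partialJ vM).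
move=> y; have := velocityM (vf y) (vh y).
by rewrite scale0r add0r.
Qed.

Lemma gauge_mx_comp (A : comUnitRingType) m (F H DF DH X : 'M[A]_m) :
  F \in unitmx -> H \in unitmx ->
  - ((DF *m H + F *m DH) *m invmx (F *m H)) + (F *m H) *m X *m invmx (F *m H) =
  - (DF *m invmx F) + F *m (- (DH *m invmx H) + H *m X *m invmx H) *m invmx F.
Proof.
move=> FU HU; rewrite invmxM // mulmxDl mulmxDr mulmxDl !mulmxA mulmxK // opprD -addrA.
by rewrite mulmxN mulNmx !mulmxA.
Qed.

Lemma gaugeJM f h (a : 'I_2 -> Sigma -> jets) i s x :
  (forall s x, f s x \in unitmx) -> (forall s x, h s x \in unitmx) ->
  smoothJ f -> smoothJ h ->
  gaugeJ (fun s => mulJ (f s) (h s)) a i s x = gaugeJ f (gaugeJ h a) i s x.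
Proof.
move=> fU hU sf sh; rewrite /gaugeJ (partialJM i s x sf sh).
exact: (gauge_mx_comp _ _ (a i s x) (fU s x) (hU s x)).
Qed.

Lemma coef_jstar L i s x p : (p < mult W x)%N -> coef_mx (jstar L i s x) p =
  \matrix_(a, b) (derive1n p (extend (fun z => L i s z a b) : C^o -> C^o) (pole W x) / p`!%:R).
Proof. exact: coef_jet_mx. Qed.

Lemma Omega_M_inf_derivable (f : coefficient N W) s a b : Omega_M G f ->
  inf_derivable (spectral_set W) (extend (fun z => f s z a b)).
Proof.
move=> [_ sf mf]; apply: holo_inf_derivable; first exact: open_spectral.
split=> [z Oz|].
  have [hz _] := mf s a b.
  exact: (nbhs_singleton (hz (Sub z Oz))).
pose phi (q : R * R) : Sigma * (R * R) := (s, q).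
have E (h : R) (w v : R * R) : phi (h *: w + v) = h *: (0, w) + phi v.
  by rewrite /phi; apply/pair_equal_spec; split => //=; rewrite scaler0 add0r.
have cphi : continuous phi.
  move=> q; exact: (@cvg_pair _ _ _ (nbhs q) _ _ _ _ _ (fun=> _) id (cvg_cst _) cvg_id).
have H := smooth_on_affine E cphi (sf a b); exact: H.
Qed.

(** Since [g] does not depend on the spectral parameter, its jet is constant: multiplying by it acts
    on each Taylor coefficient separately, and the comparison can be made degree by degree. *)
Lemma jstar_gauge g L i s x : smoothG G g -> Omega_M G (L i) ->
  jstar (gaugeL g L) i s x = gaugeJ (fun s => diagJ (g s)) (jstar L) i s x.
Proof.
move=> sG OL; have [sg Gg] := sG; have gU := smoothG_unit sG.
have oO := @open_spectral R W; have Ox := pole_spectral x.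
have pE : partialJ i (fun s => diagJ (W := W) (g s)) s x =
    map_mx (qpolyC _) (Dmx (Ddir (axis i)) g s).
  apply/matrixP => a b; rewrite !mxE; apply: tcoef_inj => p; rewrite pred_mult => pn.
  rewrite tcoef_to_trunc pn tcoefC.
  under [X in Ddir _ X]eq_fun do rewrite mxE tcoefC.
  by case: (p == 0%N); rewrite ?DdirC.
rewrite /gaugeJ pE /diagJ -map_invmx -map_mxM.
apply: coef_mx_inj => p; rewrite pred_mult => pn.
rewrite coef_mxD coef_mxN coef_mxC coef_mxCr coef_mxCl !coef_jstar //.
set D := Dmx _ _ _; set V := invmx (g s).
apply/matrixP => a b; rewrite [LHS]mxE.
pose F d c := fun z : C => (g s a c * V d b) * extend (fun z => L i s z c d) z.
have dL c d : inf_derivable (spectral_set W) (extend (fun z => L i s z c d)).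
  exact: Omega_M_inf_derivable OL.
have dF d c : inf_derivable (spectral_set W) (F d c).
  by apply: inf_derivableZ oO _; exact: dL.
have dS d : inf_derivable (spectral_set W) (fun z => \sum_(c <- index_enum 'I_N) F d c z).
  exact: (@inf_derivable_sum R _ oO _ _ (fun c => F d c) (dF d)).
have dSS := @inf_derivable_sum R _ oO _ (index_enum 'I_N)
  (fun d z => \sum_(c <- index_enum 'I_N) F d c z) dS.
(* Stated on [spectral_set] only, since the first summand is constant and does not share the junk
   value of the left-hand side elsewhere. *)
have E z : spectral_set W z -> extend (fun z => gaugeL g L i s z a b) z =
    (- (D *m V) a b) + \sum_d \sum_c F d c z.
  move=> Oz; rewrite /F /extend insubT; rewrite /gaugeL mxE [X in X + _]mxE conj_entry.
  by [].
rewrite (eq_derive1n p oO E Ox).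
rewrite (derive1nD p oO (@inf_derivable_cst R _ (- (D *m V) a b)) dSS Ox).
rewrite derive1n_cst (derive1n_sum _ p oO dS Ox).
(* The inhomogeneous term contributes in degree [0] only, on both sides. *)
rewrite mulrDl [RHS]mxE; congr (_ + _).
  rewrite [RHS]mxE; case: p pn => [|p] pn /=; first by rewrite divr1.
  by rewrite mul0r mxE oppr0.
rewrite conj_entry mulr_suml; apply: eq_bigr => d _.
rewrite (derive1n_sum _ p oO (dF d) Ox) mulr_suml; apply: eq_bigr => c _.
by rewrite (derive1nZ _ p oO (dL c d) Ox) mxE mulrA.
Qed.

Context (k : set jets) (hk : lie_subalgebra G k).

(** That the new field is again a smooth map to [defect_group] is assumed: wherever the lemma is
    applied, this field is already given as an object of [F2d]. *)
Lemma lax_object_act L h (a : gauge W) : lax_object G k L h -> is_gauge G k a ->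
  smooth_defect G (act a h) -> lax_object G k (gaugeL a.1 L) (act a h).
Proof.
case: a => g f /= [[OL OF] sh Ok] [/= sG sK] sah.
have hU := smooth_defect_unit sh; have gU := smoothG_unit sG; have [sg Gg] := sG.
have [sf fU _ _] := sK; have [smh _] := sh.
split; [|exact: sah|].
  split=> [i|]; first exact: Omega_M_gauge.
  by rewrite (curvature_gauge sG OL); exact: Omega_M_conj.
pose dg s : jets := diagJ (g s).
have dU s x : dg s x \in unitmx by rewrite /dg /diagJ map_unitmx.
have sd : smoothJ dg := smoothJ_diag sg.
have hVU s x : invJ (h s) x \in unitmx by rewrite /invJ unitmx_inv hU.
have dVU s x : invJ (dg s) x \in unitmx by rewrite /invJ unitmx_inv dU.
have sdV := smoothJV dU sd; have shV := smoothJV hU smh.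
have hdU s x : mulJ (invJ (h s)) (invJ (dg s)) x \in unitmx.
  by rewrite /mulJ unitmx_mul hVU dVU.
pose b := gaugeJ (fun s => invJ (h s)) (jstar L).
(* The inverse of the new field is [f] times the inverse of [h] times the inverse of the diagonal of
   [g]. The last factor undoes the transformation of the jets by [g], leaving the old [k]-valued
   form transformed by [f]. *)
have E i : gaugeJ (fun s => invJ (act (g, f) h s)) (jstar (gaugeL g L)) i = gaugeJ f b i.
  apply/funext => s; apply: functional_extensionality_dep => x.
  have -> : (fun s => invJ (act (g, f) h s)) =
      (fun s => mulJ (f s) (mulJ (invJ (h s)) (invJ (dg s)))).
    apply/funext => u; apply: functional_extensionality_dep => y.
    rewrite /act /invJ /mulJ /= !invmxM ?unitmx_mul ?unitmx_inv ?invmxK ?(dU u y) ?(hU u y) //.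
    exact: fU.
  rewrite (gaugeJM _ i s x fU hdU sf (smoothJM shV sdV)).
  have -> : gaugeJ (fun s => mulJ (invJ (h s)) (invJ (dg s))) (jstar (gaugeL g L)) = b.
    apply/funext => j; apply/funext => u; apply: functional_extensionality_dep => y.
    rewrite (gaugeJM _ j u y hVU dVU shV sdV); rewrite /b.
    suff -> : gaugeJ (fun s => invJ (dg s)) (jstar (gaugeL g L)) = jstar L by [].
    apply/funext => j'; apply/funext => u'; apply: functional_extensionality_dep => y'.
    have -> : jstar (gaugeL g L) = gaugeJ dg (jstar L).
      apply/funext => i1; apply/funext => s1; apply: functional_extensionality_dep => x1.
      exact: jstar_gauge.
    rewrite -(gaugeJM _ j' u' y' dVU dU sdV sd).
    have -> : (fun s => mulJ (invJ (dg s)) (dg s)) = (fun=> @oneJ R N W).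
      apply/funext => s1; apply: functional_extensionality_dep => x1.
      by rewrite /mulJ /invJ mulVmx ?dU.
    rewrite /gaugeJ /oneJ invmx1 mul1mx !mulmx1.
    have -> : partialJ j' (fun=> @oneJ R N W) u' y' = 0.
      apply: mxcoef_inj => c d p; rewrite pred_mult => pn.
      by rewrite mxcoef_partialJ // DdirC /mxcoef mxE tcoef_zero.
    by rewrite oppr0 add0r.
  by [].
move=> i; rewrite E; split=> [|s].
  by apply: smoothJ_gauge fU sf _; have [] := Ok i.
by apply: (k_gauge hk) sK _ => j u; have [_] := Ok j; apply.
Qed.

End GaugeTransport.

(** * Equivalences of groupoids *)

Lemma cmp_cancel (A : groupoid) (a b c : ob A) (f : Defs.hom a b) (g h : Defs.hom b c) : cmp f g = cmp f h -> g = h.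
Proof. by move=> fgh; rewrite -[g]cmp1g -(cmpVg f) -cmpA fgh cmpA cmpVg cmp1g. Qed.

Lemma cancel_cmp (A : groupoid) (a b c : ob A) (f g : Defs.hom a b) (h : Defs.hom b c) : cmp f h = cmp g h -> f = g.
Proof. by move=> fgh; rewrite -[f]cmpg1 -(cmpgV h) cmpA fgh -cmpA cmpgV cmpg1. Qed.

(** Conjugating the image of [f] under [Q] by [eta] yields [f'] with the same image under [Q] as
    [f], once [F] is applied to it. Naturality of [eps] makes [Q] faithful and removes it. *)
Lemma equivalence_full (A B : groupoid) (F : functor A B) : is_equivalence F ->
  forall a b (f : Defs.hom (fob F a) (fob F b)), exists f', Defs.fmap F f' = f.
Proof.
move=> [Q [[eta etaP] [eps epsP]]] a b f.
pose f' := cmp (ivg (eta a)) (cmp (Defs.fmap Q f) (eta b)).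
exists f'; have QF : Defs.fmap Q (Defs.fmap F f') = Defs.fmap Q f.
  apply: (cancel_cmp (h := eta b)); rewrite [LHS]etaP /=.
  by rewrite /f' cmpA cmpgV cmp1g.
have e1 : cmp (Defs.fmap F (Defs.fmap Q f)) (eps _) = cmp (eps _) f := epsP _ _ f.
have e2 : cmp (Defs.fmap F (Defs.fmap Q (Defs.fmap F f'))) (eps _) = cmp (eps _) (Defs.fmap F f') := epsP _ _ _.
by apply: (cmp_cancel (f := eps (fob F a))); rewrite -e1 -e2 QF.
Qed.

Lemma equivalence_essentially_surjective (A B : groupoid) (F : functor A B) :
  is_equivalence F -> forall b, exists a, inhabited (Defs.hom (fob F a) b).
Proof. by move=> [Q [_ [eps _]]] b; exists (fob Q b); split; exact: eps b. Qed.

Theorem corollary5p8 (R : realType) (N : nat) (G : matrix_lie_group R N)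
    (hG : simply_connected (mlg_set G)) (B : invariant_form (mlg_set G))
    (W : one_form R) (k : set (defect_mx N W))
    (hk : lie_subalgebra G k) (hiso : isotropic B k) :
  is_equivalence (forget G k) <->
  (forall h : 'rV[R]_2 -> defect_mx N W, smooth_defect G h ->
    exists! L : 'I_2 -> coefficient N W, lax_object G k L h).
Proof.
split=> [eqF h sh|lax].
  have [o [[a [Ga Ea]]]] := equivalence_essentially_surjective eqF (exist _ h sh : ob (F2d G k)).
  have Eh : h = act a (sval o).2 by rewrite -forget_obE -Ea.
  have Lh : lax_object G k (gaugeL a.1 (sval o).1) h.
    rewrite Eh; apply: (lax_object_act hk (svalP o) Ga).
    by rewrite -Eh.
  exists (gaugeL a.1 (sval o).1); split=> // L LL.
  pose o1 : obLax G k := exist _ (gaugeL a.1 (sval o).1, h) Lh.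
  pose o2 : obLax G k := exist _ (L, h) LL.
  (* Both objects lie over [h], so the unit transformation is a morphism between their images.
     [forget] leaves the underlying pair of maps untouched, so any lift is again [gauge1], and
     [gaugeL1] compares the two forms. *)
  have E12 : is_gauge G k (@gauge1 R N W) /\ sval (forget_ob o2) = act (@gauge1 R N W) (sval (forget_ob o1)).
    by split; [exact: is_gauge1|rewrite !forget_obE act1].
  have [q /(congr1 sval) fq] := equivalence_full eqF (exist _ (@gauge1 R N W) E12 : Defs.hom (fob (forget G k) o1) (fob (forget G k) o2)).
  have qE : sval q = @gauge1 R N W by exact: fq.
  by have [_ Lq _] := svalP q; move: Lq; rewrite qE gaugeL1.
(* A choice of the form over each field; [secU] records that any other solution coincides with
   it. *)
pose sec (h : ob2d G W) := projT1 (cid (lax (sval h) (svalP h))).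
have secP h : lax_object G k (sec h) (sval h) by have [] := projT2 (cid (lax (sval h) (svalP h))).
have secU h L : lax_object G k L (sval h) -> sec h = L.
  by have [_] := projT2 (cid (lax (sval h) (svalP h))); apply.
pose Qob (h : ob (F2d G k)) : ob (FLax G k) := exist _ (sec h, sval h) (secP h).
have Qhom (h h' : ob (F2d G k)) (f : Defs.hom h h') :
    [/\ is_gauge G k (sval f), (sval (Qob h')).1 = gaugeL (sval f).1 (sval (Qob h)).1
      & (sval (Qob h')).2 = act (sval f) (sval (Qob h)).2].
  case: f => [a [Ga Ea]] /=; split=> //; apply: secU; rewrite Ea.
  by apply: (lax_object_act hk (secP h) Ga); rewrite -Ea; exact: svalP.
pose Qmap (h h' : ob (F2d G k)) (f : Defs.hom h h') : Defs.hom (Qob h) (Qob h') :=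
  exist _ (sval f) (Qhom h h' f).
(* [Qmap] keeps the underlying gauge transformation, and a morphism is determined by it, so the
   functor laws are immediate. *)
have Q1 h : Qmap h h (idg h) = idg (Qob h) by exact: sig_eq.
have QM h h' h'' (f : Defs.hom h h') (f' : Defs.hom h' h'') :
    Qmap h h'' (cmp f f') = cmp (Qmap h h' f) (Qmap h' h'' f') by exact: sig_eq.
pose Q := @Functor (F2d G k) (FLax G k) Qob Qmap Q1 QM.
exists Q; split.
  (* By [secU] the object rebuilt from its field has the same underlying pair as [o]. Linking them
     by the unit transformation avoids transporting morphisms along an equality of objects. *)
  have etaP (o : ob (FLax G k)) :
      [/\ is_gauge G k (@gauge1 R N W), (sval o).1 = gaugeL (@gauge1 R N W).1 (sval (Qob (forget_ob o))).1
        & (sval o).2 = act (@gauge1 R N W) (sval (Qob (forget_ob o))).2].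
    split; first exact: is_gauge1.
      rewrite gaugeL1; apply/esym/secU; rewrite forget_obE; exact: svalP o.
    by rewrite act1 /= forget_obE.
  exists (fun o => exist _ (@gauge1 R N W) (etaP o)) => o o' f; apply: sig_eq.
  by rewrite /= gaugeM1 gauge1M.
have epsP (h : ob (F2d G k)) :
    is_gauge G k (@gauge1 R N W) /\ sval h = act (@gauge1 R N W) (sval (forget_ob (Qob h))).
  by split; [exact: is_gauge1|rewrite act1 forget_obE].
exists (fun h => exist _ (@gauge1 R N W) (epsP h)) => h h' f; apply: sig_eq.
by rewrite /= gaugeM1 gauge1M.
Qed.
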